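(* Let $X$ be a subgaussian random Hermitian $m\times m$ matrix (with constants $b_0,b_1,b_2$) and let $\|\xi\|_{\psi_2}<\infty$. There exist constants $C>0$, $c>0$ (depending only on $b_0,b_1,b_2$) such that the following holds. For all $t>0$ and $\lambda>0$ such that $\tau_n\le c\lambda^2n$, for all $S\in\mathcal S$ and for all $\varepsilon\in[0,1]$, with probability at least $1-e^{-t}$ $$\|\hat\rho^{\varepsilon}-S\|_{L_2(\Pi)}^2\le(1+\lambda)\|S-\rho\|_{L_2(\Pi)}^2+C\max\Bigl\{\varepsilon\Bigl(\|\log S\|\wedge\log\frac m\varepsilon\Bigr),\ \sigma_\xi\sqrt{\frac{mt_m}n},\ \frac{mt_m}{n\lambda},\ (c_\xi\vee\sqrt m)\frac{\sqrt m\,t_{n,m}}n\Bigr\}$$ and $$\|\hat\rho^{\varepsilon}-\rho\|_{L_2(\Pi)}^2\le(1+\lambda)\|S-\rho\|_{L_2(\Pi)}^2+C\max\Bigl\{\varepsilon\Bigl(\|\log S\|\wedge\log\frac m\varepsilon\Bigr),\ \sigma_\xi\sqrt{\frac{mt_m}n},\ \frac{mt_m}{n\lambda},\ (c_\xi\vee\sqrt m)\frac{\sqrt m\,t_{n,m}}n\Bigr\}.$$ In particular, $$\|\hat\rho^{\varepsilon}-\rho\|_{L_2(\Pi)}^2\le C\max\Bigl\{\varepsilon\Bigl(\|\log\rho\|\wedge\log\frac m\varepsilon\Bigr),\ \sigma_\xi\sqrt{\frac{mt_m}n},\ (c_\xi\vee\sqrt m)\frac{\sqrt m\,t_{n,m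}}n\Bigr\}.$$
   Context: Notation: $\mathbb M_m(\mathbb C)$ is the set of complex $m\times m$ matrices, $\langle A,B\rangle=\mathrm{tr}(AB^* )$, $\|\cdot\|$ is the operator norm, $\|A\|_2=\langle A,A\rangle^{1/2}$. $\mathcal S=\{S\in\mathbb M_m(\mathbb C):S=S^*,\ S\ge0,\ \mathrm{tr}(S)=1\}$. $a\vee b=\max(a,b)$, $a\wedge b=\min(a,b)$. For a random variable $\eta$, $\|\eta\|_{\psi_2}=\inf\{C>0:\mathbb E(e^{|\eta|^2/C^2}-1)\le1\}$. Model: $\rho\in\mathcal S$ is unknown; $X,X_1,\dots,X_n$ are i.i.d. random Hermitian $m\times m$ matrices with distribution $\Pi$; $\xi,\xi_1,\dots,\xi_n$ are i.i.d. real random variables independent of the $X$'s with $\mathbb E\xi=0$, $\sigma_\xi^2=\mathbb E\xi^2$; $Y_j=\mathrm{tr}(\rho X_j)+\xi_j$. For $\varepsilon\ge0$, $$\hat\rho^{\varepsilon}\in\operatorname{argmin}_{S\in\mathcal S}\Bigl[n^{-1}\sum_{j=1}^n(Y_j-\mathrm{tr}(SX_j))^2+\varepsilon\,\mathrm{tr}(S\log S)\Bigr]$$ (with $0\log0=0$). $\|A\|_{L_2(\Pi)}^2=\mathbb E|\langle A,X\rangle|^2$. $X$ is subgaussian if, for fixed constants $b_0,b_1,b_2>0$: for all Hermitian $A$, $\mathbb Ee^{s\langle A,X\rangle}\le e^{s^2b_0^2\|A\|_{L_2(\Pi)}^2/2}$ for all $s\in\mathbb R$ (hence $\mathbb EX=0$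 and $\|\langle A,X\rangle\|_{\psi_2}\le b_1\|A\|_{L_2(\Pi)}$ for all $A\in\mathbb M_m(\mathbb C)$), and $\|A\|_{L_2(\Pi)}\le b_2\|A\|_2$ for all $A\in\mathbb M_m(\mathbb C)$. $t_m=t+\log(2m)$, $\tau_n=t+\log\log_2(2n)$, $t_{n,m}=\tau_n\log n\vee t_m$, $c_\xi=\|\xi\|_{\psi_2}\log\frac{\|\xi\|_{\psi_2}}{\sigma_\xi}$. Conventions: $\|\log S\|=+\infty$ if $\mathrm{rank}(S)<m$; for $\varepsilon=0$ the term $\varepsilon(\|\log S\|\wedge\log(m/\varepsilon))$ is read as $0$. *)

(* Defs.v *)
From HB Require Import structures.
From mathcomp Require Import all_boot all_order all_algebra.
From mathcomp Require Import all_classical all_reals all_analysis.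
From mathcomp Require Import complex.

Set Implicit Arguments.
Unset Strict Implicit.
Unset Printing Implicit Defensive.

Import Order.TTheory GRing.Theory Num.Theory.

Local Open Scope classical_set_scope.
Local Open Scope ring_scope.
Local Open Scope sesquilinear_scope.

Section Matrices.
Variable R : realType.
Local Notation C := R[i].

Definition trdot {m p} (A B : 'M[C]_(m, p)) : C := \tr (A *m B^t*).

(* For column vectors this is the Euclidean norm. *)
Definition norm2 {m p} (A : 'M[C]_(m, p)) : R :=
  Num.sqrt (complex.Re (trdot A A)).

Definition opnorm {m} (A : 'M[C]_m) : R :=
  sup [set norm2 (A *m x) | x in [set x : 'cV[C]_m | norm2 x <= 1]].

(* [0 <= z] in [R[i]] says that [z] is real and nonnegative. *)
Definition psdmx {m} (A : 'M[C]_m) : Prop :=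
  forall u : 'rV[C]_m, 0 <= (u *m A *m u^t*) 0 0.

Definition states {m} : set 'M[C]_m :=
  [set S | [/\ S \is hermsymmx, psdmx S & \tr S = 1]].

(* Functional calculus, meaningful for Hermitian [A], whose spectral
   decomposition is A = P^-1 diag(spectral_diag A) P with P = spectralmx A. *)
Definition mxfun {m} (f : R -> R) (A : 'M[C]_m) : 'M[C]_m :=
  invmx (spectralmx A)
    *m diag_mx (map_mx (fun z : C => (f (complex.Re z))%:C%C) (spectral_diag A))
    *m spectralmx A.

(* As [ln 0 = 0], the zero eigenvalues of [S] contribute 0 to tr(S log S);
   only [norm_log] has to treat singular matrices separately. *)
Definition mxlog {m} (S : 'M[C]_m) : 'M[C]_m := mxfun (@ln R) S.

Definition trSlogS {m} (S : 'M[C]_m) : R := complex.Re (\tr (S *m mxlog S)).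

Definition norm_log {m} (S : 'M[C]_m) : \bar R :=
  if (\rank S < m)%N then +oo%E else (opnorm (mxlog S))%:E.

(* The minimum is finite, being bounded by a real number; for [eps = 0] the
   whole term is 0. *)
Definition entropy_error {m} (eps : R) (S : 'M[C]_m) : R :=
  eps * fine (mine (norm_log S) (ln (m%:R / eps))%:E).

(* Generators of the Borel sigma-algebra of 'M[C]_m = R^(2 m^2): preimages of
   Borel sets under the real and imaginary parts of the entries. *)
Definition mx_cylinders (m : nat) : set (set 'M[C]_m) :=
  [set B | exists (i j : 'I_m) (U : set R), measurable U /\
     (B = [set A : 'M[C]_m | U (complex.Re (A i j))] \/
      B = [set A : 'M[C]_m | U (complex.Im (A i j))])].

End Matrices.

HB.instance Definition _ (R : realType) := isPointed.Build R[i] 0.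

Notation borel_mx R m := (g_sigma_algebraType (@mx_cylinders R m)).

Section Probability.
Context {d : measure_display} {T : measurableType d} {R : realType}.
Variable P : probability T R.
Local Notation C := R[i].

(* The event [A] need not be measurable: it is required to contain a measurable
   event of probability at least [p]. *)
Definition with_prob_ge (p : R) (A : set T) : Prop :=
  exists E : set T, [/\ measurable E, (p%:E <= P E)%E & E `<=` A].

Definition sigma_rv {d'} {T' : measurableType d'} (X : T -> T') : set (set T) :=
  preimage_set_system setT X measurable.

Definition mutually_independent {I : finType} (F : I -> set (set T)) : Prop :=
  forall (J : {set I}) (E : I -> set T), (forall i, i \in J -> F i (E i)) ->
    P (\bigcap_(i in [set` J]) E i) = (\prod_(i in J) P (E i))%E.

Definition same_law {d'} {T' : measurableType d'} (X Y : {RV P >-> T'}) : Prop :=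
  forall B, measurable B -> distribution P X B = distribution P Y B.

Definition psi2_norm (eta : T -> R) : \bar R :=
  ereal_inf [set c%:E | c in [set c : R | 0 < c /\
    ('E_P[(fun w => expR (`|eta w| ^+ 2 / c ^+ 2) - 1)%R] <= 1)%E]].

Definition sigma_noise (xi : T -> R) : R :=
  Num.sqrt (fine 'E_P[(fun w => xi w ^+ 2)%R]%E).

(* For noise that is a.s. zero this is 0, [ln] and the inverse being 0 at 0. *)
Definition c_noise (xi : T -> R) : R :=
  let s := fine (psi2_norm xi) in s * ln (s / sigma_noise xi).

Definition sqnormL2 {m} (X : T -> 'M[C]_m) (A : 'M[C]_m) : \bar R :=
  'E_P[(fun w => Normc.normc (trdot A (X w)) ^+ 2)%R]%E.

Definition normL2 {m} (X : T -> 'M[C]_m) (A : 'M[C]_m) : R :=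
  Num.sqrt (fine (sqnormL2 X A)).

(* <A, X> is real for Hermitian A, X, hence the real part in the second
   clause; the first one makes [normL2] the genuine L2 norm. *)
Definition subgaussian {m} (X : T -> 'M[C]_m) (b0 b1 b2 : R) : Prop :=
  [/\ forall A : 'M[C]_m, (sqnormL2 X A < +oo)%E,
      forall A : 'M[C]_m, A \is hermsymmx -> forall s : R,
        ('E_P[(fun w => expR (s * complex.Re (trdot A (X w))))%R] <=
          (expR (s ^+ 2 * b0 ^+ 2 * normL2 X A ^+ 2 / 2))%:E)%E,
      forall A : 'M[C]_m,
        (psi2_norm (fun w => Normc.normc (trdot A (X w))) <=
          (b1 * normL2 X A)%:E)%E &
      forall A : 'M[C]_m, normL2 X A <= b2 * norm2 A].

(* [X] and [xi] are generic copies of the design and of the noise, used only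
   through their laws; independence is imposed on the sample alone. *)
Record trace_regression {m n : nat} (rho : 'M[C]_m)
    (X : {RV P >-> borel_mx R m}) (Xs : 'I_n -> {RV P >-> borel_mx R m})
    (xi : {RV P >-> R}) (xis : 'I_n -> {RV P >-> R}) : Prop := {
  tr_state : states rho;
  tr_X_herm : forall w, (X w : 'M[C]_m) \is hermsymmx;
  tr_Xs_herm : forall j w, (Xs j w : 'M[C]_m) \is hermsymmx;
  tr_Xs_law : forall j, same_law (Xs j) X;
  tr_xis_law : forall j, same_law (xis j) xi;
  tr_indep : mutually_independent (fun k : 'I_n + 'I_n =>
    match k with inl j => sigma_rv (Xs j) | inr j => sigma_rv (xis j) end);
  tr_xi_centered : ('E_P[xi] = 0)%E }.

End Probability.

Section Estimator.
Variables (R : realType) (m n : nat).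
Local Notation C := R[i].

(* The traces below are real for Hermitian arguments. *)
Definition response (rho : 'M[C]_m) (x : 'I_n -> 'M[C]_m) (e : 'I_n -> R)
    (j : 'I_n) : R :=
  complex.Re (\tr (rho *m x j)) + e j.

Definition penalized_risk (x : 'I_n -> 'M[C]_m) (y : 'I_n -> R) (eps : R)
    (S : 'M[C]_m) : R :=
  n%:R^-1 * (\sum_(j < n) (y j - complex.Re (\tr (S *m x j))) ^+ 2)
    + eps * trSlogS S.

Definition risk_argmin (x : 'I_n -> 'M[C]_m) (y : 'I_n -> R) (eps : R) :
    set 'M[C]_m :=
  [set S | states S /\
    forall S', states S' -> penalized_risk x y eps S <= penalized_risk x y eps S'].

End Estimator.

Section Rates.
Variable R : realType.

Definition t_m (t : R) (m : nat) : R := t + ln (2 * m%:R).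

Definition tau_n (t : R) (n : nat) : R := t + ln (ln (2 * n%:R) / ln 2).

Definition t_nm (t : R) (n m : nat) : R :=
  Num.max (tau_n t n * ln n%:R) (t_m t m).

Definition rate_noise (t : R) (n m : nat) (sigma : R) : R :=
  sigma * Num.sqrt (m%:R * t_m t m / n%:R).

Definition rate_lambda (t : R) (n m : nat) (lambda : R) : R :=
  m%:R * t_m t m / (n%:R * lambda).

Definition rate_fast (t : R) (n m : nat) (cxi : R) : R :=
  Num.max cxi (Num.sqrt m%:R) * (Num.sqrt m%:R * t_nm t n m / n%:R).

End Rates.

(* Main.v *)
(* A minimizer [rhohat] satisfies a first-order condition in which convexity of the
   entropy leaves only the difference of two entropies, at most ln m; and
   eps * ln m <= [entropy_error eps S].  What remains is to control, uniformly over
   differences A of states, the gap between the empirical and population L2 norms of A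
   and the noise average of <A, X_j>.

   Rounding eigenvectors at random to a grid writes every such A as a mean of atoms from
   a finite family with log-cardinality O(m log (2m)).  Drawing N atoms independently
   (Maurey) gives a random mean B with E q(B) = (1 - 1/N) q(A) + (1/N) E q(atom) for
   every quadratic form q.  For q the difference of the two squared norms, this transfers
   a union bound over the finitely many B to A, the atoms entering only with weight 1/N;
   choosing N according to the norm of A gives the rate m t_m / (n lambda).

   The noise average is linear in A, hence maximal at an atom; there it is subgaussian
   conditionally on the noise, with a variance controlled by the sum of the xi_j ^ 2. *)
Require Import Defs.
From HB Require Import structures.
From mathcomp Require Import all_boot all_order all_algebra.
From mathcomp Require Import all_classical all_reals all_analysis.
From mathcomp Require Import finmap measurable_realfun complex ring lra.

Set Implicit Arguments.
Unset Strict Implicit.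
Unset Printing Implicit Defensive.

Import Order.TTheory GRing.Theory Num.Theory.
Import numFieldNormedType.Exports.

Local Open Scope classical_set_scope.
Local Open Scope ring_scope.

(** A net of the whole set of states would have log-cardinality of order m^2; rank-one atoms cost
    only m log (2m), and convexity does the rest. The difference q - Q of the two squared norms is
    not a convex function of A, however, so its size is not controlled by its values at the atoms,
    where moreover only an error of order sqrt D is available, with D = [level_width] / n. Averaging
    N atoms divides the atoms' error by N but raises the entropy to N D, so that a mean B deviates
    by about (Q(B) + kap/N)(sqrt (N D) + N D), where kap bounds Q on atoms. The scale is relative
    because the square of <B, X> is subexponential at scale Q(B); kap/N is the size of the sampling
    variance and keeps the scale positive for degenerate B. With N near kap / (Q(A) + D/mu), Young's
    inequality leaves mu Q(A) plus a multiple of D/mu: linear in D, with an arbitrary relative error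
    mu. All probabilistic bounds come from one Markov inequality for a weighted sum of exponential
    moments, so the event is fixed before lambda and S are chosen. *)

Section ScalarInequalities.
Variable R : realType.
Implicit Types a c s x y z : R.

Lemma expR_sub1_le y : expR y - 1 <= y * expR y.
Proof.
have := expR_ge1Dx (- y); rewrite expRN => h.
have e0 := expR_gt0 y.
have : (1 - y) * expR y <= 1 by rewrite -ler_pdivlMr// mul1r.
lra.
Qed.

Lemma expR_le_quadratic y : expR y <= 1 + y + y ^+ 2 * expR `|y|.
Proof.
have h1 := expR_sub1_le y.
have h2 := expR_ge1Dx y.
have h3 : expR y - 1 - y <= y * (expR y - 1) by lra.
suff : y * (expR y - 1) <= y ^+ 2 * expR `|y| by lra.
have [y0|y0] := lerP 0 y.
  by rewrite expr2 -mulrA ger0_norm// ler_wpM2l.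
rewrite ltr0_norm//.
have e1 : 1 <= expR (- y) by rewrite leNgt expR_lt1 -leNgt; lra.
have h4 : y ^+ 2 * 1 <= y ^+ 2 * expR (- y) by rewrite ler_wpM2l// sqr_ge0.
apply: le_trans h4; rewrite mulr1 expr2 (ler_wnM2l (ltW y0))//; lra.
Qed.

Lemma sqr_le_expR a : 0 <= a -> a ^+ 2 <= 16 * expR (a / 2).
Proof.
move=> a0; have -> : a / 2 = a / 4 + a / 4 by field.
rewrite expRD; have := expR_ge1Dx (a / 4) => h.
have : (a / 4) ^+ 2 <= expR (a / 4) * expR (a / 4).
  by rewrite -expr2 lerXn2r// ?nnegrE; lra.
rewrite expr2; nra.
Qed.

(** The range of [s] spends at most half of the exponent z^2/c^2; the other half absorbs the squared
    factor of the remainder through [sqr_le_expR]. *)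
Lemma expR_square_le c s z : 0 < c -> `|s| <= (2 * c ^+ 2)^-1 ->
  expR (s * z ^+ 2) <=
    1 + s * z ^+ 2 + 16 * s ^+ 2 * c ^+ 4 * expR (z ^+ 2 / c ^+ 2).
Proof.
move=> c0 hs.
apply: (le_trans (expR_le_quadratic _)); rewrite lerD2l.
have c20 : 0 < c ^+ 2 by rewrite exprn_gt0.
set a := z ^+ 2 / c ^+ 2.
have a0 : 0 <= a by rewrite divr_ge0 ?sqr_ge0.
have za : z ^+ 2 = c ^+ 2 * a by rewrite /a mulrCA divff ?mulr1// gt_eqF.
have hsz : `|s * z ^+ 2| <= a / 2.
  rewrite normrM (ger0_norm (sqr_ge0 z)) za.
  have : `|s| * (c ^+ 2 * a) <= (2 * c ^+ 2)^-1 * (c ^+ 2 * a).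
    by rewrite ler_wpM2r// mulr_ge0// ltW.
  by rewrite [X in _ <= X -> _](_ : _ = a / 2)//; field; rewrite gt_eqF.
have h1 : expR `|s * z ^+ 2| <= expR (a / 2) by rewrite ler_expR.
have -> : (s * z ^+ 2) ^+ 2 = s ^+ 2 * c ^+ 4 * a ^+ 2 by rewrite za; ring.
have -> : 16 * s ^+ 2 * c ^+ 4 * expR a =
   s ^+ 2 * c ^+ 4 * ((16 * expR (a / 2)) * expR (a / 2)).
  have -> : expR a = expR (a / 2) * expR (a / 2) by rewrite -expRD -splitr.
  by ring.
have sc0 : 0 <= s ^+ 2 * c ^+ 4.
  by rewrite mulr_ge0 ?sqr_ge0// exprn_ge0// ltW.
rewrite -mulrA ler_wpM2l// ler_pM ?sqr_ge0 ?expR_ge0//.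
exact: sqr_le_expR.
Qed.

Lemma expR1_le4 : expR 1 <= 4 :> R.
Proof.
have -> : (1 : R) = 1 / 2 + 1 / 2 by field.
rewrite expRD.
have := expR_ge1Dx (- (1 / 2 : R)); rewrite expRN => h.
have e0 := expR_gt0 (1 / 2 : R).
have : expR (1 / 2 : R) <= 2.
  by rewrite -[leLHS]invrK -[leRHS]invrK lef_pV2 ?posrE ?invr_gt0//; lra.
nra.
Qed.

(** Where s a <= 1 the cost is linear. On the tail a > 1/s only three quarters of the exponent [a]
    are spent, and the last quarter yields the small factor [expR (- (4 * s)^-1)]. *)
Lemma expR_scaled_le s a : 0 < s -> s <= 1 / 4 -> 0 <= a ->
  expR (s * a) <= 1 + s * (4 * a + 2 * (expR a * expR (- (4 * s)^-1))).
Proof.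
move=> s0 s4 a0.
have := expR_sub1_le (s * a).
suff : a * expR (s * a) <= 4 * a + 2 * (expR a * expR (- (4 * s)^-1)).
  by move=> h; have := ler_wpM2l (ltW s0) h; lra.
have e0 : 0 <= expR a * expR (- (4 * s)^-1) by rewrite mulr_ge0 ?expR_ge0.
have [sa|sa] := lerP (s * a) 1.
  have h : expR (s * a) <= 4 by apply: le_trans expR1_le4; rewrite ler_expR.
  by have := ler_wpM2l a0 h; lra.
suff : a * expR (s * a) <= 2 * (expR a * expR (- (4 * s)^-1)) by lra.
have ea : a <= 2 * expR (a / 2) by have := expR_ge1Dx (a / 2); lra.
have h1 : expR (s * a) <= expR (a / 4).
  by rewrite ler_expR; have := ler_wpM2r a0 s4; lra.
have h2 : expR (a / 2) * expR (a / 4) <= expR a * expR (- (4 * s)^-1).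
  rewrite -!expRD ler_expR.
  suff : (4 * s)^-1 <= a / 4 by lra.
  rewrite invfM mulrC ler_pM2r ?invr_gt0//.
  by rewrite -[leLHS]mul1r ler_pdivrMr// mulrC ltW.
apply: (@le_trans _ _ (2 * expR (a / 2) * expR (a / 4))).
  by rewrite ler_pM// ?expR_ge0.
by rewrite -mulrA ler_pM2l.
Qed.

Lemma ln_ge_1subV x : 0 < x -> 1 - x^-1 <= ln x.
Proof.
move=> x0; have := @le_ln1Dx R (x^-1 - 1).
have -> : 1 + (x^-1 - 1) = x^-1 by ring.
rewrite lnV ?posrE// => h.
have xV0 : 0 < x^-1 by rewrite invr_gt0.
have : - 1 < x^-1 - 1 by lra.
by move=> /h; lra.
Qed.

Lemma xlnx_ge_tangent x y : 0 <= x -> 0 < y -> x * ln y + x - y <= x * ln x.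
Proof.
rewrite le_eqVlt => /predU1P[<-|x0] y0; first by rewrite !mul0r; lra.
have := ln_ge_1subV (divr_gt0 x0 y0).
rewrite ln_div ?posrE// invf_div => h.
have := ler_wpM2l (ltW x0) h.
rewrite mulrBr mulr1 mulrCA divff ?gt_eqF// mulr1; lra.
Qed.

(** Average the tangent line at the mean; a zero mean, where there is no tangent, forces every term
    to vanish. *)
Lemma jensen_xlnx (I : finType) (w x : I -> R) :
  (forall i, 0 <= w i) -> (forall i, 0 <= x i) -> \sum_i w i = 1 ->
  (\sum_i w i * x i) * ln (\sum_i w i * x i) <= \sum_i w i * (x i * ln (x i)).
Proof.
move=> w0 x0 w1; set y := \sum_i w i * x i.
have wx0 i : 0 <= w i * x i by rewrite mulr_ge0.
have y0 : 0 <= y by apply: sumr_ge0.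
have [yz|yp] := eqVneq y 0.
  rewrite yz mul0r big1// => i _.
  have /eqP : w i * x i = 0 by apply: (psumr_eq0P _ yz).
  rewrite mulf_eq0 => /orP[/eqP->|/eqP->]; by rewrite ?(mul0r, mulr0).
have {}yp : 0 < y by rewrite lt_def yp.
apply: (@le_trans _ _ (\sum_i w i * (x i * ln y + x i - y))).
  rewrite (eq_bigr (fun i => w i * x i * ln y + w i * x i - w i * y)); last first.
    by move=> i _; ring.
  by rewrite sumrB big_split/= -!mulr_suml w1 -/y; lra.
by apply: ler_sum => i _; rewrite ler_wpM2l// xlnx_ge_tangent.
Qed.

End ScalarInequalities.

(** * Expectations under finite product measures *)

Section ProductWeights.
Variables (R : realType) (J I : finType) (p : J -> I -> R).
Hypothesis p1 : forall j, \sum_i p j i = 1.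

Definition prod_weight (f : {ffun J -> I}) : R := \prod_j p j (f j).

Lemma prod_weight_sum (g : J -> I -> R) :
  \sum_f prod_weight f * \prod_j g j (f j) = \prod_j \sum_i p j i * g j i.
Proof.
rewrite (bigA_distr_bigA (fun j i => p j i * g j i)).
by apply: eq_bigr => f _; rewrite big_split.
Qed.

Lemma prod_weight_sum1 : \sum_f prod_weight f = 1.
Proof.
transitivity (\sum_f prod_weight f * \prod_(j : J) (1 : R)).
  by apply: eq_bigr => f _; rewrite big1_eq mulr1.
rewrite (prod_weight_sum (fun _ _ => 1)); apply: big1 => j _.
by under eq_bigr do rewrite mulr1; exact: p1.
Qed.

Lemma prod_weight_marginal j0 (u : I -> R) :
  \sum_f prod_weight f * u (f j0) = \sum_i p j0 i * u i.
Proof.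
transitivity (\sum_f prod_weight f * \prod_j (if j == j0 then u (f j) else 1)).
  apply: eq_bigr => f _; congr (_ * _).
  by rewrite (bigD1 j0)//= eqxx big1 ?mulr1// => j /negbTE->.
rewrite (prod_weight_sum (fun j i => if j == j0 then u i else 1)).
rewrite (bigD1 j0)//= eqxx [X in _ * X]big1 ?mulr1// => j /negbTE->.
by under eq_bigr do rewrite mulr1; exact: p1.
Qed.

Lemma prod_weight_pair j0 j1 (u v : I -> R) : j0 != j1 ->
  \sum_f prod_weight f * (u (f j0) * v (f j1)) =
  (\sum_i p j0 i * u i) * (\sum_i p j1 i * v i).
Proof.
move=> j01; have j10 : (j1 == j0) = false by rewrite eq_sym; apply/negbTE.
transitivity (\sum_f prod_weight f *
    \prod_j (if j == j0 then u (f j) else if j == j1 then v (f j) else 1)).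
  apply: eq_bigr => f _; congr (_ * _).
  rewrite (bigD1 j0)//= eqxx (bigD1 j1)/=; last by rewrite j10.
  rewrite j10 eqxx big1 ?mulr1// => j /andP[/negbTE-> /negbTE->].
  by [].
rewrite (prod_weight_sum
  (fun j i => if j == j0 then u i else if j == j1 then v i else 1)).
rewrite (bigD1 j0)//= eqxx (bigD1 j1)/=; last by rewrite j10.
rewrite j10 eqxx [X in _ * (_ * X)]big1 ?mulr1// => j /andP[/negbTE-> /negbTE->].
by under eq_bigr do rewrite mulr1; exact: p1.
Qed.

End ProductWeights.

(** * Second moments of means of independent draws *)

Section Maurey.
Variables (R : realType) (I : finType) (p : I -> R) (N : nat).
Hypothesis p1 : \sum_i p i = 1.

Definition iid_weight (f : {ffun 'I_N.+1 -> I}) : R :=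
  prod_weight (fun _ => p) f.

Lemma iid_weight_sum1 : \sum_f iid_weight f = 1.
Proof. exact: (prod_weight_sum1 (fun _ => p1)). Qed.

(** Of the (N+1)^2 pairs of draws, N+1 coincide and give the second moment, the others the squared
    mean. It matters that this is an equality: the weights are the same for every quadratic form, so
    it can be subtracted between two forms. *)
Lemma iid_weight_mean_square (y : I -> R) :
  \sum_f iid_weight f * (N.+1%:R^-1 * \sum_l y (f l)) ^+ 2 =
  (1 - N.+1%:R^-1) * (\sum_i p i * y i) ^+ 2
    + N.+1%:R^-1 * \sum_i p i * y i ^+ 2.
Proof.
set a := \sum_i p i * y i; set b := \sum_i p i * y i ^+ 2.
have N0 : (N.+1%:R : R) != 0 by rewrite pnatr_eq0.
have pair l l' : \sum_f iid_weight f * (y (f l) * y (f l')) =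
    if l == l' then b else a ^+ 2.
  case: eqVneq => [<-|ll'].
    transitivity (\sum_f iid_weight f * (fun i => y i ^+ 2) (f l)); last first.
      exact: (prod_weight_marginal (fun _ => p1)).
    by apply: eq_bigr => f _; rewrite expr2.
  by rewrite expr2; exact: (prod_weight_pair (fun _ => p1) y y ll').
transitivity (N.+1%:R^-1 ^+ 2 *
    \sum_(l < N.+1) \sum_(l' < N.+1) \sum_f iid_weight f * (y (f l) * y (f l'))).
  rewrite exchange_big/=; under [in RHS]eq_bigr do rewrite exchange_big/=.
  rewrite exchange_big mulr_sumr; apply: eq_bigr => f _ /=.
  rewrite exprMn mulrCA; congr (_ * _).
  rewrite expr2 mulr_suml mulr_sumr exchange_big; apply: eq_bigr => l _ /=.
  by rewrite !mulr_sumr.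
under eq_bigr do under eq_bigr do rewrite pair.
transitivity (N.+1%:R^-1 ^+ 2 * \sum_(l < N.+1) (b + N%:R * a ^+ 2)).
  congr (_ * _); apply: eq_bigr => l _; rewrite (bigD1 l)//= eqxx; congr (_ + _).
  under eq_bigr => l' /negbTE h do rewrite eq_sym h.
  rewrite sumr_const mulr_natl; congr (_ *+ _).
  transitivity #|predC1 l|; last by rewrite cardC1 card_ord.
  by apply: eq_card => l'; rewrite !inE.
rewrite sumr_const card_ord -mulr_natl -[N.+1%:R]natr1.
by field; rewrite natr1.
Qed.

End Maurey.

Local Open Scope sesquilinear_scope.

(** * Complex numbers through real and imaginary parts *)

Section ComplexParts.
Variable R : realType.
Local Notation C := R[i].
Implicit Types (x : R) (z w : C).

Definition sqmod z : R := complex.Re z ^+ 2 + complex.Im z ^+ 2.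

Lemma sqmod_ge0 z : 0 <= sqmod z.
Proof. by rewrite addr_ge0 ?sqr_ge0. Qed.

Lemma ReD z w : complex.Re (z + w) = complex.Re z + complex.Re w.
Proof. by case: z w => [a b] [c d]. Qed.

Lemma ImD z w : complex.Im (z + w) = complex.Im z + complex.Im w.
Proof. by case: z w => [a b] [c d]. Qed.

Lemma Re_sum (I : Type) (r : seq I) (Q : pred I) (F : I -> C) :
  complex.Re (\sum_(i <- r | Q i) F i) = \sum_(i <- r | Q i) complex.Re (F i).
Proof. by apply: (big_morph (@complex.Re R)) => // ? ?; exact: ReD. Qed.

Lemma Im_sum (I : Type) (r : seq I) (Q : pred I) (F : I -> C) :
  complex.Im (\sum_(i <- r | Q i) F i) = \sum_(i <- r | Q i) complex.Im (F i).
Proof. by apply: (big_morph (@complex.Im R)) => // ? ?; exact: ImD. Qed.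

Lemma Re_rscale x z : complex.Re (x%:C%C * z) = x * complex.Re z.
Proof. by case: z => a b /=; rewrite mul0r subr0. Qed.

Lemma Im_rscale x z : complex.Im (x%:C%C * z) = x * complex.Im z.
Proof. by case: z => a b /=; rewrite mul0r addr0. Qed.

Lemma mulcJ z : z * z^* = (sqmod z)%:C%C.
Proof.
case: z => a b; apply/eqP; rewrite eq_complex /sqmod /=.
by apply/andP; split; apply/eqP; ring.
Qed.

Lemma ReJ z : complex.Re (z^*) = complex.Re z.
Proof. by case: z. Qed.

Lemma ImJ z : complex.Im (z^*) = - complex.Im z.
Proof. by case: z. Qed.

Lemma sqmodJ z : sqmod (z^*) = sqmod z.
Proof. by rewrite /sqmod ReJ ImJ sqrrN. Qed.

Lemma normc_sqr z : Normc.normc z ^+ 2 = sqmod z.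
Proof. by case: z => a b; rewrite /= sqr_sqrtr ?addr_ge0 ?sqr_ge0. Qed.

Lemma complex_eqP z w :
  complex.Re z = complex.Re w -> complex.Im z = complex.Im w -> z = w.
Proof. by case: z w => [a b] [c d] /= -> ->. Qed.

End ComplexParts.

(** * Spectral calculus of states and convexity of the entropy *)

Section Spectrum.
Variables (R : realType) (m : nat).
Local Notation C := R[i].
Implicit Types (A B S Q : 'M[C]_m).

Lemma hermsymmx_conj A i j : A \is hermsymmx -> (A j i)^* = A i j.
Proof.
by move=> /is_hermitianmxP/matrixP/(_ i j); rewrite expr0 scale1r !mxE => <-.
Qed.

Lemma hermsymmx_intro A : (forall i j, (A j i)^* = A i j) -> A \is hermsymmx.
Proof.
move=> h; apply/is_hermitianmxP/matrixP => i j.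
by rewrite expr0 scale1r !mxE h.
Qed.

Definition eigval A (k : 'I_m) : R := complex.Re (spectral_diag A 0 k).

Lemma spectral_diag_eigval A k : A \is hermsymmx ->
  spectral_diag A 0 k = (eigval A k)%:C%C.
Proof.
move=> /hermitian_spectral_diag_real/mxOverP/(_ 0 k).
by rewrite /eigval => /complex_realP[x ->].
Qed.

Lemma spectral_row_orth A k l :
  \sum_j spectralmx A k j * (spectralmx A l j)^* = (k == l)%:R.
Proof.
have /unitarymxP/matrixP/(_ k l) := spectral_unitarymx A.
by rewrite !mxE => <-; apply: eq_bigr => j _; rewrite !mxE.
Qed.

Lemma mulmx_diag_congr (Q : 'M[C]_m) (v : 'rV[C]_m) i j :
  (Q^t* *m diag_mx v *m Q) i j = \sum_k v 0 k * ((Q k i)^* * Q k j).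
Proof.
rewrite mxE; apply: eq_bigr => k _.
by rewrite mul_mx_diag !mxE mulrAC mulrC mulrA.
Qed.

Lemma hermsymmx_spectral A : A \is hermsymmx ->
  A = (spectralmx A)^t* *m diag_mx (spectral_diag A) *m spectralmx A.
Proof.
move=> /hermitian_normalmx/orthomx_spectralP {1}->.
by rewrite invmx_unitary// spectral_unitarymx.
Qed.

Lemma hermsymmx_spectralE A i j : A \is hermsymmx ->
  A i j = \sum_k (eigval A k)%:C%C * ((spectralmx A k i)^* * spectralmx A k j).
Proof.
move=> hA; rewrite {1}(hermsymmx_spectral hA) mulmx_diag_congr.
by apply: eq_bigr => k _; rewrite spectral_diag_eigval.
Qed.

(** For unitary [Q] the weights are the squared moduli of a unitary matrix, hence doubly stochastic,
    which reduces statements on diagonals to Jensen's inequality. *)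
Lemma unitary_diag_spectral A Q i : A \is hermsymmx ->
  complex.Re ((Q *m A *m Q^t*) i i) =
  \sum_k sqmod ((Q *m (spectralmx A)^t*) i k) * eigval A k.
Proof.
move=> hA; rewrite {1}(hermsymmx_spectral hA).
set P := spectralmx A; set D := diag_mx _.
have -> : Q *m (P^t* *m D *m P) *m Q^t* = (Q *m P^t*) *m D *m (Q *m P^t*)^t*.
  by rewrite trmx_mul map_mxM trmxCK !mulmxA.
rewrite mxE Re_sum; apply: eq_bigr => k _.
rewrite mul_mx_diag !mxE spectral_diag_eigval//.
rewrite [_ * (eigval A k)%:C%C]mulrC -mulrA mulcJ Re_rscale mulrC.
by congr (_ * _).
Qed.

Lemma unitary_sqmod_row Q i : Q \is unitarymx -> \sum_k sqmod (Q i k) = 1.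
Proof.
move=> /unitarymxP/matrixP/(_ i i); rewrite !mxE eqxx => h.
transitivity (complex.Re (true%:R : C)) => //; rewrite -h Re_sum.
by apply: eq_bigr => k _; rewrite !mxE mulcJ.
Qed.

Lemma unitary_sqmod_col Q k : Q \is unitarymx -> \sum_i sqmod (Q i k) = 1.
Proof.
rewrite -trmxC_unitary => /(unitary_sqmod_row k) <-.
by apply: eq_bigr => i _; rewrite !mxE sqmodJ.
Qed.

Lemma eigval_unitary_diag A k : A \is hermsymmx ->
  eigval A k = complex.Re ((spectralmx A *m A *m (spectralmx A)^t*) k k).
Proof.
move=> hA; rewrite unitary_diag_spectral//.
have /unitarymxP -> := spectral_unitarymx A.
rewrite (bigD1 k)//= big1 ?addr0 => [|l /negbTE lk].
  by rewrite mxE eqxx /sqmod /= expr1n expr0n addr0 mul1r.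
by rewrite mxE eq_sym lk /sqmod /= expr0n addr0 mul0r.
Qed.

Lemma states_herm S : states S -> S \is hermsymmx. Proof. by case. Qed.

Lemma eigval_ge0 S k : states S -> 0 <= eigval S k.
Proof.
move=> [hS pS _]; rewrite eigval_unitary_diag//.
have := pS (row k (spectralmx S)).
rewrite lecE => /andP[_]; congr (_ <= complex.Re _).
rewrite !mxE; apply: eq_bigr => i _; rewrite !mxE; congr (_ * _).
by apply: eq_bigr => j _; rewrite !mxE.
Qed.

Lemma mxtrace_spectral A (v : 'rV[C]_m) :
  \tr ((spectralmx A)^t* *m diag_mx v *m spectralmx A) = \sum_k v 0 k.
Proof.
rewrite mxtrace_mulC mulmxA; have /unitarymxP -> := spectral_unitarymx A.
by rewrite mul1mx mxtrace_diag.
Qed.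

Lemma eigval_sum1 S : states S -> \sum_k eigval S k = 1.
Proof.
move=> [hS _ tS].
have := congr1 (@complex.Re R) tS; rewrite {1}(hermsymmx_spectral hS).
by rewrite mxtrace_spectral Re_sum.
Qed.

Lemma eigval_le1 S k : states S -> eigval S k <= 1.
Proof.
move=> sS; rewrite -(eigval_sum1 sS) (bigD1 k)//= lerDl sumr_ge0// => l _.
exact: eigval_ge0.
Qed.

Lemma states_gt0 S : states S -> (0 < m)%N.
Proof.
move=> /eigval_sum1 /eqP; case: posnP => // m0.
rewrite big1 ?(eq_sym 0) ?oner_eq0// => k _.
by have := ltn_ord k; rewrite [X in (_ < X)%N]m0.
Qed.

Lemma mxlogE S : mxlog S = (spectralmx S)^t* *m
  diag_mx (\row_k (ln (eigval S k))%:C%C) *m spectralmx S.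
Proof.
rewrite /mxlog /mxfun (invmx_unitary (spectral_unitarymx S)).
set D := map_mx _ (spectral_diag S); have -> // : D = \row_k (ln (eigval S k))%:C%C.
by apply/rowP => k; rewrite !mxE.
Qed.

Lemma trSlogSE S : S \is hermsymmx ->
  trSlogS S = \sum_k eigval S k * ln (eigval S k).
Proof.
move=> hS; rewrite /trSlogS mxlogE {1}(hermsymmx_spectral hS).
set P := spectralmx S; have PP : P *m P^t* = 1%:M.
  exact/unitarymxP/spectral_unitarymx.
rewrite !mulmxA -[_ *m P *m P^t*]mulmxA PP mulmx1 -[_ *m diag_mx _ *m diag_mx _]mulmxA.
rewrite mulmx_diag mxtrace_spectral Re_sum; apply: eq_bigr => k _.
by rewrite !mxE spectral_diag_eigval// Re_rscale.
Qed.

(** The diagonal of a state in any orthonormal basis is a doubly stochastic average of its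
    eigenvalues: Jensen applies row by row, and the unit column sums reassemble the entropy. *)
Lemma peierls S Q : states S -> Q \is unitarymx ->
  let q i := complex.Re ((Q *m S *m Q^t*) i i) in
  (forall i, 0 <= q i) /\ \sum_i q i * ln (q i) <= trSlogS S.
Proof.
move=> sS uQ q; have hS := states_herm sS.
set U := Q *m (spectralmx S)^t*.
have uU : U \is unitarymx.
  have uP : (spectralmx S)^t* \is unitarymx.
    by rewrite trmxC_unitary spectral_unitarymx.
  exact: mul_unitarymx uQ uP.
have qE i : q i = \sum_k sqmod (U i k) * eigval S k.
  by rewrite /q unitary_diag_spectral.
split=> [i|].
  by rewrite qE sumr_ge0// => k _; rewrite mulr_ge0 ?sqmod_ge0 ?eigval_ge0.
rewrite trSlogSE//.
apply: (@le_trans _ _ (\sum_i \sum_k sqmod (U i k) *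
    (eigval S k * ln (eigval S k)))).
  apply: ler_sum => i _; rewrite qE; apply: jensen_xlnx => [k|k|].
  - exact: sqmod_ge0.
  - exact: eigval_ge0.
  - exact: unitary_sqmod_row.
rewrite exchange_big ler_sum// => k _ /=.
by rewrite -mulr_suml unitary_sqmod_col// mul1r.
Qed.

Lemma xlnx_convex (s x y : R) : 0 <= s <= 1 -> 0 <= x -> 0 <= y ->
  ((1 - s) * x + s * y) * ln ((1 - s) * x + s * y) <=
  (1 - s) * (x * ln x) + s * (y * ln y).
Proof.
move=> /andP[s0 s1] x0 y0.
have := @jensen_xlnx R bool (fun b => if b then 1 - s else s)
  (fun b => if b then x else y).
rewrite !big_bool /=; apply.
- by case => //; rewrite subr_ge0.
- by case.
- by rewrite subrK.
Qed.

Lemma states_convex S S' (s : R) : 0 <= s <= 1 -> states S -> states S' ->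
  states ((1 - s)%:C%C *: S + s%:C%C *: S').
Proof.
move=> /andP[s0 s1] [hS pS tS] [hS' pS' tS']; split.
- apply: hermsymmx_intro => i j; rewrite !mxE.
  rewrite -(hermsymmx_conj i j hS) -(hermsymmx_conj i j hS').
  by apply: complex_eqP; rewrite !(ReJ, ImJ, ReD, ImD, Re_rscale, Im_rscale);
    ring.
- move=> u; rewrite mulmxDr mulmxDl mxE -!scalemxAr -!scalemxAl !mxE.
  by rewrite addr_ge0// mulr_ge0 ?ler0c ?subr_ge0//; [have := pS u|have := pS' u];
    rewrite mxE.
- rewrite mxtraceD !mxtraceZ tS tS' !mulr1.
  by apply: complex_eqP => /=; rewrite ?addr0// subrK.
Qed.

(** In an eigenbasis of the mixture its entropy is read off the diagonal, where diagonals are affine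
    and scalar convexity applies; [peierls] then compares the diagonals of [S] and [S'] with their
    own entropies. *)
Lemma trSlogS_convex S S' (s : R) : 0 <= s <= 1 -> states S -> states S' ->
  trSlogS ((1 - s)%:C%C *: S + s%:C%C *: S') <=
  (1 - s) * trSlogS S + s * trSlogS S'.
Proof.
move=> s01 sS sS'; have sT := states_convex s01 sS sS'.
set T := (_ + _) in sT *; have hT := states_herm sT.
set Q := spectralmx T; have uQ : Q \is unitarymx by exact: spectral_unitarymx.
have [q0 qS] := peierls sS uQ; have [q'0 qS'] := peierls sS' uQ.
have /andP[s0 s1] := s01.
rewrite (trSlogSE hT).
apply: le_trans (lerD (ler_wpM2l _ qS) (ler_wpM2l s0 qS')); last first.
  by rewrite subr_ge0.
rewrite !mulr_sumr -big_split/=; apply: ler_sum => i _.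
rewrite (_ : eigval T i = (1 - s) * complex.Re ((Q *m S *m Q^t*) i i)
    + s * complex.Re ((Q *m S' *m Q^t*) i i)); last first.
  rewrite eigval_unitary_diag// -/Q /T mulmxDr mulmxDl mxE ReD.
  by rewrite -!scalemxAr -!scalemxAl [X in complex.Re X + _]mxE
    [X in _ + complex.Re X]mxE !Re_rscale.
exact: xlnx_convex.
Qed.

Lemma trSlogS_le0 S : states S -> trSlogS S <= 0.
Proof.
move=> sS; rewrite trSlogSE ?states_herm//; apply: sumr_le0 => k _.
by rewrite mulr_ge0_le0 ?eigval_ge0// ln_le0// eigval_le1.
Qed.

Lemma trSlogS_ge S : states S -> - ln m%:R <= trSlogS S.
Proof.
move=> sS; have m0 : (0 : R) < m%:R by rewrite ltr0n (states_gt0 sS).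
rewrite trSlogSE ?states_herm//.
(* Uniform weights: the mean of the eigenvalues is 1/m. *)
have := @jensen_xlnx R 'I_m (fun _ => m%:R^-1) (eigval S).
rewrite -!mulr_sumr eigval_sum1// mulr1 lnV ?posrE// ler_pM2l ?invr_gt0//.
apply => [k|k|]; first by rewrite invr_ge0 ltW.
  exact: eigval_ge0.
by rewrite sumr_const card_ord -[LHS]mulr_natl mulfV// gt_eqF.
Qed.

End Spectrum.

(** * Lower bound on the entropy term *)

Section EntropyError.
Variables (R : realType) (m : nat).
Local Notation C := R[i].
Implicit Types (S A : 'M[C]_m).

Lemma norm2_cV (x : 'cV[C]_m) : norm2 x = Num.sqrt (\sum_i sqmod (x i 0)).
Proof.
rewrite /norm2 /trdot /mxtrace Re_sum; congr (Num.sqrt _).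
by apply: eq_bigr => i _; rewrite mxE big_ord1 !mxE mulcJ.
Qed.

Lemma opnorm_ge A (x : 'cV[C]_m) : norm2 x <= 1 -> norm2 (A *m x) <= opnorm A.
Proof.
move=> x1; apply: ub_le_sup; last by exists x.
(* The supremum in [opnorm] says something only for a bounded set; row sums of the entries give a
   crude bound. *)
pose a i := \sum_j (`|complex.Re (A i j)| + `|complex.Im (A i j)|).
exists (Num.sqrt (\sum_i (a i ^+ 2 + a i ^+ 2))) => _ [{x1}x /= x1 <-].
rewrite norm2_cV ler_wsqrtr// ler_sum// => i _.
have xj j : sqmod (x j 0) <= 1.
  move: x1; rewrite norm2_cV -[leRHS]sqrtr1 ler_sqrt// => x1.
  apply: le_trans x1; rewrite (bigD1 j)//= lerDl sumr_ge0// => k _.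
  exact: sqmod_ge0.
have Rx j : `|complex.Re (x j 0)| <= 1.
  rewrite -(@ler_pXn2r _ 2) ?nnegrE// expr1n real_normK ?num_real//.
  by apply: le_trans (xj j); rewrite lerDl sqr_ge0.
have Ix j : `|complex.Im (x j 0)| <= 1.
  rewrite -(@ler_pXn2r _ 2) ?nnegrE// expr1n real_normK ?num_real//.
  by apply: le_trans (xj j); rewrite lerDr sqr_ge0.
have sq (y : R) : `|y| <= a i -> y ^+ 2 <= a i ^+ 2.
  by move=> h; rewrite -real_normK ?num_real// lerXn2r// nnegrE (le_trans _ h).
rewrite /sqmod mxE Re_sum Im_sum lerD// sq//.
  apply: le_trans (ler_norm_sum _ _ _) _; apply: ler_sum => j _.
  have -> : complex.Re (A i j * x j 0) = complex.Re (A i j) * complex.Re (x j 0)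
     - complex.Im (A i j) * complex.Im (x j 0).
    by case: (A i j) (x j 0) => [? ?] [? ?].
  apply: le_trans (ler_normB _ _) _; rewrite !normrM.
  by rewrite lerD// ler_piMr.
apply: le_trans (ler_norm_sum _ _ _) _; apply: ler_sum => j _.
have -> : complex.Im (A i j * x j 0) = complex.Re (A i j) * complex.Im (x j 0)
   + complex.Im (A i j) * complex.Re (x j 0).
  by case: (A i j) (x j 0) => [? ?] [? ?].
apply: le_trans (ler_normD _ _) _; rewrite !normrM.
by rewrite lerD// ler_piMr.
Qed.

(** As [ln 0 = 0], a zero eigenvalue would go unnoticed in [mxlog S]. Full rank excludes it, since
    [S] would kill the corresponding unit eigenvector. *)
Lemma eigval_neq0 S k : S \is hermsymmx -> \rank S = m -> eigval S k != 0.
Proof.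
move=> hS rS; apply/eqP => dk.
set P := spectralmx S.
have PS : P *m S = diag_mx (spectral_diag S) *m P.
  rewrite {1}(hermsymmx_spectral hS) !mulmxA.
  by have /unitarymxP -> := spectral_unitarymx S; rewrite mul1mx.
have rPS : row k P *m S = 0.
  rewrite -row_mul PS; apply/rowP => j; rewrite mul_diag_mx !mxE.
  by rewrite spectral_diag_eigval// dk mul0r.
have Su : S \in unitmx by rewrite -row_free_unit /row_free rS.
have rP : row k P = 0 by rewrite -[LHS](mulmxK Su) rPS mul0mx.
have := spectral_row_orth S k k; rewrite big1 => [/eqP|j _].
  by rewrite eqxx eq_sym oner_eq0.
by have /rowP/(_ j) := rP; rewrite !mxE => ->; rewrite mul0r.
Qed.

Lemma mxlog_eigenvector S k : S \is hermsymmx ->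
  mxlog S *m (row k (spectralmx S))^t* =
  (ln (eigval S k))%:C%C *: (row k (spectralmx S))^t*.
Proof.
move=> hS; apply/colP => i; rewrite mxlogE -!mulmxA.
set P := spectralmx S.
have -> : P *m (row k P)^t* = delta_mx k 0.
  apply/colP => l; rewrite !mxE andbT -(spectral_row_orth S l k).
  by apply: eq_bigr => j _; rewrite !mxE.
rewrite mul_diag_mx mxE (bigD1 k)//= big1 ?addr0 => [|l /negbTE lk].
  by rewrite !mxE !eqxx mulr1 mulrC.
by rewrite !mxE lk !mulr0.
Qed.

Lemma norm2_cVZ (s : R) (x : 'cV[C]_m) : norm2 (s%:C%C *: x) = `|s| * norm2 x.
Proof.
rewrite !norm2_cV -sqrtr_sqr -sqrtrM ?sqr_ge0// mulr_sumr; congr Num.sqrt.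
apply: eq_bigr => i _; rewrite mxE /sqmod Re_rscale Im_rscale; ring.
Qed.

Lemma exists_eigval_le S : states S -> exists k, eigval S k <= m%:R^-1.
Proof.
move=> sS; apply: contrapT => /forallNP h.
have m0 := states_gt0 sS; have mR0 : (0 : R) < m%:R by rewrite ltr0n.
suff : \sum_(k < m) (m%:R^-1 : R) < \sum_k eigval S k.
  rewrite eigval_sum1// sumr_const card_ord -[X in X < _]mulr_natl mulfV ?ltxx//.
  by rewrite gt_eqF.
apply: ltr_sum => [|k _]; last by have /negP := h k; rewrite -ltNge.
by apply/hasP; exists (Ordinal m0) => //; rewrite mem_index_enum.
Qed.

(** Some eigenvalue is at most the mean 1/m, and [mxlog S] stretches its eigenvector by at least ln
    m. *)
Lemma ln_le_opnorm_mxlog S : states S -> \rank S = m ->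
  ln m%:R <= opnorm (mxlog S).
Proof.
move=> sS rS; have hS := states_herm sS.
have m0 := states_gt0 sS; have mR0 : (0 : R) < m%:R by rewrite ltr0n.
have [k kS] := exists_eigval_le sS.
have d0 : 0 < eigval S k by rewrite lt_def eigval_neq0// eigval_ge0.
set x := (row k (spectralmx S))^t*.
have x1 : norm2 x = 1.
  rewrite norm2_cV -[RHS]sqrtr1; congr Num.sqrt.
  rewrite -(unitary_sqmod_row k (spectral_unitarymx S)).
  by apply: eq_bigr => i _; rewrite !mxE sqmodJ.
have := @opnorm_ge (mxlog S) x; rewrite x1 lexx => /(_ isT).
rewrite mxlog_eigenvector// norm2_cVZ x1 mulr1; apply: le_trans.
rewrite -normrN; apply: le_trans (ler_norm _).
by rewrite lerNr -lnV ?posrE// ler_ln ?posrE// invr_gt0.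
Qed.

(** Both members of the minimum dominate ln m: the logarithm because eps <= 1, the norm by
    [ln_le_opnorm_mxlog]. *)
Lemma entropy_error_ge S (eps : R) : states S -> 0 <= eps <= 1 ->
  eps * ln m%:R <= entropy_error eps S.
Proof.
move=> sS /andP[]; rewrite le_eqVlt => /predU1P[<-|e0] e1.
  by rewrite /entropy_error !mul0r.
rewrite /entropy_error ler_pM2l//.
have mR0 : (0 : R) < m%:R by rewrite ltr0n (states_gt0 sS).
have h : ln m%:R <= ln (m%:R / eps).
  rewrite ler_ln ?posrE ?divr_gt0// ler_pdivlMr//.
  by rewrite ler_piMr// ltW.
rewrite /norm_log; case: ifPn => [_|].
  by rewrite (min_idPr _) ?leey.
rewrite -leqNgt => rS; rewrite -EFin_min /= le_min h andbT.
by apply: ln_le_opnorm_mxlog => //; apply/eqP; rewrite eqn_leq rank_leq_row.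
Qed.

End EntropyError.

(** * The real trace pairing *)

Section Pairing.
Variables (R : realType) (m : nat).
Local Notation C := R[i].
Implicit Types (A B x : 'M[C]_m).

(** The real part makes this real-linear in [A] on all matrices; by [trdot_hermsymmx] it is the full
    inner product on Hermitian ones. *)
Definition pairing A x : R := complex.Re (\tr (A *m x)).

Lemma pairingD A B x : pairing (A + B) x = pairing A x + pairing B x.
Proof. by rewrite /pairing mulmxDl mxtraceD ReD. Qed.

Lemma pairingZ (s : R) A x : pairing (s%:C%C *: A) x = s * pairing A x.
Proof. by rewrite /pairing -scalemxAl mxtraceZ Re_rscale. Qed.

Lemma pairingB A B x : pairing (A - B) x = pairing A x - pairing B x.
Proof.
have -> : - B = (- 1 : R)%:C%C *: B by rewrite rmorphN1 scaleN1r.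
by rewrite pairingD pairingZ mulN1r.
Qed.

Lemma pairing_sum (I : Type) (r : seq I) (Q : pred I) (F : I -> 'M[C]_m) x :
  pairing (\sum_(i <- r | Q i) F i) x = \sum_(i <- r | Q i) pairing (F i) x.
Proof.
apply: (big_morph (fun A => pairing A x)) => [A B|]; first exact: pairingD.
by rewrite /pairing mul0mx mxtrace0.
Qed.

Lemma trdot_hermsymmx A x : A \is hermsymmx -> x \is hermsymmx ->
  trdot A x = (pairing A x)%:C%C.
Proof.
move=> hA hx; have xE : x^t* = x.
  by apply/matrixP => i j; rewrite !mxE hermsymmx_conj.
rewrite /trdot xE; apply: complex_eqP => //=.
suff : complex.Im (\tr (A *m x)) = - complex.Im (\tr (A *m x)) by lra.
rewrite -ImJ; congr complex.Im; rewrite /mxtrace rmorph_sum.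
under eq_bigr do rewrite mxE.
under [RHS]eq_bigr do rewrite mxE rmorph_sum/=.
rewrite [RHS]exchange_big; apply: eq_bigr => i _; apply: eq_bigr => j _ /=.
rewrite -(hermsymmx_conj i j hA) -(hermsymmx_conj j i hx).
by case: (A j i) (x i j) => [a b] [c d]; apply: complex_eqP => /=; ring.
Qed.

Lemma normc_trdot_sqr A x : A \is hermsymmx -> x \is hermsymmx ->
  Normc.normc (trdot A x) ^+ 2 = pairing A x ^+ 2.
Proof.
move=> hA hx; rewrite trdot_hermsymmx// normc_sqr /sqmod /=.
by rewrite expr0n addr0.
Qed.

End Pairing.

(** * First-order optimality of the estimator *)

Section FirstOrderCondition.
Variables (R : realType) (m n : nat).
Local Notation C := R[i].
Variables (x : 'I_n -> 'M[C]_m) (rho : 'M[C]_m) (e : 'I_n -> R).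

Definition emp_sqnorm (A : 'M[C]_m) : R :=
  n%:R^-1 * \sum_j pairing A (x j) ^+ 2.

Definition emp_noise (A : 'M[C]_m) : R :=
  n%:R^-1 * \sum_j e j * pairing A (x j).

Lemma le_of_le_scaled (a b c : R) : 0 <= c ->
  (forall s, 0 < s -> s <= 1 -> a <= b + s * c) -> a <= b.
Proof.
move=> c0 h; apply/ler_addgt0Pr => g g0.
have c1 : 0 < c + 1 by lra.
pose s := Num.min 1 (g / (c + 1)).
have s0 : 0 < s by rewrite lt_min ltr01 divr_gt0.
apply: le_trans (h s s0 _) _; first by rewrite ge_min lexx.
rewrite lerD2l.
have : s * (c + 1) <= g by rewrite -ler_pdivlMr// ge_min lexx orbT.
lra.
Qed.

Let segment_arith (s p L c a b u v w : R) :
  c + p * v <= c - 2 * s * a + s * s * b + p * u ->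
  p * u <= p * ((1 - s) * v + s * w) ->
  s * p * (w - v) <= s * p * (0 - - L) ->
  s * (2 * a) <= s * (p * L + s * b).
Proof. by lra. Qed.

(* The penalty is convex along the segment from [rhohat] to [S], so the optimality of
   [rhohat] yields a first-order condition in which the entropy enters only through
   trSlogS S - trSlogS rhohat <= ln m. *)
Lemma risk_argmin_first_order (eps : R) (rhohat S : 'M[C]_m) :
  0 <= eps -> risk_argmin x (response rho x e) eps rhohat -> states S ->
  emp_sqnorm (rhohat - rho) + emp_sqnorm (rhohat - S) <=
  emp_sqnorm (S - rho) + 2 * emp_noise (rhohat - S) + eps * ln m%:R.
Proof.
move=> eps0 [sh hmin] sS.
pose r j := response rho x e j - pairing rhohat (x j).
pose dl j := pairing (S - rhohat) (x j).
(* Along the segment the empirical risk is its value at [rhohat] minus 2 s a plus s^2 b: [a] carries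
   the slope at [rhohat], and [b] disappears as s tends to 0. *)
pose a := n%:R^-1 * \sum_j r j * dl j.
pose b := n%:R^-1 * \sum_j dl j ^+ 2.
have b0 : 0 <= b.
  by rewrite mulr_ge0 ?invr_ge0// sumr_ge0// => j _; rewrite sqr_ge0.
have ent := lerB (trSlogS_le0 sS) (trSlogS_ge sh).
have key : 2 * a <= eps * ln m%:R.
  apply: (le_of_le_scaled b0) => s s0 s1.
  have s01 : 0 <= s <= 1 by rewrite ltW.
  have := hmin _ (states_convex s01 sh sS).
  have := trSlogS_convex s01 sh sS.
  set T := _ + _; rewrite /penalized_risk => hT.
  have -> : n%:R^-1 * (\sum_(j < n) (response rho x e j -
      complex.Re (\tr (T *m x j))) ^+ 2) =
      n%:R^-1 * (\sum_j r j ^+ 2) - 2 * s * a + s ^+ 2 * b.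
    transitivity (n%:R^-1 *
        \sum_j (r j ^+ 2 - 2 * s * (r j * dl j) + s ^+ 2 * dl j ^+ 2)).
      congr (_ * _); apply: eq_bigr => j _.
      rewrite -[complex.Re _]/(pairing T (x j)).
      by rewrite pairingD !pairingZ /r /dl pairingB; ring.
    by rewrite big_split sumrB/= -!mulr_sumr /a /b; ring.
  rewrite -/(pairing _ _) => h.
  have h2 := ler_wpM2l eps0 hT.
  have : s * (2 * a) <= s * (eps * ln m%:R + s * b).
    have h3 := ler_wpM2l (mulr_ge0 (ltW s0) eps0) ent.
    move: h; rewrite expr2 => h; exact: segment_arith h h2 h3.
  by rewrite ler_pM2l.
(* Polarization: the residual is the noise plus <rho - rhohat, X_j>, so [2 * a] contains twice the
   empirical inner product of rhohat - rho and rhohat - S. *)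
have -> : emp_sqnorm (rhohat - rho) + emp_sqnorm (rhohat - S) =
    emp_sqnorm (S - rho) + 2 * emp_noise (rhohat - S) + 2 * a.
  rewrite /emp_sqnorm /emp_noise /a -mulrDr -big_split/= !mulr_sumr -!big_split/=.
  apply: eq_bigr => j _; rewrite /r /dl /response -/(pairing rho (x j)).
  by rewrite !pairingB; ring.
by rewrite lerD2l.
Qed.

End FirstOrderCondition.

(** * Randomized rounding to a grid *)

Section GridAtoms.
Variables (R : realType) (m : nat).
Local Notation C := R[i].
Hypothesis m0 : (0 < m)%N.
Let mR0 : (0 : R) < m%:R. Proof. by rewrite ltr0n. Qed.

(** The boolean selects the imaginary part. Mesh 1/m is fine enough for the 2m rounding variances to
    add up to at most 2/m, and coarse enough for a log-cardinality of order m log (2m). The grid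
    runs from -1 to 1 + 1/m: the extra point gives the coordinate 1 an upper neighbour. *)
Definition grid_index := {ffun 'I_m * bool -> 'I_(m.*2.+2)}.

Definition grid_val (k : 'I_(m.*2.+2)) : R := (k%:R - m%:R) / m%:R.

Definition grid_vec (f : grid_index) (i : 'I_m) : C :=
  (grid_val (f (i, false)) +i* grid_val (f (i, true)))%C.

(** The cut-off bounds the atom of every index. Rounding a unit vector gives squared length at most
    2 + 4/m <= 6, so it never acts on a rounding of positive probability. *)
Definition grid_atom (f : grid_index) : 'M[C]_m :=
  if \sum_i sqmod (grid_vec f i) <= 6
  then \matrix_(i, j) (grid_vec f i * (grid_vec f j)^*) else 0.

Lemma grid_rounding (x : R) : `|x| <= 1 -> exists p : 'I_(m.*2.+2) -> R,
  [/\ forall k, 0 <= p k, \sum_k p k = 1, \sum_k p k * grid_val k = x &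
      forall k, p k != 0 -> `|grid_val k - x| <= m%:R^-1].
Proof.
rewrite ler_norml => /andP[x1 x2].
pose y := m%:R * (x + 1).
have y0 : 0 <= y by rewrite mulr_ge0//; lra.
pose k0 := Num.truncn y.
have /andP[k0y yk0] : k0%:R <= y < k0.+1%:R by exact: truncn_itv.
have k02m : (k0 <= m.*2)%N.
  rewrite -(ler_nat R); apply: le_trans k0y _; rewrite -mul2n natrM /y mulrC.
  by rewrite ler_pM2r//; lra.
have k0lt : (k0 < m.*2.+2)%N by rewrite ltnS (leq_trans k02m).
have k1lt : (k0.+1 < m.*2.+2)%N by rewrite ltnS.
pose i0 := Ordinal k0lt; pose i1 := Ordinal k1lt.
have i01 : i1 != i0 by rewrite -val_eqE /= neq_ltn ltnSn orbT.
pose f := y - k0%:R.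
have f0 : 0 <= f by rewrite subr_ge0.
have f1 : f <= 1 by move: yk0; rewrite -natr1 /f; lra.
(* Linear interpolation between the two neighbouring grid points makes the rounding unbiased. *)
pose p k : R := if k == i0 then 1 - f else if k == i1 then f else 0.
have pS (u : 'I_(m.*2.+2) -> R) :
    \sum_k p k * u k = (1 - f) * u i0 + f * u i1.
  rewrite (bigD1 i0)//= (bigD1 i1)//= big1 => [|k /andP[/negbTE ki0 /negbTE ki1]].
    by rewrite addr0 /p !eqxx (negbTE i01).
  by rewrite /p ki0 ki1 mul0r.
have v0 : grid_val i0 = x - f / m%:R.
  by rewrite /grid_val /f /y /=; field; rewrite gt_eqF.
have v1 : grid_val i1 = x + (1 - f) / m%:R.
  by rewrite /grid_val /f /y /= -natr1; field; rewrite gt_eqF.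
exists p; split.
- by move=> k; rewrite /p; case: ifP => // _; [rewrite subr_ge0|case: ifP].
- transitivity (\sum_k p k * 1); first by apply: eq_bigr => k _; rewrite mulr1.
  by rewrite (pS (fun=> 1)) !mulr1 subrK.
- by rewrite pS v0 v1; ring.
- move=> k; rewrite /p; have [->|_] := eqVneq k i0 => [_|].
    rewrite v0 addrAC subrr add0r normrN ger0_norm ?divr_ge0 ?(ltW mR0)//.
    by rewrite -[leRHS]mul1r ler_pM2r ?invr_gt0.
  have [->|_] := eqVneq k i1 => [_|]; last by rewrite eqxx.
  rewrite v1 addrAC subrr add0r ger0_norm; last first.
    by rewrite divr_ge0 ?subr_ge0// ltW.
  by rewrite -[leRHS]mul1r ler_pM2r ?invr_gt0//; lra.
Qed.

End GridAtoms.

(** * Decomposition of states into rank-one atoms *)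

Section AtomicDecomposition.
Variables (R : realType) (m : nat).
Local Notation C := R[i].
Hypothesis m0 : (0 < m)%N.
Let mR0 : (0 : R) < m%:R. Proof. by rewrite ltr0n. Qed.
Let mV1 : (m%:R : R)^-1 <= 1. Proof. by rewrite invf_le1// ler1n. Qed.
Local Notation G := (grid_index m).

Lemma grid_atom_hermsymmx (f : G) : grid_atom R f \is hermsymmx.
Proof.
apply: hermsymmx_intro => i j; rewrite /grid_atom; case: ifP => _; rewrite !mxE.
  case: (grid_vec R f i) (grid_vec R f j) => [a b] [c d].
  by apply: complex_eqP => /=; ring.
by apply: complex_eqP => /=; rewrite ?oppr0.
Qed.

Lemma norm2_rank_one (w : 'I_m -> C) :
  norm2 (\matrix_(i, j) (w i * (w j)^*)) = \sum_i sqmod (w i).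
Proof.
have s0 : 0 <= \sum_i sqmod (w i) by apply: sumr_ge0 => i _; exact: sqmod_ge0.
rewrite -[RHS](ger0_norm s0) -sqrtr_sqr /norm2; congr Num.sqrt.
rewrite /trdot /mxtrace Re_sum expr2 mulr_suml; apply: eq_bigr => i _.
rewrite mxE Re_sum mulr_sumr; apply: eq_bigr => j _.
rewrite !mxE mulcJ /= /sqmod.
by case: (w i) (w j) => [a b] [c d] /=; ring.
Qed.

Lemma norm2_grid_atom (f : G) : norm2 (grid_atom R f) <= 6.
Proof.
rewrite /grid_atom; case: ifP => [h|_]; first by rewrite norm2_rank_one.
by rewrite /norm2 /trdot mul0mx mxtrace0 /= sqrtr0.
Qed.

(** Index m codes the value 0 and index 2m the value 1, so this is the i-th basis vector. Its atom,
    a diagonal matrix unit, serves to subtract a rounding variance. *)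
Definition basis_index (i : 'I_m) : G :=
  [ffun a => inord (if a == (i, false) then m.*2 else m)].

Lemma grid_vec_basis i j : grid_vec R (basis_index i) j = (j == i)%:R.
Proof.
have mm : (m < m.*2.+2)%N by rewrite ltnS (leq_trans _ (leqnSn _))// -addnn leq_addl.
rewrite /grid_vec /grid_val !ffunE !xpair_eqE !eqxx andbT andbF.
rewrite !inordK//; last by case: ifP => _ //; rewrite ltnS leqnSn.
rewrite subrr mul0r; case: eqVneq => _.
  by rewrite -addnn natrD addrK divff// gt_eqF.
by rewrite subrr mul0r.
Qed.

Lemma grid_atom_basis i a b :
  grid_atom R (basis_index i) a b = ((a == i) && (b == i))%:R.
Proof.
rewrite /grid_atom ifT.
  rewrite mxE !grid_vec_basis; case: (a == i); case: (b == i);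
    by apply: complex_eqP => /=; rewrite ?(mulr0, mul0r, oppr0, addr0, subr0, mulr1).
rewrite (bigD1 i)//= big1 => [|j /negbTE ji]; rewrite grid_vec_basis.
  by rewrite eqxx /sqmod /= expr1n expr0n !addr0 (ler_nat _ 1 6).
by rewrite ji /sqmod /= expr0n addr0.
Qed.

(* Randomized rounding of the coordinates of [u] to the grid is unbiased, so uu* is the
   mean of the rounded rank-one matrices up to a diagonal variance correction. *)
Lemma rank_one_decomposition (u : 'I_m -> C) : \sum_i sqmod (u i) = 1 ->
  exists c : G -> R, \sum_f `|c f| <= 3 /\
    forall i j, u i * (u j)^* = \sum_f (c f)%:C%C * grid_atom R f i j.
Proof.
move=> u1.
pose x (a : 'I_m * bool) : R :=
  if a.2 then complex.Im (u a.1) else complex.Re (u a.1).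
have ui1 i : sqmod (u i) <= 1.
  by rewrite -u1 (bigD1 i)//= lerDl sumr_ge0// => j _; exact: sqmod_ge0.
have x1 a : `|x a| <= 1.
  rewrite -(@ler_pXn2r _ 2) ?nnegrE// expr1n real_normK ?num_real//.
  by apply: le_trans (ui1 a.1); rewrite /x /sqmod; case: a.2; rewrite ?lerDl ?lerDr sqr_ge0.
have [p hp] := choice (fun a => grid_rounding m0 (x1 a)).
have p0 a k : 0 <= p a k by have [] := hp a.
have p1 a : \sum_k p a k = 1 by have [] := hp a.
have px a : \sum_k p a k * grid_val R k = x a by have [] := hp a.
have pn a k : p a k != 0 -> `|grid_val R k - x a| <= m%:R^-1.
  by have [_ _ _] := hp a; apply.
pose W := prod_weight p.
have W0 f : 0 <= W f by rewrite prodr_ge0.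
have W1 : \sum_f W f = 1 by exact: prod_weight_sum1.
pose v a := \sum_k p a k * (grid_val R k - x a) ^+ 2.
have v0 a : 0 <= v a by rewrite sumr_ge0// => k _; rewrite mulr_ge0// sqr_ge0.
have sqle (y : R) : `|y| <= m%:R^-1 -> y ^+ 2 <= m%:R^-1 ^+ 2.
  move=> h; rewrite -real_normK ?num_real//.
  by apply: lerXn2r => //; rewrite nnegrE invr_ge0 ltW.
have v1 a : v a <= m%:R^-1 ^+ 2.
  apply: (@le_trans _ _ (\sum_k p a k * m%:R^-1 ^+ 2)); last first.
    by rewrite -mulr_suml p1 mul1r.
  apply: ler_sum => k _.
  have [->|pk] := eqVneq (p a k) 0; first by rewrite !mul0r.
  by rewrite ler_wpM2l// sqle// pn.
have pv a : \sum_k p a k * grid_val R k ^+ 2 = x a ^+ 2 + v a.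
  transitivity (\sum_k (p a k * (grid_val R k - x a) ^+ 2
      + 2 * x a * (p a k * grid_val R k) - x a ^+ 2 * p a k)).
    by apply: eq_bigr => k _; ring.
  by rewrite sumrB big_split/= -!mulr_sumr px p1 -/(v a); ring.
(* Distinct coordinates are rounded independently, so a variance [v a] shows up only in the square
   of a single coordinate, that is, on the diagonal of uu*. *)
have M a b : \sum_f W f * (grid_val R (f a) * grid_val R (f b)) =
    x a * x b + (if a == b then v a else 0).
  case: eqVneq => [<-|ab].
    rewrite -expr2 -pv -(prod_weight_marginal p1 a (fun k => grid_val R k ^+ 2)).
    by apply: eq_bigr => f _; rewrite expr2.
  by rewrite addr0 -(px a) -(px b) -(prod_weight_pair p1 _ _ ab).
have Watom f i j : (W f)%:C%C * grid_atom R f i j =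
    (W f)%:C%C * (grid_vec R f i * (grid_vec R f j)^*).
  have [->|Wf] := eqVneq (W f) 0; first by rewrite !mul0r.
  have near a : grid_val R (f a) ^+ 2 <= 2 * x a ^+ 2 + 2 * m%:R^-1 ^+ 2.
    have : p a (f a) != 0.
      by apply: contraNneq Wf => pz; rewrite /W /prod_weight (bigD1 a)//= pz mul0r.
    move=> /pn h.
    have : (grid_val R (f a) - x a) ^+ 2 <= m%:R^-1 ^+ 2 by exact: sqle.
    have := sqr_ge0 (grid_val R (f a) - 2 * x a).
    by rewrite !expr2; lra.
  rewrite /grid_atom ifT; first by rewrite mxE.
  apply: (@le_trans _ _ (\sum_i (2 * sqmod (u i) + 4 * m%:R^-1 ^+ 2))).
    apply: ler_sum => k _; have := near (k, false); have := near (k, true).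
    rewrite /x /sqmod /=; lra.
  rewrite big_split/= -mulr_sumr u1 sumr_const card_ord -[_ *+ m]mulr_natl.
  have : m%:R * (4 * (m%:R : R)^-1 ^+ 2) = 4 * m%:R^-1.
    by field; rewrite gt_eqF.
  by move=> ->; have := mV1; lra.
pose vv i := v (i, false) + v (i, true).
(* Rounding probabilities, minus the variances put on the diagonal atoms. The latter total at most m
   * 2/m^2 <= 2, whence the mass 3. *)
exists (fun f => W f - \sum_i vv i * (f == basis_index i)%:R); split.
  apply: (@le_trans _ _ (\sum_f (W f + \sum_i vv i * (f == basis_index i)%:R))).
    apply: ler_sum => f _; apply: le_trans (ler_normB _ _) _.
    rewrite (ger0_norm (W0 f)) lerD2l ger0_norm// sumr_ge0// => i _.
    by rewrite mulr_ge0// addr_ge0.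
  rewrite big_split/= W1 exchange_big/=.
  apply: (@le_trans _ _ (1 + \sum_(i < m) 2 * m%:R^-1 ^+ 2)).
    rewrite lerD2l; apply: ler_sum => i _.
    rewrite (bigD1 (basis_index i))//= eqxx mulr1 big1 => [|f /negbTE->].
      by rewrite addr0 /vv; have := v1 (i, false); have := v1 (i, true); lra.
    by rewrite mulr0.
  rewrite sumr_const card_ord -[_ *+ m]mulr_natl.
  have -> : m%:R * (2 * (m%:R : R)^-1 ^+ 2) = 2 * m%:R^-1.
    by field; rewrite gt_eqF.
  by have := mV1; lra.
move=> i j.
under eq_bigr do rewrite rmorphB mulrBl Watom.
rewrite sumrB.
have -> : \sum_f (\sum_k vv k * (f == basis_index k)%:R)%:C%C * grid_atom R f i j =
    (if i == j then vv i else 0)%:C%C.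
  under eq_bigr do rewrite rmorph_sum mulr_suml.
  rewrite exchange_big/=.
  transitivity (\sum_k (vv k)%:C%C * ((i == k) && (j == k))%:R).
    apply: eq_bigr => k _; rewrite -grid_atom_basis.
    rewrite (bigD1 (basis_index k))//= big1 ?addr0 => [|f /negbTE->].
      by rewrite eqxx mulr1.
    by rewrite mulr0 mul0r.
  rewrite (bigD1 i)//= [X in _ + X]big1 ?addr0 => [|k /negbTE ki].
    by rewrite eqxx eq_sym /=; case: (i == j); rewrite ?mulr1 ?mulr0.
  by rewrite eq_sym ki mulr0.
apply: complex_eqP.
  rewrite ReD Re_sum.
  under eq_bigr do rewrite Re_rscale.
  transitivity (\sum_f (W f * (grid_val R (f (i, false)) * grid_val R (f (j, false)))
     + W f * (grid_val R (f (i, true)) * grid_val R (f (j, true))))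
     - (if i == j then vv i else 0)); last first.
    by congr (_ - _); apply: eq_bigr => f _ /=; ring.
  rewrite big_split/= !M !xpair_eqE /= !andbT.
  rewrite /x /= /vv; case: (i == j);
    by case: (u i) (u j) => [a b] [c d] /=; ring.
rewrite ImD Im_sum [X in _ = _ + X](_ : _ = 0) ?addr0; last by rewrite /= oppr0.
under eq_bigr do rewrite Im_rscale.
transitivity (\sum_f (W f * (grid_val R (f (i, true)) * grid_val R (f (j, false)))
   - W f * (grid_val R (f (i, false)) * grid_val R (f (j, true))))); last first.
  by apply: eq_bigr => f _ /=; ring.
rewrite sumrB/= !M !xpair_eqE /= !andbF /x /=.
by case: (u i) (u j) => [a b] [c d] /=; ring.
Qed.

Lemma states_decomposition (S : 'M[C]_m) : states S ->
  exists c : G -> R, \sum_f `|c f| <= 3 /\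
    S = \sum_f (c f)%:C%C *: grid_atom R f.
Proof.
move=> sS; have hS := states_herm sS; set P := spectralmx S.
(* As S = P* D P, the eigenvectors are the conjugated rows of [P]. *)
have uk k : \sum_i sqmod ((P k i)^*) = 1.
  rewrite -(unitary_sqmod_row k (spectral_unitarymx S)).
  by apply: eq_bigr => i _; rewrite sqmodJ.
have [c hc] := choice (fun k => rank_one_decomposition (uk k)).
exists (fun f => \sum_k eigval S k * c k f); split.
  apply: (@le_trans _ _ (\sum_f \sum_k eigval S k * `|c k f|)).
    apply: ler_sum => f _; apply: le_trans (ler_norm_sum _ _ _) _.
    by apply: ler_sum => k _; rewrite normrM ger0_norm// eigval_ge0.
  rewrite exchange_big/=.
  apply: (@le_trans _ _ (\sum_k eigval S k * 3)).
    apply: ler_sum => k _; rewrite -mulr_sumr ler_wpM2l ?eigval_ge0//.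
    by have [] := hc k.
  by rewrite -mulr_suml eigval_sum1// mul1r.
apply/matrixP => i j; rewrite (hermsymmx_spectralE i j hS) summxE.
transitivity (\sum_f \sum_k (eigval S k * c k f)%:C%C * grid_atom R f i j).
  rewrite exchange_big; apply: eq_bigr => k _ /=.
  have [_ /(_ i j)] := hc k; rewrite -/P conjCK => ->.
  by rewrite mulr_sumr; apply: eq_bigr => f _; rewrite mulrA -rmorphM.
by apply: eq_bigr => f _; rewrite mxE rmorph_sum mulr_suml.
Qed.

(** Each of two states has coefficients of total mass at most 3, hence the scale 6; both signs occur
    because sampling needs nonnegative weights. *)
Definition signed_atom (i : G * bool) : 'M[C]_m :=
  (if i.2 then 6 else - 6 : R)%:C%C *: grid_atom R i.1.

Lemma signed_atom_hermsymmx i : signed_atom i \is hermsymmx.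
Proof.
apply: hermsymmx_intro => a b; rewrite !mxE.
rewrite -(hermsymmx_conj a b (grid_atom_hermsymmx i.1)).
by apply: complex_eqP; rewrite ?(ReJ, ImJ, Re_rscale, Im_rscale); ring.
Qed.

Lemma norm2_signed_atom i : norm2 (signed_atom i) <= 36.
Proof.
have -> : norm2 (signed_atom i) = 6 * norm2 (grid_atom R i.1).
  rewrite /norm2 /trdot /signed_atom; set s := (if _ then _ else _).
  have -> : (s%:C%C *: grid_atom R i.1)^t* = s%:C%C *: (grid_atom R i.1)^t*.
    apply/matrixP => a b; rewrite !mxE.
    by apply: complex_eqP; rewrite ?(ReJ, ImJ, Re_rscale, Im_rscale); ring.
  rewrite -scalemxAl -scalemxAr !mxtraceZ !Re_rscale mulrA sqrtrM -?expr2 ?sqr_ge0//.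
  by rewrite sqrtr_sqr /s; case: ifP => _; rewrite ?normrN ger0_norm.
by have := norm2_grid_atom i.1; lra.
Qed.

Lemma states_sub_decomposition (S S' : 'M[C]_m) : states S -> states S' ->
  exists p : G * bool -> R, [/\ forall i, 0 <= p i, \sum_i p i = 1 &
    S - S' = \sum_i (p i)%:C%C *: signed_atom i].
Proof.
move=> /states_decomposition[c1 [hc1 ->]] /states_decomposition[c2 [hc2 ->]].
pose c f := c1 f - c2 f.
have hc : \sum_f `|c f| <= 6.
  apply: (@le_trans _ _ (\sum_f (`|c1 f| + `|c2 f|))).
    by apply: ler_sum => f _; exact: ler_normB.
  by rewrite big_split/=; lra.
set s := \sum_f `|c f| in hc.
pose K : R := #|G|%:R.
have K0 : 0 < K.
  by rewrite ltr0n; apply/card_gt0P; exists [ffun _ => ord0].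
(* Positive and negative parts of the coefficients over 6. The missing mass 1 - s/6 is spread evenly
   over both signs of every atom, where it cancels. *)
pose p (i : G * bool) : R :=
  ((`|c i.1| + (if i.2 then c i.1 else - c i.1)) / 2) / 6
   + (1 - s / 6) / (2 * K).
exists p; split.
- move=> [f b]; rewrite /p /= addr_ge0//.
    have := ler_norm (c f); have := ler_norm (- c f); rewrite normrN => ? ?.
    by rewrite !divr_ge0//; case: b; lra.
  by rewrite divr_ge0 ?mulr_ge0 ?(ltW K0)//; lra.
- rewrite (eq_bigr (fun i => p (i.1, i.2))); last by case.
  rewrite -(pair_bigA _ (fun f b => p (f, b))) /=.
  transitivity (\sum_f (`|c f| / 6 + (1 - s / 6) / K)).
    apply: eq_bigr => f _; rewrite big_bool /p /=.
    by field; rewrite gt_eqF.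
  rewrite big_split/= -mulr_suml -/s sumr_const -[_ *+ _]mulr_natl -/K.
  by field; rewrite gt_eqF.
- rewrite -sumrB (eq_bigr (fun i => (p (i.1, i.2))%:C%C *: signed_atom (i.1, i.2)));
    last by case.
  rewrite -(pair_bigA _ (fun f b => (p (f, b))%:C%C *: signed_atom (f, b))) /=.
  apply: eq_bigr => f _; rewrite big_bool /signed_atom /= !scalerA -scalerDl -scalerBl.
  congr (_ *: _); rewrite -!rmorphM -rmorphD -rmorphB; congr (_%:C)%C.
  by rewrite /p /= -/(c f); field; rewrite gt_eqF.
Qed.

End AtomicDecomposition.

(** * Independence for products of nonnegative functions *)

Section IndependentProducts.
Context d (T : measurableType d) (R : realType) (P : probability T R).
Import HBNNSimple.

Lemma integral_mul_factor (G h : T -> R) (c : R) :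
  measurable_fun setT G -> (forall x, 0 <= G x) ->
  measurable_fun setT h -> (forall x, 0 <= h x) -> 0 <= c ->
  (forall B : set R, measurable B ->
    (\int[P]_x (G x * \1_(h @^-1` B) x)%:E = c%:E * P (h @^-1` B))%E) ->
  (\int[P]_x (G x * h x)%:E = c%:E * \int[P]_x (h x)%:E)%E.
Proof.
move=> mG G0 mh h0 c0 hyp.
have mhB (B : set R) : measurable B -> measurable (h @^-1` B).
  by move=> mB; rewrite -[_ @^-1` _]setTI; exact: mh.
(* Approximating the nonnegative part of the identity, rather than [h], by simple functions keeps
   every approximation a function of [h], so that its level sets are preimages under [h], as [hyp]
   demands. *)
pose phi (y : R) : \bar R := (Num.max y 0)%:E.
have mphi : measurable_fun [set: R] phi.
  by apply/measurable_EFinP; apply: measurable_maxr.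
pose g k := nnsfun_approx measurableT mphi k.
have phi0 y : (0 <= phi y)%E by rewrite lee_fin le_max lexx orbT.
have g_ge0 k y : 0 <= g k y by [].
have mg k : measurable_fun setT (fun x => g k (h x)).
  by apply: measurableT_comp.
have cvg_g x : (fun k => (g k (h x))%:E) @ \oo --> (h x)%:E.
  have := @cvg_nnsfun_approx _ _ _ _ measurableT _ mphi (fun y _ => phi0 y) (h x) I.
  by rewrite /phi (max_idPl (h0 x)).
have nd_g x : {homo (fun k => g k (h x)) : k l / (k <= l)%N >-> k <= l}.
  move=> k l kl.
  by have /lefP/(_ (h x)) := nd_nnsfun_approx measurableT mphi kl.
pose s k := fset_set (range (g k)).
have gE k y : g k y = \sum_(r <- s k) Num.max r 0 * \1_(g k @^-1` [set r]) y.
  rewrite fimfunE fsbig_finite//=; apply: eq_big_seq => r.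
  by rewrite in_fset_set// => /set_mem[z _ <-]; rewrite (max_idPl _).
have key k : (\int[P]_x (G x * g k (h x))%:E = c%:E * \int[P]_x (g k (h x))%:E)%E.
  have mB r : measurable (g k @^-1` [set r]) by exact: measurable_sfunP.
  have m1 r : measurable_fun setT (fun x => \1_(h @^-1` (g k @^-1` [set r])) x : R).
    by apply: measurable_indic; exact: mhB.
  have r0 (r : R) : 0 <= Num.max r 0 by rewrite le_max lexx orbT.
  transitivity (\int[P]_x \sum_(r <- s k) (Num.max r 0)%:E *
      (G x * \1_(h @^-1` (g k @^-1` [set r])) x)%:E)%E.
    apply: eq_integral => x _; rewrite gE mulr_sumr -sumEFin.
    by apply: eq_bigr => r _; rewrite -EFinM mulrCA.
  rewrite ge0_integral_sum//; last 2 first.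
  - move=> r; apply/measurable_funeM/measurable_EFinP.
    exact: measurable_funM.
  - by move=> r x _; rewrite -EFinM lee_fin mulr_ge0// mulr_ge0.
  transitivity (c%:E * \int[P]_x \sum_(r <- s k) (Num.max r 0)%:E *
      (\1_(h @^-1` (g k @^-1` [set r])) x)%:E)%E; last first.
    congr (_ * _)%E; apply: eq_integral => x _; rewrite gE -sumEFin.
    by apply: eq_bigr => r _; rewrite EFinM.
  rewrite ge0_integral_sum//; last 2 first.
  - by move=> r; apply/measurable_funeM/measurable_EFinP.
  - by move=> r x _; rewrite -EFinM lee_fin mulr_ge0.
  rewrite ge0_sume_distrr; last first.
    by move=> r _; apply: integral_ge0 => x _; rewrite -EFinM lee_fin mulr_ge0.
  apply: eq_bigr => r _; rewrite ge0_integralZl_EFin//; last 2 first.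
  - by move=> x _; rewrite lee_fin mulr_ge0.
  - by apply/measurable_EFinP/measurable_funM.
  rewrite hyp// ge0_integralZl_EFin//; last exact/measurable_EFinP.
  by rewrite integral_indic ?setIT//; [rewrite muleCA|exact: mhB].
have lim1 : (fun k => (\int[P]_x (G x * g k (h x))%:E)%E) @ \oo -->
    (\int[P]_x (G x * h x)%:E)%E.
  have -> : (\int[P]_x (G x * h x)%:E =
      \int[P]_x limn (fun k => (G x * g k (h x))%:E))%E.
    apply: eq_integral => x _; apply/esym/cvg_lim => //.
    under eq_fun do rewrite EFinM.
    rewrite EFinM; exact: cvgeZl (cvg_g x).
  apply: cvg_monotone_convergence => //.
  - by move=> k; apply/measurable_EFinP/measurable_funM.
  - by move=> k x _; rewrite lee_fin mulr_ge0.
  - by move=> x _ k l kl; rewrite lee_fin ler_wpM2l// nd_g.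
have lim2 : (fun k => (\int[P]_x (g k (h x))%:E)%E) @ \oo --> (\int[P]_x (h x)%:E)%E.
  have -> : (\int[P]_x (h x)%:E = \int[P]_x limn (fun k => (g k (h x))%:E))%E.
    by apply: eq_integral => x _; apply/esym/cvg_lim => //; exact: cvg_g.
  apply: cvg_monotone_convergence => //.
  - by move=> k; exact/measurable_EFinP.
  - by move=> k x _; rewrite lee_fin.
  - by move=> x _ k l kl; rewrite lee_fin nd_g.
rewrite -(cvg_lim (@ereal_hausdorff R) lim1); apply/cvg_lim => //.
under eq_fun do rewrite key.
exact: cvgeZl lim2.
Qed.

(** Induction on a list [s] outside which all factors are indicators of events of [F]. With [s]
    empty this is independence itself; otherwise [integral_mul_factor] reduces one listed factor to
    indicators, which shortens the list. *)
Lemma independent_integral_prod (I : finType) (F : I -> set (set T))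
    (f : I -> T -> R) (mu : I -> R) :
  mutually_independent P F ->
  (forall i, F i `<=` measurable) ->
  (forall i (B : set R), measurable B -> F i (f i @^-1` B)) ->
  (forall i x, 0 <= f i x) ->
  (forall i, (\int[P]_x (f i x)%:E = (mu i)%:E)%E) ->
  (\int[P]_x (\prod_i f i x)%:E = (\prod_i mu i)%:E)%E.
Proof.
move=> indep mF Ff f0 fmu.
have gen : forall (s : seq I) (f : I -> T -> R) (mu : I -> R),
    (forall i (B : set R), measurable B -> F i (f i @^-1` B)) ->
    (forall i x, 0 <= f i x) ->
    (forall i, (\int[P]_x (f i x)%:E = (mu i)%:E)%E) ->
    (forall i, i \notin s -> exists2 E, F i E & f i = \1_E) ->
    (\int[P]_x (\prod_i f i x)%:E = (\prod_i mu i)%:E)%E.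
  elim=> [|k s IH] {f mu Ff f0 fmu} f mu Ff f0 fmu fs.
    have /choice[E hE] : forall i, exists E, F i E /\ f i = \1_E.
      by move=> i; have [//|E FE fE] := fs i; exists E.
    have FE i : F i (E i) by have [] := hE i.
    have fE i x : f i x = \1_(E i) x by have [_ ->] := hE i.
    have mE i : measurable (E i) by exact: mF (FE i).
    have mint : measurable (\bigcap_(i in [set` [set: I]%SET]) E i).
      by apply: fin_bigcap_measurable.
    transitivity (P (\bigcap_(i in [set` [set: I]%SET]) E i)).
      rewrite -[in RHS](setIT (\bigcap_(i in _) _)) -integral_indic//.
      apply: eq_integral => x _; congr EFin.
      have [h|/existsNP[i hi]] := pselect (forall i, E i x).
        rewrite indicE mem_set// big1// => i _.
        by rewrite fE indicE mem_set.
      rewrite indicE memNset => [|h]; last by apply/hi/h; rewrite /= inE.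
      by rewrite (bigD1 i)//= fE indicE memNset// mul0r.
    rewrite indep => [|i _]; last exact: FE.
    rewrite -prodEFin; apply: eq_big => [i|i _]; first by rewrite inE.
    rewrite -fmu -[in LHS](setIT (E i)) -integral_indic//.
    by apply: eq_integral => x _; rewrite fE.
  pose G x := \prod_(i | i != k) f i x.
  pose c := \prod_(i | i != k) mu i.
  have mu0 i : 0 <= mu i.
    by rewrite -lee_fin -fmu; apply: integral_ge0 => x _; rewrite lee_fin.
  have mf i : measurable_fun setT (f i).
    by move=> _ B mB; rewrite setTI; apply: mF (Ff _ _ mB).
  have -> : (\int[P]_x (\prod_i f i x)%:E = \int[P]_x (G x * f k x)%:E)%E.
    by apply: eq_integral => x _; rewrite (bigD1 k)//= mulrC.
  rewrite (bigD1 k)//= mulrC -/c EFinM -fmu.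
  apply: integral_mul_factor => //.
  - rewrite /G; under eq_fun do rewrite -big_filter.
    by apply: measurable_prod.
  - by move=> x; apply: prodr_ge0.
  - by apply: prodr_ge0.
  - move=> B mB; have mfB : measurable (f k @^-1` B) by exact: mF (Ff _ _ mB).
    (* The family with its k-th factor replaced by an indicator falls under the induction
       hypothesis. *)
    pose f' i := if i == k then \1_(f k @^-1` B) else f i.
    pose mu' i := if i == k then fine (P (f k @^-1` B)) else mu i.
    have -> : (\int[P]_x (G x * \1_(f k @^-1` B) x)%:E =
        \int[P]_x (\prod_i f' i x)%:E)%E.
      apply: eq_integral => x _; rewrite (bigD1 k)//= mulrC /f' eqxx.
      by congr ((_ * _)%:E); apply: eq_bigr => i /negbTE->.
    rewrite (IH f' mu').
    + rewrite (bigD1 k)//= EFinM muleC /mu' eqxx fineK ?fin_num_measure//.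
      by congr (_ * _)%E; congr EFin; apply: eq_bigr => i /negbTE->.
    + move=> i C mC; rewrite /f'; case: eqVneq => [->|_]; last exact: Ff.
      rewrite preimage_indic; have FT : F k setT.
        by rewrite -(preimage_setT (f k)); exact: Ff.
      case: ifPn => _; case: ifPn => _ //; last 2 first.
      * by rewrite preimage_setC; apply: Ff; exact: measurableC.
      * by rewrite -(preimage_set0 (f k)); exact: Ff.
      exact: Ff.
    + by move=> i x; rewrite /f'; case: ifP.
    + move=> i; rewrite /f' /mu'; case: eqVneq => // _.
      by rewrite integral_indic// setIT fineK ?fin_num_measure.
    + move=> i si; rewrite /f'; case: eqVneq => [->|ik].
        by exists (f k @^-1` B) => //; exact: Ff.
      by apply: fs; rewrite inE negb_or ik.
apply: (gen (index_enum I)) => // i.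
by rewrite mem_index_enum.
Qed.

End IndependentProducts.

(** * Exponential moments and a weighted Markov bound *)

Section MomentBounds.
Context d (T : measurableType d) (R : realType) (P : probability T R).
Local Open Scope ereal_scope.

Lemma integral_cst_probability (a : R) : \int[P]_x a%:E = a%:E.
Proof.
rewrite integral_cst// -[RHS]mule1; congr (_ * _).
exact: probability_setT.
Qed.

(** A union bound with prior weights: Markov's inequality is applied once, to the weighted sum,
    which dominates each of its terms. *)
Lemma union_markov (I : finType) (f : I -> T -> R) (w : I -> R) (t : R) :
  (forall i, measurable_fun setT (f i)) -> (forall i x, (0 <= f i x)%R) ->
  (forall i, \int[P]_x (f i x)%:E <= 1) -> (forall i, (0 <= w i)%R) ->
  (\sum_i w i <= 1)%R ->
  exists E : set T, [/\ measurable E, (1 - expR (- t))%:E <= P E &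
    forall x, E x -> forall i, (w i * f i x <= expR t)%R].
Proof.
move=> mf f0 f1 w0 w1.
pose Phi x := (\sum_i w i * f i x)%R.
have mPhi : measurable_fun setT Phi.
  by apply: measurable_sum => i; exact: measurable_funM.
have Phi0 x : (0 <= Phi x)%R by apply: sumr_ge0 => i _; rewrite mulr_ge0.
pose E := [set x | (Phi x <= expR t)%R].
have mE : measurable E.
  have -> : E = setT `&` Phi @^-1` `]-oo, expR t].
    by apply/seteqP; split => x /=; rewrite in_itv/= => // -[].
  exact: mPhi.
exists E; split => //; last first.
  move=> x Ex i; apply: le_trans Ex; rewrite /Phi (bigD1 i)//= lerDl.
  by apply: sumr_ge0 => j _; rewrite mulr_ge0.
have intPhi : \int[P]_x (Phi x)%:E <= 1.
  under eq_integral do rewrite /Phi -sumEFin.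
  rewrite ge0_integral_sum//; last 2 first.
  - by move=> i; apply/measurable_EFinP/measurable_funM.
  - by move=> i x _; rewrite lee_fin mulr_ge0.
  apply: (@le_trans _ _ (\sum_i (w i)%:E)); last by rewrite sumEFin lee_fin.
  apply: lee_sum => i _; under eq_integral do rewrite EFinM.
  rewrite ge0_integralZl_EFin//; last 2 first.
  - by move=> x _; rewrite lee_fin.
  - exact/measurable_EFinP.
  by rewrite -[leRHS]mule1 lee_wpmul2l ?lee_fin.
have mEC : measurable (~` E) by exact: measurableC.
have PEC : P (~` E) <= (expR (- t))%:E.
  have : (expR t)%:E * P (~` E) <= 1.
    apply: le_trans intPhi; rewrite -(setIT (~` E)) -integral_indic//.
    rewrite -ge0_integralZl_EFin ?expR_ge0//; last first.
      by apply/measurable_EFinP; exact: measurable_indic.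
    apply: ge0_le_integral => //.
    - by apply: measurable_funeM; apply/measurable_EFinP; exact: measurable_indic.
    - exact/measurable_EFinP.
    - move=> x _; rewrite -EFinM lee_fin indicE.
      case: (boolP (x \in _)); rewrite ?mulr0// mulr1 => /set_mem /=.
      by move=> /negP; rewrite -ltNge => /ltW.
  rewrite expRN -(@fineK _ (P (~` E))) ?fin_num_measure// -EFinM !lee_fin => h.
  by rewrite -[leRHS]mul1r ler_pdivlMr ?expR_gt0// mulrC.
rewrite probability_setC// in PEC.
move: PEC; rewrite -(@fineK _ (P E)) ?fin_num_measure// -EFinB !lee_fin; lra.
Qed.

(** [b1] may be negative. Its negative part is moved to the side of [f], so that only nonnegative
    functions are integrated and no integrability of [f] is presupposed. *)
Lemma integral_le_affine (f g1 g2 : T -> R) (a b1 b2 v1 v2 : R) :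
  measurable_fun setT f -> measurable_fun setT g1 -> measurable_fun setT g2 ->
  (forall x, (0 <= f x)%R) -> (forall x, (0 <= g1 x)%R) ->
  (forall x, (0 <= g2 x)%R) -> (0 <= a)%R -> (0 <= b2)%R ->
  \int[P]_x (g1 x)%:E = v1%:E -> \int[P]_x (g2 x)%:E = v2%:E ->
  (forall x, (f x <= a + b1 * g1 x + b2 * g2 x)%R) ->
  \int[P]_x (f x)%:E <= (a + b1 * v1 + b2 * v2)%:E.
Proof.
move=> mf mg1 mg2 f0 g10 g20 a0 b20 i1 i2 fle.
pose bp := Num.max b1 0%R; pose bn := Num.max (- b1)%R 0%R.
have bp0 : (0 <= bp)%R by rewrite le_max lexx orbT.
have bn0 : (0 <= bn)%R by rewrite le_max lexx orbT.
have bE : (b1 = bp - bn)%R.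
  by rewrite /bp /bn; have [b0|b0] := lerP 0 b1; rewrite /Num.max; case: ltrP; case: ltrP; lra.
have mgZ (b : R) (g : T -> R) : measurable_fun setT g ->
    measurable_fun setT (fun x => (b * g x)%:E).
  by move=> mg; apply/measurable_EFinP; apply: measurable_funM.
have intZ (b v : R) (g : T -> R) : (0 <= b)%R -> measurable_fun setT g ->
    (forall x, (0 <= g x)%R) -> \int[P]_x (g x)%:E = v%:E ->
    \int[P]_x (b * g x)%:E = (b * v)%:E.
  move=> b0 mg g0 iv; under eq_integral do rewrite EFinM.
  rewrite ge0_integralZl_EFin ?iv//; last exact/measurable_EFinP.
  by move=> x _; rewrite lee_fin.
have : \int[P]_x ((f x)%:E + (bn * g1 x)%:E) <=
    \int[P]_x ((a%:E + (bp * g1 x)%:E) + (b2 * g2 x)%:E).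
  apply: ge0_le_integral => //.
  - by move=> x _; rewrite -EFinD lee_fin addr_ge0// mulr_ge0.
  - by apply: emeasurable_funD; [exact/measurable_EFinP|exact: mgZ].
  - apply: emeasurable_funD; last exact: mgZ.
    by apply: emeasurable_funD => //; exact: mgZ.
  - move=> x _; rewrite -!EFinD lee_fin; have := fle x; rewrite {1}bE; lra.
rewrite ge0_integralD//; last 4 first.
- by move=> x _; rewrite lee_fin.
- exact/measurable_EFinP.
- by move=> x _; rewrite lee_fin mulr_ge0.
- exact: mgZ.
rewrite [X in _ <= X]ge0_integralD//; last 4 first.
- by move=> x _; rewrite -EFinD lee_fin addr_ge0// mulr_ge0.
- by apply: emeasurable_funD => //; exact: mgZ.
- by move=> x _; rewrite lee_fin mulr_ge0.
- exact: mgZ.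
rewrite ge0_integralD//; last 2 first.
- by move=> x _; rewrite lee_fin mulr_ge0.
- exact: mgZ.
rewrite (intZ _ _ _ bn0 mg1 g10 i1) (intZ _ _ _ bp0 mg1 g10 i1).
rewrite (intZ _ _ _ b20 mg2 g20 i2) integral_cst_probability.
rewrite -!EFinD -leeBrDr// -EFinB => h; apply: le_trans h _.
by rewrite lee_fin bE; lra.
Qed.

Lemma integral_ge0_finite (f : T -> R) (b : R) :
  (forall x, (0 <= f x)%R) -> \int[P]_x (f x)%:E <= b%:E ->
  exists v, [/\ \int[P]_x (f x)%:E = v%:E, (0 <= v)%R & (v <= b)%R].
Proof.
move=> f0 fb; have i0 : 0 <= \int[P]_x (f x)%:E.
  by apply: integral_ge0 => x _; rewrite lee_fin.
have fin : \int[P]_x (f x)%:E \is a fin_num.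
  by rewrite ge0_fin_numE// (le_lt_trans fb)// ltry.
exists (fine (\int[P]_x (f x)%:E)); rewrite fineK//; split => //.
  by rewrite fine_ge0.
by rewrite -lee_fin fineK.
Qed.

Lemma measurable_expR_sqr (Z : T -> R) (c : R) : measurable_fun setT Z ->
  measurable_fun setT (fun x => expR (Z x ^+ 2 / c ^+ 2)).
Proof.
move=> mZ; apply: measurableT_comp => //.
by apply: measurable_funM => //; exact: measurable_funX.
Qed.

(** Centring cancels the linear term of [expR_square_le]; 32 is its 16 times the bound 2 on the
    exponential moment. *)
Lemma square_mgf (Z : T -> R) (c r2 s : R) :
  measurable_fun setT Z -> (0 < c)%R ->
  \int[P]_x (expR (Z x ^+ 2 / c ^+ 2))%:E <= 2%:E ->
  \int[P]_x (Z x ^+ 2)%:E = r2%:E -> (`|s| <= (2 * c ^+ 2)^-1)%R ->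
  \int[P]_x (expR (s * (Z x ^+ 2 - r2)))%:E <= (expR (32 * s ^+ 2 * c ^+ 4))%:E.
Proof.
move=> mZ c0 hexp hr hs.
have mZ2 : measurable_fun setT (fun x => (Z x ^+ 2)%R) by exact: measurable_funX.
have [v [iv v0 v2]] := integral_ge0_finite (fun x => expR_ge0 _) hexp.
have sc0 : (0 <= 16 * s ^+ 2 * c ^+ 4)%R.
  have c40 : (0 <= c ^+ 4)%R by exact: exprn_ge0 (ltW c0).
  by rewrite mulr_ge0// mulr_ge0// sqr_ge0.
have main : \int[P]_x (expR (s * Z x ^+ 2))%:E <=
    (1 + s * r2 + 16 * s ^+ 2 * c ^+ 4 * v)%:E.
  apply: (integral_le_affine _ mZ2 (measurable_expR_sqr c mZ) _ _ _ _ sc0 hr iv) => //.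
  - by apply: measurableT_comp => //; exact: measurable_funM.
  - by move=> x; exact: sqr_ge0.
  - by move=> x; exact: expR_square_le.
under eq_integral do rewrite mulrBr expRD mulrC EFinM.
rewrite ge0_integralZl_EFin//; last first.
  by apply/measurable_EFinP; apply: measurableT_comp => //; exact: measurable_funM.
apply: (@le_trans _ _ ((expR (- (s * r2)))%:E *
    (1 + s * r2 + 16 * s ^+ 2 * c ^+ 4 * v)%:E)).
  by rewrite lee_pmul2l// lte_fin expR_gt0.
rewrite -EFinM lee_fin.
apply: (@le_trans _ _ (expR (- (s * r2)) * expR (s * r2 + 32 * s ^+ 2 * c ^+ 4))%R).
  rewrite ler_wpM2l ?expR_ge0//; apply: le_trans (expR_ge1Dx _).
  by rewrite -addrA !lerD2l; nra.
by rewrite -expRD ler_expR; lra.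
Qed.

(** The strict inequality avoids asking whether the infimum is attained. *)
Lemma psi2_expR_le (eta : T -> R) (c : R) : measurable_fun setT eta ->
  psi2_norm P eta < c%:E -> (0 < c)%R /\
  \int[P]_x (expR (eta x ^+ 2 / c ^+ 2))%:E <= 2%:E.
Proof.
move=> meta /ereal_inf_lt[_ [c' [c'0 hc'] <-]]; rewrite lte_fin => c'c.
have c0 : (0 < c)%R by exact: lt_trans c'c.
split => //; move: hc'; rewrite unlock => hc'.
have e1 x : (1 <= expR (`|eta x| ^+ 2 / c' ^+ 2))%R.
  by rewrite -expR0 ler_expR divr_ge0 ?sqr_ge0.
have mexp : measurable_fun setT (fun x => expR (`|eta x| ^+ 2 / c' ^+ 2) - 1)%R.
  apply: measurable_funB => //.
  by apply: measurable_expR_sqr; apply: measurableT_comp.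
apply: (@le_trans _ _ (\int[P]_x ((expR (`|eta x| ^+ 2 / c' ^+ 2) - 1)%:E + 1%:E))).
  apply: ge0_le_integral => //.
  - by apply/measurable_EFinP; exact: measurable_expR_sqr.
  - by apply: emeasurable_funD => //; exact/measurable_EFinP.
  - move=> x _; rewrite -EFinD lee_fin subrK ler_expR real_normK ?num_real//.
    rewrite ler_wpM2l ?sqr_ge0// lef_pV2 ?posrE ?exprn_gt0//.
    by rewrite lerXn2r ?nnegrE// ltW.
rewrite ge0_integralD//; last 2 first.
- by move=> x _; rewrite lee_fin subr_ge0.
- exact/measurable_EFinP.
rewrite integral_cst_probability.
by apply: le_trans (leeD hc' (lexx _)) _; rewrite -EFinD lee_fin.
Qed.

Lemma same_law_integral d' (T' : measurableType d') (X Y : {RV P >-> T'})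
    (phi : T' -> R) : same_law X Y -> measurable_fun setT phi ->
  (forall y, (0 <= phi y)%R) ->
  \int[P]_x (phi (X x))%:E = \int[P]_x (phi (Y x))%:E.
Proof.
move=> XY mphi phi0.
have mphi' : measurable_fun setT (EFin \o phi) by exact/measurable_EFinP.
transitivity (\int[distribution P X]_y (EFin \o phi) y).
  by rewrite ge0_integral_distribution.
transitivity (\int[distribution P Y]_y (EFin \o phi) y).
  by apply: eq_measure_integral => A mA _; exact: XY.
by rewrite ge0_integral_distribution.
Qed.

End MomentBounds.

(** * Exponential moments of the squared noise *)

Section NoiseMoments.
Context d (T : measurableType d) (R : realType) (P : probability T R).
Local Open Scope ereal_scope.

Lemma integral_sqr_sigma (eta : T -> R) : measurable_fun setT eta ->
  psi2_norm P eta < +oo ->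
  \int[P]_x (eta x ^+ 2)%:E = (sigma_noise P eta ^+ 2)%:E.
Proof.
move=> meta psifin.
have [c [hc _]] : exists c : R, psi2_norm P eta < c%:E /\ True.
  move: psifin => /ereal_inf_lt[_ [c [c0 hc] <-] _].
  exists (c + 1)%R; split => //; apply: (@le_lt_trans _ _ c%:E).
    by apply: ereal_inf_lbound; exists c.
  by rewrite lte_fin ltrDl.
have [c0 hexp] := psi2_expR_le meta hc.
have c20 : (0 < c ^+ 2)%R by rewrite exprn_gt0.
have meta2 : measurable_fun setT (fun x => (eta x ^+ 2)%R) by exact: measurable_funX.
have h : \int[P]_x (eta x ^+ 2)%:E <= (c ^+ 2 * 2)%:E.
  apply: (@le_trans _ _ (\int[P]_x ((c ^+ 2)%:E * (expR (eta x ^+ 2 / c ^+ 2))%:E))).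
    apply: ge0_le_integral => //.
    - by move=> x _; rewrite lee_fin sqr_ge0.
    - exact/measurable_EFinP.
    - by apply: measurable_funeM; apply/measurable_EFinP; exact: measurable_expR_sqr.
    - move=> x _; rewrite -EFinM lee_fin mulrC -ler_pdivrMr//.
      by have := expR_ge1Dx (eta x ^+ 2 / c ^+ 2)%R; lra.
  rewrite ge0_integralZl_EFin ?(ltW c20)//; last first.
    by apply/measurable_EFinP; exact: measurable_expR_sqr.
  by rewrite [(c ^+ 2 * 2)%:E]EFinM lee_wpmul2l// lee_fin ltW.
have [v [iv v0 _]] := integral_ge0_finite (fun x => sqr_ge0 (eta x)) h.
rewrite /sigma_noise unlock iv /= sqr_sqrtr//.
Qed.

Lemma ln2_le45 : (ln 2 <= 4 / 5 :> R)%R.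
Proof.
rewrite -ler_expR lnK ?posrE//.
have -> : (4 / 5 = 4%:R * (1 / 5) :> R)%R by field.
rewrite expRM_natl.
have h := expR_ge1Dx (1 / 5 : R)%R.
apply: (@le_trans _ _ ((1 + 1 / 5) ^+ 4)%R); first by rewrite !exprS expr0; lra.
by apply: lerXn2r => //; rewrite nnegrE ?expR_ge0//; lra.
Qed.

(** Jensen applied to E exp(eta^2/c^2) <= 2 gives sigma^2/c^2 <= ln 2 < 1 for c above the norm.
    Hence the logarithm in [c_noise] is bounded away from 0, and [c_noise] dominates a multiple of
    the psi_2-norm. *)
Lemma psi2_sigma_gap (eta : T -> R) : measurable_fun setT eta ->
  psi2_norm P eta < +oo -> (0 < sigma_noise P eta)%R ->
  let psi := fine (psi2_norm P eta) in
  (0 < psi)%R /\ (1 / 20 <= ln (psi / sigma_noise P eta))%R.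
Proof.
move=> meta psifin s0 psi; set s := sigma_noise P eta in s0 *.
have i2 := integral_sqr_sigma meta psifin; rewrite -/s in i2.
have psi0' : 0 <= psi2_norm P eta.
  by apply: le_ereal_inf_tmp => _ [c [c0 _] <-]; rewrite lee_fin ltW.
have psiE : psi2_norm P eta = psi%:E by rewrite fineK// ge0_fin_numE.
have psi0 : (0 <= psi)%R by rewrite -lee_fin -psiE.
have meta2 : measurable_fun setT (fun x => (eta x ^+ 2)%R) by exact: measurable_funX.
have key (c : R) : (psi < c)%R -> (s ^+ 2 / c ^+ 2 <= 4 / 5)%R.
  move=> pc; have pc' : psi2_norm P eta < c%:E by rewrite psiE lte_fin.
  have [c0 hexp] := psi2_expR_le meta pc'.
  have c20 : (0 < c ^+ 2)%R by rewrite exprn_gt0.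
  set y := (s ^+ 2 / c ^+ 2)%R.
  have y0 : (0 <= y)%R by rewrite divr_ge0 ?sqr_ge0// ltW.
  have [v [iv v0 v2]] := integral_ge0_finite (fun x => expR_ge0 _) hexp.
  have my : measurable_fun setT (fun x => expR y / c ^+ 2 * eta x ^+ 2)%R.
    exact: measurable_funM.
  have f0 x : (0 <= expR y / c ^+ 2 * eta x ^+ 2)%R.
    by rewrite mulr_ge0 ?sqr_ge0// divr_ge0 ?expR_ge0 ?ltW.
  have iy : \int[P]_x (expR y / c ^+ 2 * eta x ^+ 2)%:E = (expR y * y)%:E.
    under eq_integral do rewrite EFinM.
    rewrite ge0_integralZl_EFin ?divr_ge0 ?expR_ge0 ?(ltW c20)//; last 2 first.
    - by move=> x _; rewrite lee_fin sqr_ge0.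
    - exact/measurable_EFinP.
    by rewrite i2 -EFinM; congr EFin; rewrite /y; ring.
  have : \int[P]_x (expR y + expR y / c ^+ 2 * eta x ^+ 2)%:E <=
      (expR y * y + 0 * s ^+ 2 + 1 * v)%:E.
    apply: (integral_le_affine _ meta2 (measurable_expR_sqr c meta) _ _ _ _ _ i2 iv) => //.
    - exact: measurable_funD.
    - by move=> x; rewrite addr_ge0 ?expR_ge0.
    - by move=> x; exact: sqr_ge0.
    - by rewrite mulr_ge0// expR_ge0.
    - move=> x; set b := (eta x ^+ 2 / c ^+ 2)%R.
      have := expR_ge1Dx (b - y)%R; rewrite expRB ler_pdivlMr ?expR_gt0//.
      have -> : (expR y / c ^+ 2 * eta x ^+ 2 = expR y * b)%R by rewrite /b; ring.
      by lra.
  under eq_integral do rewrite EFinD.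
  rewrite ge0_integralD//; last 2 first.
  - by move=> x _; rewrite lee_fin.
  - exact/measurable_EFinP.
  rewrite integral_cst_probability iy -EFinD lee_fin => h.
  apply: le_trans ln2_le45; rewrite -ler_expR lnK ?posrE//; lra.
have psi_gt0 : (0 < psi)%R.
  rewrite lt_neqAle psi0 andbT; apply/eqP => psiz.
  have := key s; rewrite -psiz => /(_ s0).
  by rewrite divff ?gt_eqF ?exprn_gt0//; lra.
split => //.
(* The factor 21/20 leaves room for the strict inequality: 4/5 * (21/20)^2 is still below
   (19/20)^2. *)
have := key (21 / 20 * psi)%R.
have -> : (s ^+ 2 / (21 / 20 * psi) ^+ 2 = (s / psi) ^+ 2 * (400 / 441))%R.
  by field; rewrite gt_eqF.
have pp : (psi < 21 / 20 * psi)%R by lra.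
move=> /(_ pp) h.
have sp0 : (0 <= s / psi)%R by rewrite divr_ge0 ?ltW.
have sp : (s / psi <= 19 / 20)%R.
  rewrite leNgt; apply/negP => h'.
  have : ((19 / 20) ^+ 2 <= (s / psi) ^+ 2)%R.
    by apply: lerXn2r; rewrite ?nnegrE//; lra.
  move: h; set u := ((s / psi) ^+ 2)%R; rewrite expr2; lra.
have := ln_ge_1subV (divr_gt0 psi_gt0 s0); rewrite invf_div; lra.
Qed.

(** Bounds 16 (2 L + ln 4) by a multiple of L^2, given ln 4 <= 3 and L >= 1/20: then L <= 20 L^2 and
    1 <= 400 L^2. *)
Definition noise_const : R := (16 * (40 + 3 * (20 * 20)))%R.

Lemma noise_const_gt0 : (0 < noise_const)%R.
Proof. by rewrite /noise_const mulr_gt0// addr_gt0// !mulr_gt0. Qed.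

(* The exponent 1/q may exceed the psi_2-scale by the factor ln(psi/sigma)^2: this is
   where [c_noise] enters.  The slack [g] covers noise that vanishes almost surely. *)
Lemma noise_square_mgf (eta : T -> R) (g : R) : measurable_fun setT eta ->
  psi2_norm P eta < +oo -> (0 < g)%R ->
  exists q : R, [/\ (0 < q)%R, (q^-1 <= noise_const * c_noise P eta ^+ 2 + g)%R &
   \int[P]_x (expR (q * eta x ^+ 2))%:E <=
     (expR (8 * q * sigma_noise P eta ^+ 2))%:E].
Proof.
move=> meta psifin g0.
have meta2 : measurable_fun setT (fun x => (eta x ^+ 2)%R) by exact: measurable_funX.
have i2 := integral_sqr_sigma meta psifin.
have s0 : (0 <= sigma_noise P eta)%R by exact: sqrtr_ge0.
set s := sigma_noise P eta in i2 s0 *.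
move: s0; rewrite le_eqVlt => /predU1P[sz|s0].
  exists (g^-1)%R; split; first by rewrite invr_gt0.
    by rewrite invrK lerDr (mulr_ge0 (ltW noise_const_gt0))// sqr_ge0.
  have ae0 : ae_eq P setT (fun x => (eta x ^+ 2)%:E) (cst 0).
    apply/(ae_eq_integral_abs P measurableT); first exact/measurable_EFinP.
    under eq_integral do rewrite gee0_abs ?lee_fin ?sqr_ge0//.
    by rewrite i2 -sz expr0n.
  have -> : \int[P]_x (expR (g^-1 * eta x ^+ 2))%:E = \int[P]_x 1%R%:E.
    apply: ge0_ae_eq_integral => //.
    - apply/measurable_EFinP; apply: measurableT_comp => //.
      exact: measurable_funM.
    - apply: filterS ae0 => x /= h _.
      by have [->] := h I; rewrite mulr0 expR0.
  by rewrite integral_cst_probability -sz expr0n mulr0 expR0.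
have [psi0 L20] := psi2_sigma_gap meta psifin s0.
set psi := fine _ in psi0 L20; rewrite -/s in L20.
set L := ln (psi / s) in L20.
have psiE : psi2_norm P eta = psi%:E.
  rewrite fineK// ge0_fin_numE//.
  by apply: le_ereal_inf_tmp => _ [c [c0 _] <-]; rewrite lee_fin ltW.
pose c := (2 * psi)%R.
have pc : psi2_norm P eta < c%:E by rewrite psiE lte_fin /c; lra.
have [c0 hexp] := psi2_expR_le meta pc.
have [v [iv v0 v2]] := integral_ge0_finite (fun x => expR_ge0 _) hexp.
have ln4 : (1 <= ln 4 :> R)%R.
  by rewrite -ler_expR lnK ?posrE//; exact: expR1_le4.
have ln43 : (ln 4 <= 3 :> R)%R.
  by have := @le_ln1Dx R 3; rewrite (_ : (1 + 3 = 4)%R); [apply|]; lra.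
(* Solves expR (- (4 th)^-1) = s^2/c^2 for c = 2 psi: the tail term of [expR_scaled_le] becomes of
   the order of the variance, like the linear term. *)
pose th := ((4 * (2 * L + ln 4))^-1)%R.
have th0 : (0 < th)%R by rewrite invr_gt0; lra.
have th4 : (th <= 1 / 4)%R.
  by rewrite /th mul1r lef_pV2 ?posrE; lra.
have eth : (expR (- (4 * th)^-1) = s ^+ 2 / c ^+ 2)%R.
  have -> : (- (4 * th)^-1 = - (L + L + ln 4))%R.
    by rewrite /th invfM invrK; field.
  rewrite expRN !expRD lnK ?posrE//.
  rewrite /L lnK ?posrE ?divr_gt0// /c.
  by field; rewrite !gt_eqF.
have c20 : (0 < c ^+ 2)%R by rewrite exprn_gt0.
exists (th / c ^+ 2)%R; split; first by rewrite divr_gt0.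
  rewrite invf_div /th invrK.
  have -> : c_noise P eta = (psi * L)%R by [].
  have -> : (c ^+ 2 * (4 * (2 * L + ln 4)) = psi ^+ 2 * (16 * (2 * L + ln 4)))%R.
    by rewrite /c; ring.
  have -> : (noise_const * (psi * L) ^+ 2 = psi ^+ 2 * (noise_const * L ^+ 2))%R.
    by ring.
  apply: ler_wpDr; first exact: ltW.
  apply: ler_wpM2l; first exact: sqr_ge0.
  rewrite /noise_const -[leRHS]mulrA; apply: ler_wpM2l; first by [].
  have L1 : (1 <= 20 * L)%R by lra.
  have L2 : (20 * L <= (20 * L) * (20 * L))%R by rewrite ler_peMl//; lra.
  move: L1 L2 ln43; rewrite expr2 => L1 L2 ln43; lra.
have : \int[P]_x (expR (th / c ^+ 2 * eta x ^+ 2))%:E <=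
   (1 + (4 * th / c ^+ 2) * s ^+ 2 + (2 * th * (s ^+ 2 / c ^+ 2)) * v)%:E.
  apply: (integral_le_affine _ meta2 (measurable_expR_sqr c meta) _ _ _ _ _ i2 iv) => //.
  - by apply: measurableT_comp => //; exact: measurable_funM.
  - by move=> x; exact: sqr_ge0.
  - apply: mulr_ge0; first by rewrite mulr_ge0// ltW.
    by rewrite divr_ge0 ?sqr_ge0 ?(ltW c20).
  - move=> x; rewrite -eth.
    have := @expR_scaled_le R th (eta x ^+ 2 / c ^+ 2) th0 th4.
    rewrite divr_ge0 ?sqr_ge0 ?(ltW c20)// => /(_ isT) h.
    rewrite (_ : (th / c ^+ 2 * eta x ^+ 2 = th * (eta x ^+ 2 / c ^+ 2))%R); last by ring.
    by apply: le_trans h _; rewrite le_eqVlt; apply/orP; left; apply/eqP; ring.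
move=> h; apply: le_trans h _; rewrite lee_fin.
apply: le_trans (expR_ge1Dx _); rewrite -addrA lerD2l.
have y0 : (0 <= th * (s ^+ 2 / c ^+ 2))%R.
  by rewrite mulr_ge0 ?(ltW th0)// divr_ge0 ?sqr_ge0 ?(ltW c20).
have -> : (8 * (th / c ^+ 2) * s ^+ 2 = 8 * (th * (s ^+ 2 / c ^+ 2)))%R by ring.
have -> : (4 * th / c ^+ 2 * s ^+ 2 = 4 * (th * (s ^+ 2 / c ^+ 2)))%R by ring.
have -> : (2 * th * (s ^+ 2 / c ^+ 2) * v = 2 * (th * (s ^+ 2 / c ^+ 2)) * v)%R by ring.
move: y0; set y := (th * _)%R; nra.
Qed.

End NoiseMoments.

(** * Products of design and noise, conditionally on the noise *)

Lemma cvgn_sum (R : realType) (I : Type) (r : seq I) (u : I -> nat -> R)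
    (l : I -> R) : (forall i, u i @ \oo --> l i) ->
  (fun k => \sum_(i <- r) u i k) @ \oo --> \sum_(i <- r) l i.
Proof.
move=> ul; elim: r => [|i r IH].
  by rewrite big_nil; under eq_fun do rewrite big_nil; exact: cvg_cst.
by rewrite big_cons; under eq_fun do rewrite big_cons; exact: cvgD.
Qed.

Section NoiseProduct.
Import HBSimple.
Context d (T : measurableType d) (R : realType) (P : probability T R).
Context (n : nat) (Z Y : 'I_n -> T -> R) (F : 'I_n + 'I_n -> set (set T)).
Hypotheses (indep : mutually_independent P F)
  (mF : forall k, F k `<=` measurable)
  (FZ : forall j B, measurable B -> F (inl j) (Z j @^-1` B))
  (FY : forall j B, measurable B -> F (inr j) (Y j @^-1` B)).
Variable V : R.
Hypothesis subg : forall j a,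
  (\int[P]_x (expR (a * Z j x))%:E <= (expR (a ^+ 2 * V / 2))%:E)%E.

Let mZ j : measurable_fun setT (Z j).
Proof. by move=> _ B mB; rewrite setTI; apply: mF (FZ _ mB). Qed.

Let mY j : measurable_fun setT (Y j).
Proof. by move=> _ B mB; rewrite setTI; apply: mF (FY _ mB). Qed.

Let h (a z : R) := expR (a * z - a ^+ 2 * V / 2).

Let mh a : measurable_fun setT (h a).
Proof.
by apply: measurableT_comp => //; apply: measurable_funB => //; exact: measurable_funM.
Qed.

Let mhZ a j : measurable_fun setT (fun x => h a (Z j x)).
Proof. exact: measurableT_comp (mh a) (mZ j). Qed.

Let h1 a j : (\int[P]_x (h a (Z j x))%:E <= 1)%E.
Proof.
rewrite /h; under eq_integral do rewrite expRD mulrC EFinM.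
rewrite ge0_integralZl_EFin ?expR_ge0//; last first.
  apply/measurable_EFinP; apply: measurableT_comp => //.
  exact: measurable_funM.
have e0 : (0 < (expR (- (a ^+ 2 * V / 2)))%:E)%E by rewrite lte_fin expR_gt0.
apply: (@le_trans _ _ ((expR (- (a ^+ 2 * V / 2)))%:E *
    (expR (a ^+ 2 * V / 2))%:E)%E); first by rewrite lee_pmul2l.
by rewrite -EFinM -expRD addNr expR0.
Qed.

Lemma sum_indicator_range (g : {sfun R >-> R}) (H : R -> R) (y : R) :
  let rs := fset_set (range g) : seq R in
  \sum_(i < size rs) \1_(g @^-1` [set rs`_i]) y * H (rs`_i) = H (g y).
Proof.
move=> rs; have urs : uniq rs by exact: fset_uniq.
have gy : g y \in rs by rewrite in_fset_set//; apply/mem_set; exists y.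
have iy : (index (g y) rs < size rs)%N by rewrite index_mem.
rewrite (bigD1 (Ordinal iy))//= nth_index// indicE mem_set// mul1r.
rewrite big1 ?addr0// => i ii; rewrite indicE memNset ?mul0r//= => gyi.
case/negP: ii; apply/eqP/val_inj => /=.
by rewrite gyi index_uniq.
Qed.

(** Expand the product over the finitely many values of g(Y_j). In each term the coefficients of the
    Z_j are constants, so independence factors it; every [h] integrates to at most 1, and the
    probabilities of the value patterns sum to 1. *)
Lemma simple_noise_mgf (g : {sfun R >-> R}) :
  (\int[P]_x (\prod_j h (g (Y j x)) (Z j x))%:E <= 1)%E.
Proof.
pose rs : seq R := fset_set (range g).
pose I : finType := 'I_(size rs).
pose D (i : I) := g @^-1` [set rs`_i].
have mD i : measurable (D i) by exact: measurable_sfunP.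
have mYD j i : measurable (Y j @^-1` D i).
  by rewrite -[_ @^-1` _]setTI; exact: mY.
pose q j i := fine (P (Y j @^-1` D i)).
have q0 j i : 0 <= q j i by rewrite fine_ge0.
have qE j i : (\int[P]_x (\1_(Y j @^-1` D i) x)%:E = (q j i)%:E)%E.
  by rewrite integral_indic// setIT fineK// fin_num_measure.
have q1 j : \sum_i q j i = 1.
  apply: EFin_inj; rewrite -sumEFin; under eq_bigr do rewrite -qE.
  rewrite -ge0_integral_sum//; last first.
    by move=> i; apply/measurable_EFinP; exact: measurable_indic.
  rewrite -[RHS](integral_cst_probability P 1); apply: eq_integral => x _.
  rewrite sumEFin; congr EFin.
  have := sum_indicator_range g (fun=> 1) (Y j x); rewrite -/rs => <-.
  by apply: eq_bigr => i _; rewrite mulr1.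
have /choice[nu hnu] : forall ij : I * 'I_n, exists v,
    [/\ (\int[P]_x (h (rs`_ij.1) (Z ij.2 x))%:E = v%:E)%E, 0 <= v & v <= 1].
  by move=> ij; apply: (integral_ge0_finite (fun x => expR_ge0 _)); exact: h1.
have main (a : {ffun 'I_n -> I}) :
   (\int[P]_x (\prod_j (\1_(Y j @^-1` D (a j)) x * h (rs`_(a j)) (Z j x)))%:E <=
    (\prod_j q j (a j))%:E)%E.
  pose f (k : 'I_n + 'I_n) : T -> R := match k with
    | inl j => fun x => h (rs`_(a j)) (Z j x)
    | inr j => \1_(Y j @^-1` D (a j)) end.
  pose mu (k : 'I_n + 'I_n) : R := match k with
    | inl j => nu (a j, j) | inr j => q j (a j) end.
  have -> : (\int[P]_x (\prod_j (\1_(Y j @^-1` D (a j)) x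
        * h (rs`_(a j)) (Z j x)))%:E = \int[P]_x (\prod_k f k x)%:E)%E.
    apply: eq_integral => x _; congr EFin.
    by rewrite big_split/= big_sumType/= mulrC.
  rewrite (independent_integral_prod indep mF (mu := mu)).
  - rewrite lee_fin big_sumType/= -[leRHS]mul1r.
    apply: ler_wpM2r; first exact: prodr_ge0.
    apply: (@le_trans _ _ (\prod_(j < n) 1)); last by rewrite big1.
    apply: ler_prod => j _.
    by have [_ -> ->] := hnu (a j, j).
  - move=> [j|j] B mB /=.
      have -> : (fun x => h rs`_(a j) (Z j x)) @^-1` B =
        Z j @^-1` (h rs`_(a j) @^-1` B) by [].
      by apply: FZ; rewrite -[_ @^-1` _]setTI; exact: mh.
    rewrite (_ : \1_(Y j @^-1` D (a j)) @^-1` B = Y j @^-1` (\1_(D (a j)) @^-1` B)).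
      by apply: FY; rewrite -[_ @^-1` _]setTI; exact: measurable_indic.
    by apply/seteqP; split => x.
  - by move=> [j|j] x //=; rewrite expR_ge0.
  - move=> [j|j] /=; last exact: qE.
    by have [-> _ _] := hnu (a j, j).
have f0 (a : {ffun 'I_n -> I}) x :
  0 <= \prod_j (\1_(Y j @^-1` D (a j)) x * h (rs`_(a j)) (Z j x)).
  by apply: prodr_ge0 => j _; rewrite mulr_ge0// expR_ge0.
have -> : (\int[P]_x (\prod_j h (g (Y j x)) (Z j x))%:E = \int[P]_x
   \sum_(a : {ffun 'I_n -> I})
     (\prod_j (\1_(Y j @^-1` D (a j)) x * h (rs`_(a j)) (Z j x)))%:E)%E.
  apply: eq_integral => x _; rewrite sumEFin -(bigA_distr_bigA
    (fun j i => \1_(Y j @^-1` D i) x * h (rs`_i) (Z j x))); congr EFin.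
  apply: eq_bigr => j _.
  exact/esym/(sum_indicator_range g (fun a => h a (Z j x)) (Y j x)).
rewrite ge0_integral_sum//; last 2 first.
- move=> a; apply/measurable_EFinP; apply: measurable_prod => j _.
  by apply: measurable_funM => //; exact: measurable_indic.
- by move=> a x _; rewrite lee_fin.
apply: (@le_trans _ _ (\sum_(a : {ffun 'I_n -> I}) (\prod_j q j (a j))%:E)%E).
  by apply: lee_sum => a _; exact: main.
by rewrite sumEFin -bigA_distr_bigA lee_fin big1.
Qed.

(* Conditionally on the noise the sum of the Y_j Z_j is subgaussian with variance proxy
   V times the sum of the Y_j ^ 2; the conditioning is done on simple approximations of
   the noise. *)
Lemma noise_product_mgf (s : R) :
  (\int[P]_x (expR (s * \sum_j Y j x * Z j x
     - s ^+ 2 * V / 2 * \sum_j Y j x ^+ 2))%:E <= 1)%E.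
Proof.
have mid : measurable_fun [set: R] (fun y : R => (s * y)%:E).
  by apply/measurable_EFinP; exact: measurable_funM.
have [g cvg_g] := approximation_sfun measurableT mid.
pose f k x := (\prod_j h (g k (Y j x)) (Z j x))%:E.
have fE k x : f k x = (expR (\sum_j (g k (Y j x) * Z j x
    - g k (Y j x) ^+ 2 * V / 2)))%:E by rewrite expR_sum.
have cvgf x : f ^~ x @ \oo --> (expR (s * \sum_j Y j x * Z j x
     - s ^+ 2 * V / 2 * \sum_j Y j x ^+ 2))%:E.
  under eq_fun do rewrite fE.
  apply: cvg_EFin; first by near=> k.
  rewrite [X in X @ _ --> _](_ : _ = (fun k => expR (\sum_j (g k (Y j x) * Z j x
    - g k (Y j x) ^+ 2 * V / 2)))); last by apply/funext.
  apply: continuous_cvg; first exact: continuous_expR.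
  have -> : s * \sum_j Y j x * Z j x - s ^+ 2 * V / 2 * \sum_j Y j x ^+ 2 =
      \sum_j (s * Y j x * Z j x - (s * Y j x) ^+ 2 * V / 2).
    by rewrite sumrB !mulr_sumr; congr (_ - _); apply: eq_bigr => j _; ring.
  apply: cvgn_sum => j.
  have cg : (fun k => g k (Y j x)) @ \oo --> s * Y j x.
    by have /fine_cvgP[_] := cvg_g (Y j x) I.
  apply: cvgB; first exact: cvgMl.
  apply: cvgMl; apply: cvgMl.
  by rewrite expr2; under eq_fun do rewrite expr2; exact: cvgM.
have mf k : measurable_fun setT (f k).
  apply/measurable_EFinP; apply: measurable_prod => j _.
  have mg : measurable_fun setT (fun x => g k (Y j x)).
    by apply: measurableT_comp.
  apply: measurableT_comp => //; apply: measurable_funB => //.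
    exact: measurable_funM.
  do 2! apply: measurable_funM => //; exact: measurable_funX.
have f0 k x : (0 <= f k x)%E.
  by rewrite lee_fin; apply: prodr_ge0 => j _; rewrite expR_ge0.
have -> : (\int[P]_x (expR (s * \sum_j Y j x * Z j x
     - s ^+ 2 * V / 2 * \sum_j Y j x ^+ 2))%:E =
     \int[P]_x limn_einf (f ^~ x))%E.
  apply: eq_integral => x _; apply/esym.
  by rewrite (cvg_limn_einf_sup (cvgf x)).1.
(* Only an upper bound is wanted, so Fatou's lemma does without domination. *)
apply: le_trans (fatou P measurableT mf _) _ => //.
rewrite limn_einf_lim; apply: lime_le; first exact: is_cvg_einfs.
apply: nearW => k; apply: le_trans (simple_noise_mgf (g k)).
by apply: ereal_inf_lbound; exists k => /=.
Unshelve. all: by end_near. Qed.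

End NoiseProduct.

(** * Balancing sampling error against entropy *)

Section Levels.
Variable R : realType.

(** The sampling identities for q and Q have the same weights. With e = 1/(N+1), their difference
    expresses (1 - e)(qA - QA) as the mean deviation at the sampled means minus e times that at the
    atoms; since N > 0, dividing by 1 - e costs at most a factor 2. *)
Lemma maurey_deviation (I : finType) (p : I -> R) (N : nat)
    (qB QB : {ffun 'I_N.+1 -> I} -> R) (qa Qa : I -> R) (qA QA kap gN g1 : R) :
  (forall i, 0 <= p i) -> \sum_i p i = 1 -> (0 < N)%N -> 0 <= gN -> 0 <= QA ->
  (forall i, Qa i <= kap) ->
  \sum_f iid_weight p f * qB f =
    (1 - N.+1%:R^-1) * qA + N.+1%:R^-1 * \sum_i p i * qa i ->
  \sum_f iid_weight p f * QB f =
    (1 - N.+1%:R^-1) * QA + N.+1%:R^-1 * \sum_i p i * Qa i ->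
  (forall f, `|qB f - QB f| <= (QB f + kap / N.+1%:R) * gN) ->
  (forall i, `|qa i - Qa i| <= g1) ->
  `|qA - QA| <= 2 * ((QA + 2 * (kap / N.+1%:R)) * gN + N.+1%:R^-1 * g1).
Proof.
move=> p0 p1 N0 gN0 QA0 Qak qE QE hB ha.
set e : R := N.+1%:R^-1 in qE QE *.
have e0 : 0 <= e by rewrite invr_ge0.
have e2 : e <= 1 / 2.
  by rewrite /e mul1r lef_pV2 ?posrE// ler_nat.
have W0 (f : {ffun 'I_N.+1 -> I}) : 0 <= iid_weight p f by exact: prodr_ge0.
set dB := \sum_f iid_weight p f * (qB f - QB f).
set da := \sum_i p i * (qa i - Qa i).
have E : (1 - e) * (qA - QA) = dB - e * da.
  have -> : dB = \sum_f iid_weight p f * qB f - \sum_f iid_weight p f * QB f.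
    by rewrite -sumrB; apply: eq_bigr => f _; rewrite mulrBr.
  have -> : da = \sum_i p i * qa i - \sum_i p i * Qa i.
    by rewrite -sumrB; apply: eq_bigr => f _; rewrite mulrBr.
  by rewrite qE QE; ring.
have hQa : \sum_i p i * Qa i <= kap.
  apply: (@le_trans _ _ (\sum_i p i * kap)); last by rewrite -mulr_suml p1 mul1r.
  by apply: ler_sum => i _; exact: ler_wpM2l.
have hdB : `|dB| <= (QA + 2 * (kap * e)) * gN.
  apply: (@le_trans _ _ (\sum_f iid_weight p f * ((QB f + kap * e) * gN))).
    apply: le_trans (ler_norm_sum _ _ _) _; apply: ler_sum => f _.
    by rewrite normrM ger0_norm// ler_wpM2l.
  have -> : \sum_f iid_weight p f * ((QB f + kap * e) * gN) =
      (\sum_f iid_weight p f * QB f + kap * e *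
        \sum_(f : {ffun 'I_N.+1 -> I}) iid_weight p f) * gN.
    rewrite mulr_sumr -big_split/= mulr_suml; apply: eq_bigr => f _; ring.
  rewrite iid_weight_sum1// QE ler_wpM2r//.
  have := ler_wpM2l e0 hQa; have := mulr_ge0 e0 QA0; lra.
have hda : `|da| <= g1.
  apply: (@le_trans _ _ (\sum_i p i * g1)); last by rewrite -mulr_suml p1 mul1r.
  apply: le_trans (ler_norm_sum _ _ _) _; apply: ler_sum => i _.
  by rewrite normrM ger0_norm// ler_wpM2l.
have h1 : (1 - e) * `|qA - QA| <= (QA + 2 * (kap * e)) * gN + e * g1.
  have e1 : 0 <= 1 - e by lra.
  rewrite -{1}(ger0_norm e1) -normrM E; apply: le_trans (ler_normB _ _) _.
  by rewrite lerD// normrM ger0_norm// ler_wpM2l.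
have := normr_ge0 (qA - QA); move: h1; set z := `|_|; nra.
Qed.

Lemma sqrt_le_amgm (y a : R) : 0 <= y -> 0 < a -> Num.sqrt y <= a + y / (4 * a).
Proof.
move=> y0 a0; rewrite -(ler_pM2r (_ : 0 < 4 * a)); last by lra.
have -> : (a + y / (4 * a)) * (4 * a) = 4 * (a * a) + y by field; rewrite gt_eqF.
have := sqr_ge0 (2 * a - Num.sqrt y).
by have := sqr_sqrtr y0; rewrite !expr2; lra.
Qed.

(** The weighted sum of the bounds [P1] to [P4] of [exists_level]; the leading 1 comes from [P5]. *)
Definition level_const (kap K : R) : R :=
  1 + 18 * K ^+ 2 * (3 * kap + 2) + 6 * K * (3 * kap + 2)
    + 8 * K ^+ 2 * (kap + 1) + 4 * K * (kap + 1).

(* Balances the sampling error kap / N against the entropy cost N * D of a level. *)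
Lemma exists_level (kap K D mu Q : R) : 0 < kap -> 0 < K -> 0 < D -> D <= 1 ->
  0 < mu -> mu <= 1 -> 0 <= Q -> Q <= kap ->
  exists N : nat, [/\ (0 < N)%N, N.+1%:R <= kap / D + kap + 2 &
    2 * ((Q + 2 * (kap / N.+1%:R))
           * (K * (Num.sqrt (N.+1%:R * D) + N.+1%:R * D))
         + N.+1%:R^-1 * (2 * kap * (K * (Num.sqrt D + D)))) <=
    mu * Q + level_const kap K * (D / mu)].
Proof.
move=> k0 K0 D0 D1 mu0 mu1 Q0 Qk.
(* The error that is tolerated anyway; the cut at 1 keeps [r] below kap + 1. *)
pose e := Num.min (D / mu) 1.
have Dmu : D <= D / mu by rewrite ler_pdivlMr// ler_piMr// ltW.
have e0 : 0 < e by rewrite /e lt_min divr_gt0// ltr01.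
have e1 : e <= 1 by rewrite /e ge_min lexx orbT.
have eD : D <= e by rewrite /e le_min Dmu.
have emu : mu * e <= D.
  by rewrite mulrC -ler_pdivlMr// /e ge_min lexx.
pose r := Q + e.
have r0 : 0 < r by rewrite /r; lra.
have rk : r <= kap + 1 by rewrite /r; lra.
have kr0 : 0 <= kap / r by rewrite divr_ge0 ?ltW.
(* Enough draws for the sampling error kap/(N+1) to be at most [r], few enough for r (N+1) to stay
   bounded. *)
pose N := (Num.truncn (kap / r)).+1.
have /andP[tr1 tr2] : (Num.truncn (kap / r))%:R <= kap / r < N%:R.
  exact: truncn_itv.
have N2 : N.+1%:R <= kap / r + 2 by rewrite -!natr1; lra.
have N1 : kap / r <= N.+1%:R by rewrite -natr1; lra.
exists N; split => //.
  have : kap / r <= kap / D by rewrite ler_pM2l// lef_pV2 ?posrE ?(lt_le_trans D0)// /r; lra.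
  lra.
set n1 : R := N.+1%:R in N1 N2 *.
have n10 : 0 < n1 by rewrite ltr0n.
have kn : kap / n1 <= r by rewrite ler_pdivrMr// mulrC -ler_pdivrMr.
have kn0 : 0 <= kap / n1 by rewrite divr_ge0 ?(ltW k0) ?(ltW n10).
have rn : r * n1 <= 3 * kap + 2.
  have : r * n1 <= r * (kap / r + 2) by rewrite (ler_wpM2l (ltW r0)).
  have -> : r * (kap / r + 2) = kap + 2 * r by field; rewrite gt_eqF.
  lra.
set y := n1 * D; have y0 : 0 <= y by rewrite mulr_ge0 ?ltW.
have ry : r * y <= (3 * kap + 2) * D.
  by rewrite mulrA (ler_wpM2r (ltW D0)).
have ry0 : 0 <= r * y by rewrite mulr_ge0 ?(ltW r0).
have E0 : 0 < D / mu by rewrite divr_gt0.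
(* The weights mu/12 and mu/8 of the two square roots are chosen so that each ends up contributing
   mu r / 2. *)
have a0 : 0 < mu / (12 * K) by rewrite divr_gt0//; lra.
have sy : K * Num.sqrt y <= mu / 12 + 3 * K ^+ 2 * (y / mu).
  have := ler_wpM2l (ltW K0) (sqrt_le_amgm y0 a0).
  by have -> : K * (mu / (12 * K) + y / (4 * (mu / (12 * K)))) =
    mu / 12 + 3 * K ^+ 2 * (y / mu) by field; rewrite !gt_eqF.
have b0 : 0 < mu / (8 * K) by rewrite divr_gt0//; lra.
have sD : K * Num.sqrt D <= mu / 8 + 2 * K ^+ 2 * (D / mu).
  have := ler_wpM2l (ltW K0) (sqrt_le_amgm (ltW D0) b0).
  by have -> : K * (mu / (8 * K) + D / (4 * (mu / (8 * K)))) =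
    mu / 8 + 2 * K ^+ 2 * (D / mu) by field; rewrite !gt_eqF.
have sD0 : 0 <= K * Num.sqrt D by rewrite mulr_ge0 ?sqrtr_ge0// ltW.
have KD0 : 0 <= K * D by rewrite mulr_ge0 ?ltW.
have K20 : 0 <= K ^+ 2 by exact: sqr_ge0.
have sy0 : 0 <= K * Num.sqrt y by rewrite mulr_ge0 ?sqrtr_ge0// ltW.
have Ky0 : 0 <= K * y by rewrite mulr_ge0// ltW.
have -> : n1^-1 * (2 * kap * (K * (Num.sqrt D + D))) =
  2 * (kap / n1) * (K * Num.sqrt D + K * D) by ring.
move: kn kn0; move: (kap / n1) => z zr z0.
have Qr : Q <= r by rewrite /r lerDl ltW.
have T1 : (Q + 2 * z) * (K * (Num.sqrt y + y)) <=
    3 * r * (mu / 12 + 3 * K ^+ 2 * (y / mu) + K * y).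
  apply: ler_pM; first by rewrite addr_ge0// mulr_ge0.
  - by rewrite mulrDr addr_ge0.
  - by move: zr Qr; clear; lra.
  - by rewrite mulrDr lerD2r.
have T2 : 2 * z * (K * Num.sqrt D + K * D) <=
    2 * r * (mu / 8 + 2 * K ^+ 2 * (D / mu) + K * D).
  apply: ler_pM.
  - by rewrite mulr_ge0.
  - by rewrite addr_ge0.
  - by rewrite ler_pM2l.
  - by rewrite lerD2r.
have P1 : r * (3 * K ^+ 2 * (y / mu)) <= 3 * K ^+ 2 * (3 * kap + 2) * (D / mu).
  have -> : r * (3 * K ^+ 2 * (y / mu)) = 3 * K ^+ 2 * (r * y) / mu by ring.
  have -> : 3 * K ^+ 2 * (3 * kap + 2) * (D / mu) =
    3 * K ^+ 2 * ((3 * kap + 2) * D) / mu by ring.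
  by rewrite ler_pM2r ?invr_gt0// ler_wpM2l// mulr_ge0.
have P2 : r * (K * y) <= K * (3 * kap + 2) * (D / mu).
  have -> : r * (K * y) = K * (r * y) by ring.
  rewrite -mulrA ler_wpM2l ?(ltW K0)//; apply: le_trans ry _.
  by rewrite ler_wpM2l//; lra.
have P3 : r * (2 * K ^+ 2 * (D / mu)) <= 2 * K ^+ 2 * (kap + 1) * (D / mu).
  have -> : r * (2 * K ^+ 2 * (D / mu)) = 2 * K ^+ 2 * (D / mu) * r by ring.
  rewrite [leRHS]mulrAC ler_wpM2l// mulr_ge0 ?(ltW E0)//.
  by rewrite mulr_ge0.
have P4 : r * (K * D) <= K * (kap + 1) * (D / mu).
  have -> : r * (K * D) = K * (r * D) by ring.
  rewrite -mulrA ler_wpM2l ?(ltW K0)//.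
  by apply: ler_pM => //; rewrite ltW.
have P5 : mu * r <= mu * Q + D / mu by rewrite /r; lra.
apply: (@le_trans _ _ (2 * (3 * r * (mu / 12 + 3 * K ^+ 2 * (y / mu) + K * y) +
    2 * r * (mu / 8 + 2 * K ^+ 2 * (D / mu) + K * D)))).
  by rewrite ler_wpM2l// lerD.
rewrite /level_const; move: P1 P2 P3 P4 P5.
set A1 := r * (3 * _ * _); set A2 := r * (K * y); set A3 := r * (2 * _ * _).
set A4 := r * (K * D) => P1 P2 P3 P4 P5.
have -> : 2 * (3 * r * (mu / 12 + 3 * K ^+ 2 * (y / mu) + K * y) +
    2 * r * (mu / 8 + 2 * K ^+ 2 * (D / mu) + K * D)) =
  mu * r + 6 * A1 + 6 * A2 + 4 * A3 + 4 * A4.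
  by rewrite /A1 /A2 /A3 /A4; field; rewrite gt_eqF.
move: P1 P2 P3 P4 P5.
move: A1 A2 A3 A4 (D / mu) (mu * r) (mu * Q) => A1 A2 A3 A4 E mr mQ.
by clear; lra.
Qed.

End Levels.

(** * Sample moments in the regression model *)

Section Model.
Context d (T : measurableType d) (R : realType) (P : probability T R) (m n : nat).
Local Notation C := R[i].
Variables (rho : 'M[C]_m) (X : {RV P >-> borel_mx R m})
  (Xs : 'I_n -> {RV P >-> borel_mx R m}) (xi : {RV P >-> R})
  (xis : 'I_n -> {RV P >-> R}) (b0 b1 b2 : R).
Hypotheses (tr : trace_regression rho X Xs xi xis) (sg : subgaussian P X b0 b1 b2)
  (b1_gt0 : 0 < b1).

Let F (k : 'I_n + 'I_n) : set (set T) :=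
  match k with inl j => sigma_rv (Xs j) | inr j => sigma_rv (xis j) end.

Let indep : mutually_independent P F. Proof. exact: tr_indep tr. Qed.

Let mF k : F k `<=` measurable.
Proof.
by case: k => j _ [B mB <-]; rewrite setTI -[_ @^-1` _]setTI; exact: measurable_funP.
Qed.

Lemma measurable_entry_Re i j :
  measurable_fun setT (fun x : borel_mx R m => complex.Re ((x : 'M[C]_m) i j)).
Proof.
move=> _ U mU; rewrite setTI; apply: sub_sigma_algebra.
by exists i, j, U; split => //; left.
Qed.

Lemma measurable_entry_Im i j :
  measurable_fun setT (fun x : borel_mx R m => complex.Im ((x : 'M[C]_m) i j)).
Proof.
move=> _ U mU; rewrite setTI; apply: sub_sigma_algebra.
by exists i, j, U; split => //; right.
Qed.

Lemma measurable_pairing (A : 'M[C]_m) :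
  measurable_fun setT (pairing A : borel_mx R m -> R).
Proof.
have -> : (pairing A : borel_mx R m -> R) = (fun x : borel_mx R m => \sum_i \sum_j
    (complex.Re (A i j) * complex.Re ((x : 'M[C]_m) j i)
     - complex.Im (A i j) * complex.Im ((x : 'M[C]_m) j i))).
  apply/funext => x; rewrite /pairing /mxtrace Re_sum; apply: eq_bigr => i _.
  rewrite mxE Re_sum; apply: eq_bigr => j _.
  by case: (A i j) ((x : 'M[C]_m) j i) => [a b] [c e].
apply: measurable_sum => i; apply: measurable_sum => j; apply: measurable_funB.
  by apply: measurable_funM => //; exact: measurable_entry_Re.
by apply: measurable_funM => //; exact: measurable_entry_Im.
Qed.

Let mpX A : measurable_fun setT (fun w => pairing A (X w)).
Proof. exact: measurableT_comp (measurable_pairing A) _. Qed.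

Let mpXs A j : measurable_fun setT (fun w => pairing A (Xs j w)).
Proof. exact: measurableT_comp (measurable_pairing A) _. Qed.

Definition pop_sqnorm (A : 'M[C]_m) : R := normL2 P X A ^+ 2.

Lemma pop_sqnorm_ge0 A : 0 <= pop_sqnorm A.
Proof. exact: sqr_ge0. Qed.

Lemma integral_pairing_sqr A : A \is hermsymmx ->
  (\int[P]_w (pairing A (X w) ^+ 2)%:E = (pop_sqnorm A)%:E)%E.
Proof.
move=> hA; have [fin _ _ _] := sg.
have E : sqnormL2 P X A = (\int[P]_w (pairing A (X w) ^+ 2)%:E)%E.
  rewrite /sqnormL2 unlock; apply: eq_integral => w _; congr EFin.
  by rewrite normc_trdot_sqr//; exact: tr_X_herm tr w.
have i0 : (0 <= \int[P]_w (pairing A (X w) ^+ 2)%:E)%E.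
  by apply: integral_ge0 => w _; rewrite lee_fin sqr_ge0.
rewrite /pop_sqnorm /normL2 sqr_sqrtr ?E ?fine_ge0// fineK//.
by rewrite ge0_fin_numE// -E.
Qed.

Lemma sample_integral (phi : R -> R) A j : measurable_fun setT phi ->
  (forall y, 0 <= phi y) ->
  (\int[P]_w (phi (pairing A (Xs j w)))%:E =
   \int[P]_w (phi (pairing A (X w)))%:E)%E.
Proof.
move=> mphi phi0.
have mp : measurable_fun setT (fun x : borel_mx R m => phi (pairing A x)).
  exact: measurableT_comp mphi (measurable_pairing A).
exact: (same_law_integral (tr_Xs_law tr j) mp (fun x => phi0 _)).
Qed.

Lemma psi2_sample A j (c : R) : A \is hermsymmx -> b1 * normL2 P X A < c ->
  0 < c /\
  (\int[P]_w (expR (pairing A (Xs j w) ^+ 2 / c ^+ 2))%:E <= 2%:E)%E.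
Proof.
move=> hA hc; have [_ _ psi _] := sg.
have E : (fun w => Normc.normc (trdot A (X w))) = (fun w => `|pairing A (X w)|).
  apply/funext => w; apply/eqP; rewrite -(@eqrXn2 _ 2)//.
  - by rewrite normc_trdot_sqr ?(tr_X_herm tr w)// real_normK ?num_real.
  - by case: (trdot A (X w)) => a b; exact: sqrtr_ge0.
have lt : (psi2_norm P (fun w => `|pairing A (X w)|%R) < c%:E)%E.
  by rewrite -E; apply: le_lt_trans (psi A) _; rewrite lte_fin.
have mabs : measurable_fun setT (fun w => `|pairing A (X w)|).
  by apply: measurableT_comp.
have [c0 h] := psi2_expR_le mabs lt; split => //.
rewrite (sample_integral (phi := fun y => expR (y ^+ 2 / c ^+ 2))) => [| |y].
- apply: le_trans h; rewrite le_eqVlt; apply/orP; left; apply/eqP.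
  by apply: eq_integral => w _; rewrite real_normK ?num_real.
- by apply: measurable_expR_sqr.
- exact: expR_ge0.
Qed.

Lemma sample_mgf A j (s : R) : A \is hermsymmx ->
  (\int[P]_w (expR (s * pairing A (Xs j w)))%:E <=
    (expR (s ^+ 2 * (b0 ^+ 2 * pop_sqnorm A) / 2))%:E)%E.
Proof.
move=> hA; have [_ mgf _ _] := sg.
rewrite (sample_integral (phi := fun y => expR (s * y))) => [| |y].
- have := mgf A hA s; rewrite unlock mulrA; apply: le_trans.
  rewrite le_eqVlt; apply/orP; left; apply/eqP; apply: eq_integral => w _.
  by rewrite trdot_hermsymmx//; exact: tr_X_herm tr w.
- by apply: measurableT_comp => //; exact: measurable_funM.
- exact: expR_ge0.
Qed.

Let FX A j (B : set R) : measurable B ->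
  F (inl j) ((fun w => pairing A (Xs j w)) @^-1` B).
Proof.
move=> mB; exists (pairing A @^-1` B); last by rewrite setTI.
by rewrite -[_ @^-1` _]setTI; exact: measurable_pairing.
Qed.

Let Fxi j (B : set R) : measurable B -> F (inr j) (xis j @^-1` B).
Proof. by move=> mB; exists B => //; rewrite setTI. Qed.

Let FT k : F k setT.
Proof. by case: k => j; exists setT => //; rewrite setTI preimage_setT. Qed.

Let Fcst k (B : set R) : F k ((fun _ : T => 1) @^-1` B).
Proof.
rewrite preimage_cst; case: ifP => _; first exact: FT.
case: k => j; exists set0 => //; by rewrite setTI preimage_set0.
Qed.

(** Independence is given for design and noise jointly; the noise slots are filled with the constant
    1. *)
Lemma integral_prod_design (f : 'I_n -> R -> R) A (b : R) : 0 <= b ->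
  (forall j, measurable_fun setT (f j)) -> (forall j y, 0 <= f j y) ->
  (forall j, (\int[P]_w (f j (pairing A (Xs j w)))%:E <= b%:E)%E) ->
  (\int[P]_w (\prod_j f j (pairing A (Xs j w)))%:E <= (b ^+ n)%:E)%E.
Proof.
move=> bge0 mf f0 fb.
have /choice[v hv] : forall j, exists v,
    [/\ (\int[P]_w (f j (pairing A (Xs j w)))%:E = v%:E)%E, 0 <= v & v <= b].
  by move=> j; apply: integral_ge0_finite.
pose g (k : 'I_n + 'I_n) : T -> R :=
  match k with inl j => fun w => f j (pairing A (Xs j w)) | inr j => fun=> 1 end.
pose mu (k : 'I_n + 'I_n) : R := match k with inl j => v j | inr j => 1 end.
have -> : (\int[P]_w (\prod_j f j (pairing A (Xs j w)))%:E =
    \int[P]_w (\prod_k g k w)%:E)%E.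
  apply: eq_integral => w _; congr EFin.
  by rewrite big_sumType/= [X in _ = _ * X]big1// mulr1.
rewrite (independent_integral_prod indep mF (mu := mu)).
- rewrite lee_fin big_sumType/= [X in _ * X]big1// mulr1.
  have -> : b ^+ n = \prod_(j < n) b by rewrite prodr_const card_ord.
  apply: ler_prod => j _.
  by have [_ -> ->] := hv j.
- move=> [j|j] B mB; last exact: (Fcst (inr j) B).
  have mfB : measurable (f j @^-1` B) by rewrite -[_ @^-1` _]setTI; exact: mf.
  exact: (FX A j mfB).
- by move=> [j|j] w; [exact: f0|exact: ler01].
- move=> [j|j] /=; first by have [] := hv j.
  exact: integral_cst_probability.
Qed.

Lemma integral_prod_noise (f : R -> R) (b : R) : 0 <= b ->
  measurable_fun setT f -> (forall y, 0 <= f y) ->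
  (\int[P]_w (f (xi w))%:E <= b%:E)%E ->
  (\int[P]_w (\prod_j f (xis j w))%:E <= (b ^+ n)%:E)%E.
Proof.
move=> bge0 mf f0 fb.
have [v [iv v0 vb]] := integral_ge0_finite (fun w => f0 (xi w)) fb.
pose g (k : 'I_n + 'I_n) : T -> R :=
  match k with inl j => fun=> 1 | inr j => fun w => f (xis j w) end.
pose mu (k : 'I_n + 'I_n) : R := match k with inl j => 1 | inr j => v end.
have -> : (\int[P]_w (\prod_j f (xis j w))%:E = \int[P]_w (\prod_k g k w)%:E)%E.
  apply: eq_integral => w _; congr EFin.
  by rewrite big_sumType/= [X in _ = X * _]big1// mul1r.
rewrite (independent_integral_prod indep mF (mu := mu)).
- rewrite lee_fin big_sumType/= [X in X * _]big1// mul1r.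
  by rewrite prodr_const card_ord lerXn2r// nnegrE.
- move=> [j|j] B mB; first exact: (Fcst (inl j) B).
  have mfB : measurable (f @^-1` B) by rewrite -[_ @^-1` _]setTI; exact: mf.
  exact: (Fxi j mfB).
- by move=> [j|j] w; [exact: ler01|exact: f0].
- move=> [j|j] /=; first exact: integral_cst_probability.
  by rewrite -iv; apply: same_law_integral => //; exact: tr_xis_law tr j.
Qed.

(** [b] selects the side of the deviation and v <= 1 is the admissible range of [square_mgf] at c =
    2 b1 sqrt r. The factor 2 puts [c] strictly above the psi_2-norm, and [r] stands in for a
    squared norm that may be 0. *)
Lemma quadratic_mgf A (r v s : R) (b : bool) : A \is hermsymmx -> 0 < r ->
  pop_sqnorm A <= r -> 0 <= v -> v <= 1 ->
  s = (-1) ^+ b * (v / (8 * b1 ^+ 2 * r)) ->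
  (\int[P]_w (expR (s * \sum_j (pairing A (Xs j w) ^+ 2 - pop_sqnorm A)
     - n%:R * (8 * v ^+ 2)))%:E <= 1)%E.
Proof.
move=> hA r0 Ar v0 v1 sE.
pose c := 2 * b1 * Num.sqrt r.
have sr0 : 0 < Num.sqrt r by rewrite sqrtr_gt0.
have c2 : c ^+ 2 = 4 * b1 ^+ 2 * r.
  by rewrite /c exprMn sqr_sqrtr ?ltW// exprMn; ring.
have nc : b1 * normL2 P X A < c.
  apply: (@le_lt_trans _ _ (b1 * Num.sqrt r)).
    rewrite ler_pM2l// -[leLHS]ger0_norm ?sqrtr_ge0//.
    by rewrite -sqrtr_sqr ler_wsqrtr.
  by rewrite /c -mulrA ltr_pMl ?mulr_gt0// ltr1n.
have b12 : 0 < b1 ^+ 2 by rewrite exprn_gt0.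
have den0 : 0 < 8 * b1 ^+ 2 * r by rewrite !mulr_gt0.
have hs : `|s| <= (2 * c ^+ 2)^-1.
  rewrite sE normrM normrX normrN1 expr1n mul1r ger0_norm ?divr_ge0 ?(ltW den0)//.
  rewrite c2 (_ : 2 * (4 * b1 ^+ 2 * r) = 8 * b1 ^+ 2 * r); last by ring.
  by rewrite ler_pdivrMr// mulVf ?gt_eqF.
have s2 : 32 * s ^+ 2 * c ^+ 4 = 8 * v ^+ 2.
  rewrite sE exprMn -exprM mulnC exprM sqrrN expr1n expr1n mul1r.
  rewrite (_ : c ^+ 4 = (c ^+ 2) ^+ 2); last by rewrite -exprM.
  by rewrite c2; field; rewrite !gt_eqF.
pose f (y : R) := expR (s * (y ^+ 2 - pop_sqnorm A)).
have mf : measurable_fun setT f.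
  apply: measurableT_comp => //; apply: measurable_funM => //.
  by apply: measurable_funB.
have fj j : (\int[P]_w (f (pairing A (Xs j w)))%:E <= (expR (8 * v ^+ 2))%:E)%E.
  have [c0 hexp] := psi2_sample j hA nc.
  rewrite -s2; apply: square_mgf => //.
  rewrite (sample_integral (phi := fun y => y ^+ 2)) => [| |y].
  - exact: integral_pairing_sqr.
  - exact: measurable_funX.
  - exact: sqr_ge0.
have := integral_prod_design (expR_ge0 _) (fun=> mf) (fun _ y => expR_ge0 _) fj.
rewrite -expRM_natl => main.
rewrite (_ : (\int[P]_w _ = (expR (- (n%:R * (8 * v ^+ 2))))%:E *
    \int[P]_w (\prod_j f (pairing A (Xs j w)))%:E)%E); last first.
  rewrite -ge0_integralZl_EFin ?expR_ge0//; last 2 first.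
  - by move=> w _; rewrite lee_fin prodr_ge0// => j _; exact: expR_ge0.
  - apply/measurable_EFinP; apply: measurable_prod => j _.
    exact: measurableT_comp mf (mpXs A j).
  apply: eq_integral => w _; rewrite -EFinM -expR_sum -expRD; congr (expR _)%:E.
  by rewrite addrC -mulr_sumr.
apply: (@le_trans _ _ ((expR (- (n%:R * (8 * v ^+ 2))))%:E *
    (expR (n%:R * (8 * v ^+ 2)))%:E)%E).
  by rewrite lee_wpmul2l// lee_fin expR_ge0.
by rewrite -EFinM -expRD addNr expR0.
Qed.

Lemma noise_square_sum_mgf (q : R) :
  (\int[P]_x (expR (q * xi x ^+ 2))%:E <=
     (expR (8 * q * sigma_noise P xi ^+ 2))%:E)%E ->
  (\int[P]_w (expR (q * \sum_j xis j w ^+ 2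
     - n%:R * (8 * q * sigma_noise P xi ^+ 2)))%:E <= 1)%E.
Proof.
move=> hq; pose f (y : R) := expR (q * y ^+ 2).
have mf : measurable_fun setT f.
  by apply: measurableT_comp => //; apply: measurable_funM.
have := integral_prod_noise (expR_ge0 _) mf (fun y => expR_ge0 _) hq.
set e := 8 * q * _; rewrite -expRM_natl => main.
rewrite (_ : (\int[P]_w _ = (expR (- (n%:R * e)))%:E *
    \int[P]_w (\prod_j f (xis j w))%:E)%E); last first.
  rewrite -ge0_integralZl_EFin ?expR_ge0//; last 2 first.
  - by move=> w _; rewrite lee_fin prodr_ge0// => j _; exact: expR_ge0.
  - apply/measurable_EFinP; apply: measurable_prod => j _.
    exact: measurableT_comp mf _.
  apply: eq_integral => w _; rewrite -EFinM -expR_sum -expRD; congr (expR _)%:E.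
  by rewrite addrC -mulr_sumr.
apply: (@le_trans _ _ ((expR (- (n%:R * e)))%:E * (expR (n%:R * e))%:E)%E).
  by rewrite lee_wpmul2l// lee_fin expR_ge0.
by rewrite -EFinM -expRD addNr expR0.
Qed.

Lemma linear_noise_mgf A (s V : R) : A \is hermsymmx ->
  b0 ^+ 2 * pop_sqnorm A <= V ->
  (\int[P]_w (expR (s * \sum_j xis j w * pairing A (Xs j w)
     - s ^+ 2 * V / 2 * \sum_j xis j w ^+ 2))%:E <= 1)%E.
Proof.
move=> hA AV; apply: (noise_product_mgf indep mF) => [j B mB|j B mB|j a].
- exact: FX.
- exact: Fxi.
- apply: le_trans (sample_mgf j a hA) _; rewrite lee_fin ler_expR.
  by rewrite ler_pM2r ?invr_gt0// ler_wpM2l// sqr_ge0.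
Qed.

End Model.

(** * The sampling identity for empirical and population norms *)

Section AtomMeans.
Variables (R : realType) (m : nat).
Local Notation C := R[i].
Local Notation I := (grid_index m * bool)%type.

Definition atom_mean (N : nat) (f : {ffun 'I_N.+1 -> I}) : 'M[C]_m :=
  (N.+1%:R^-1 : R)%:C%C *: \sum_l signed_atom R (f l).

Lemma pairing_atom_mean N (f : {ffun 'I_N.+1 -> I}) x :
  pairing (atom_mean f) x = N.+1%:R^-1 * \sum_l pairing (signed_atom R (f l)) x.
Proof. by rewrite pairingZ pairing_sum. Qed.

Lemma hermsymmxZ (c : R) (A : 'M[C]_m) : A \is hermsymmx ->
  c%:C%C *: A \is hermsymmx.
Proof.
move=> hA; apply: hermsymmx_intro => i j; rewrite !mxE -(hermsymmx_conj i j hA).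
by apply: complex_eqP; rewrite ?(ReJ, ImJ, Re_rscale, Im_rscale); ring.
Qed.

Lemma hermsymmxD (A B : 'M[C]_m) : A \is hermsymmx -> B \is hermsymmx ->
  A + B \is hermsymmx.
Proof.
move=> hA hB; apply: hermsymmx_intro => i j; rewrite !mxE.
rewrite -(hermsymmx_conj i j hA) -(hermsymmx_conj i j hB).
by apply: complex_eqP; rewrite ?(ReJ, ImJ, ReD, ImD); ring.
Qed.

Lemma hermsymmx_sum (J : Type) (r : seq J) (A : J -> 'M[C]_m) :
  (forall j, A j \is hermsymmx) -> \sum_(j <- r) A j \is hermsymmx.
Proof.
move=> hA; elim: r => [|j r IH]; last by rewrite big_cons hermsymmxD.
rewrite big_nil; apply: hermsymmx_intro => i j; rewrite !mxE.
by apply: complex_eqP; rewrite ?(ReJ, ImJ)/= ?oppr0.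
Qed.

Lemma atom_mean_hermsymmx N (f : {ffun 'I_N.+1 -> I}) :
  atom_mean f \is hermsymmx.
Proof.
by apply: hermsymmxZ; apply: hermsymmx_sum => l; exact: signed_atom_hermsymmx.
Qed.

Lemma emp_sqnorm_maurey n (x : 'I_n -> 'M[C]_m) N (p : I -> R) :
  \sum_i p i = 1 ->
  \sum_(f : {ffun 'I_N.+1 -> I}) iid_weight p f * emp_sqnorm x (atom_mean f) =
  (1 - N.+1%:R^-1) * emp_sqnorm x (\sum_i (p i)%:C%C *: signed_atom R i)
  + N.+1%:R^-1 * \sum_i p i * emp_sqnorm x (signed_atom R i).
Proof.
move=> p1; rewrite /emp_sqnorm.
transitivity (n%:R^-1 * \sum_j \sum_(f : {ffun 'I_N.+1 -> I}) iid_weight p f *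
   (N.+1%:R^-1 * \sum_l pairing (signed_atom R (f l)) (x j)) ^+ 2).
  rewrite exchange_big mulr_sumr; apply: eq_bigr => f _ /=.
  rewrite mulrCA mulr_sumr; congr (_ * _); apply: eq_bigr => j _.
  by rewrite pairing_atom_mean.
under eq_bigr => j _ do
  rewrite (iid_weight_mean_square N p1 (fun i => pairing (signed_atom R i) (x j))).
rewrite big_split/= mulrDr -!mulr_sumr; congr (_ + _).
  rewrite mulrCA; congr (_ * (_ * _)); apply: eq_bigr => j _.
  by rewrite pairing_sum; under [in RHS]eq_bigr do rewrite pairingZ.
rewrite mulrCA; congr (_ * _); rewrite exchange_big mulr_sumr.
by apply: eq_bigr => i _ /=; rewrite mulrCA -mulr_sumr.
Qed.

End AtomMeans.

Section PopulationNorm.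
Context d (T : measurableType d) (R : realType) (P : probability T R) (m n : nat).
Local Notation C := R[i].
Local Notation I := (grid_index m * bool)%type.
Variables (rho : 'M[C]_m) (X : {RV P >-> borel_mx R m})
  (Xs : 'I_n -> {RV P >-> borel_mx R m}) (xi : {RV P >-> R})
  (xis : 'I_n -> {RV P >-> R}) (b0 b1 b2 : R).
Hypotheses (tr : trace_regression rho X Xs xi xis) (sg : subgaussian P X b0 b1 b2)
  (b2_gt0 : 0 < b2).

Let mp (A : 'M[C]_m) : measurable_fun setT (fun w => pairing A (X w) ^+ 2).
Proof.
by apply: measurable_funX; exact: measurableT_comp (measurable_pairing A) _.
Qed.

Lemma integral_lincomb (J : finType) (c : J -> R) (A : J -> 'M[C]_m) :
  (forall j, 0 <= c j) -> (forall j, A j \is hermsymmx) ->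
  (\int[P]_w (\sum_j c j * pairing (A j) (X w) ^+ 2)%:E =
    (\sum_j c j * pop_sqnorm X (A j))%:E)%E.
Proof.
move=> c0 hA; under eq_integral do rewrite -sumEFin.
rewrite ge0_integral_sum//; last 2 first.
- by move=> j; apply/measurable_EFinP; exact: measurable_funM.
- by move=> j w _; rewrite lee_fin mulr_ge0// sqr_ge0.
rewrite -sumEFin; apply: eq_bigr => j _; under eq_integral do rewrite EFinM.
rewrite ge0_integralZl_EFin//; last 2 first.
- by move=> w _; rewrite lee_fin sqr_ge0.
- exact/measurable_EFinP.
by rewrite (integral_pairing_sqr tr sg (hA j)) EFinM.
Qed.

Lemma pop_sqnorm_maurey N (p : I -> R) : (forall i, 0 <= p i) -> \sum_i p i = 1 ->
  \sum_(f : {ffun 'I_N.+1 -> I}) iid_weight p f * pop_sqnorm X (atom_mean R f) =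
  (1 - N.+1%:R^-1) * pop_sqnorm X (\sum_i (p i)%:C%C *: signed_atom R i)
  + N.+1%:R^-1 * \sum_i p i * pop_sqnorm X (signed_atom R i).
Proof.
move=> p0 p1.
have e0 : 0 <= 1 - (N.+1%:R : R)^-1 by rewrite subr_ge0 invf_le1// ler1n.
pose A := \sum_i (p i)%:C%C *: signed_atom R i; rewrite -/A.
have hA : A \is hermsymmx.
  by apply: hermsymmx_sum => i; apply: hermsymmxZ; exact: signed_atom_hermsymmx.
apply: EFin_inj; rewrite -integral_lincomb; last 2 first.
- by move=> f; exact: prodr_ge0.
- by move=> f; exact: atom_mean_hermsymmx.
(* Adjoining the mean [A] to the atoms makes the right-hand side a single nonnegative combination.
   Both sides are then integrals, and the identity is checked pointwise. *)
pose c (o : 'I_1 + I) : R :=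
  if o is inr i then N.+1%:R^-1 * p i else 1 - N.+1%:R^-1.
pose B (o : 'I_1 + I) : 'M[C]_m := if o is inr i then signed_atom R i else A.
transitivity (\sum_o c o * pop_sqnorm X (B o))%:E; last first.
  rewrite big_sumType/= big_ord1 mulr_sumr; congr (_ + _)%:E.
  by apply: eq_bigr => i _; rewrite -mulrA.
rewrite -integral_lincomb; last 2 first.
- by case=> [?|i] //=; rewrite mulr_ge0.
- by case=> [?|i] //=; exact: signed_atom_hermsymmx.
apply: eq_integral => w _; congr EFin.
rewrite big_sumType/= big_ord1.
under eq_bigr do rewrite pairing_atom_mean.
rewrite (iid_weight_mean_square N p1 (fun i => pairing (signed_atom R i) (X w))).
congr (_ * _ ^+ 2 + _).
  by rewrite /A pairing_sum; apply: eq_bigr => i _; rewrite pairingZ.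
by rewrite mulr_sumr; apply: eq_bigr => i _; rewrite mulrA.
Qed.

(** 36 is the bound of [norm2_signed_atom]: scale 6 times squared length 6. *)
Definition atom_bound : R := (36 * b2) ^+ 2.

Lemma pop_sqnorm_signed_atom i : pop_sqnorm X (signed_atom R i) <= atom_bound.
Proof.
have [_ _ _ h] := sg; apply: lerXn2r; rewrite ?nnegrE ?sqrtr_ge0//.
  by rewrite mulr_ge0// ltW.
by apply: le_trans (h _) _; rewrite mulrC ler_pM2r// norm2_signed_atom.
Qed.

Lemma pop_sqnorm_states_sub S S' : states S -> states S' ->
  pop_sqnorm X (S - S') <= atom_bound.
Proof.
move=> sS sS'; have m0 := states_gt0 sS.
have [p [p0 p1 ->]] := states_sub_decomposition m0 sS sS'.
set A := \sum_i _.
have hA : A \is hermsymmx.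
  by apply: hermsymmx_sum => i; apply: hermsymmxZ; exact: signed_atom_hermsymmx.
apply: (@le_trans _ _ (\sum_i p i * pop_sqnorm X (signed_atom R i))); last first.
  apply: (@le_trans _ _ (\sum_i p i * atom_bound)); last first.
    by rewrite -mulr_suml p1 mul1r.
  by apply: ler_sum => i _; rewrite ler_wpM2l// pop_sqnorm_signed_atom.
rewrite -lee_fin -(integral_pairing_sqr tr sg hA) -integral_lincomb//; last first.
  exact: signed_atom_hermsymmx.
apply: ge0_le_integral => //.
- by move=> w _; rewrite lee_fin sqr_ge0.
- exact/measurable_EFinP.
- apply/measurable_EFinP; apply: measurable_sum => i; exact: measurable_funM.
move=> w _; rewrite lee_fin /A pairing_sum.
under eq_bigr do rewrite pairingZ.
pose y i := pairing (signed_atom R i) (X w).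
set a := \sum_i _; change (a ^+ 2 <= \sum_i p i * y i ^+ 2).
(* Jensen's inequality for the square, as nonnegativity of a variance. *)
have : 0 <= \sum_i p i * (y i - a) ^+ 2.
  by apply: sumr_ge0 => i _; rewrite mulr_ge0// sqr_ge0.
have -> : \sum_i p i * (y i - a) ^+ 2 = \sum_i p i * y i ^+ 2 - a ^+ 2.
  transitivity (\sum_i (p i * y i ^+ 2 - 2 * a * (p i * y i) + a ^+ 2 * p i)).
    by apply: eq_bigr => i _; ring.
  by rewrite big_split sumrB/= -!mulr_sumr p1 -/a; ring.
by rewrite subr_ge0.
Qed.

End PopulationNorm.

(** * The good event *)

Section GoodEvent.
Context d (T : measurableType d) (R : realType) (P : probability T R) (m n : nat).
Local Notation C := R[i].
Local Notation I := (grid_index m * bool)%type.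
Variables (rho : 'M[C]_m) (X : {RV P >-> borel_mx R m})
  (Xs : 'I_n -> {RV P >-> borel_mx R m}) (xi : {RV P >-> R})
  (xis : 'I_n -> {RV P >-> R}) (b0 b1 b2 : R).
Hypotheses (tr : trace_regression rho X Xs xi xis) (sg : subgaussian P X b0 b1 b2)
  (b0_gt0 : 0 < b0) (b1_gt0 : 0 < b1) (b2_gt0 : 0 < b2) (n0 : (0 < n)%N).

Definition atom_count : R := #|{: I}|%:R.

Lemma atom_count_ge1 : 1 <= atom_count.
Proof.
rewrite ler1n; apply/card_gt0P.
by exists ([ffun=> ord0], true).
Qed.

(** With weight (8 [atom_count])^-(N+1) for each mean of N+1 atoms, the levels form a geometric
    series of sum at most 1/7. Two signs, the noise at the atoms and the noise energy total at most
    2/7 + 1/8 + 1/8 <= 1. *)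
Definition level_width (t : R) : R := t + ln (8 * atom_count).

Let c8_gt0 : 0 < 8 * atom_count.
Proof. by have := atom_count_ge1; lra. Qed.

Lemma level_width_gt0 t : 0 < t -> 0 < level_width t.
Proof.
move=> t0; rewrite /level_width addr_gt0// ln_gt0//.
by have := atom_count_ge1; lra.
Qed.

(** Bound for the sum of the xi_j^2 on the good event: 8 n sigma^2 from the moment bound, plus a
    deviation at exponent [q] for an event of weight 1/8. *)
Definition noise_energy (t q : R) : R :=
  n%:R * (8 * sigma_noise P xi ^+ 2) + (t + ln 8) / q.

(** A nearly optimal Chernoff parameter: it balances y/v + 8 v under the constraint v <= 1 of
    [quadratic_mgf]. *)
Lemma min1_sqrt_rate (y : R) : 0 < y ->
  let v := Num.min 1 (Num.sqrt y) in
  [/\ 0 < v, v <= 1, v <= Num.sqrt y & y / v <= Num.sqrt y + y].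
Proof.
move=> y0 v; have sy : 0 < Num.sqrt y by rewrite sqrtr_gt0.
have v0 : 0 < v by rewrite /v lt_min ltr01.
split => //; rewrite /v ?ge_min ?lexx ?orbT//.
rewrite /Num.min; case: ifP => _; first by rewrite divr1 lerDr ltW.
by rewrite -{1}(sqr_sqrtr (ltW y0)) expr2 mulfK ?gt_eqF// lerDl ltW.
Qed.

Lemma sum_level_weights (M : nat) :
  \sum_(N < M) atom_count ^+ N.+1 * expR (- (N.+1%:R * ln (8 * atom_count))) <=
  1 / 7 :> R.
Proof.
suff -> : \sum_(N < M) atom_count ^+ N.+1 *
    expR (- (N.+1%:R * ln (8 * atom_count))) = (1 - (8^-1) ^+ M) / 7.
  by rewrite ler_pM2r ?invr_gt0// gerBl exprn_ge0.
have c0 : atom_count != 0 by rewrite gt_eqF// (lt_le_trans ltr01)// atom_count_ge1.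
elim: M => [|M IH]; first by rewrite big_ord0 expr0 subrr mul0r.
rewrite big_ord_recr IH /= -mulrN expRM_natl expRN lnK ?posrE// -exprMn.
rewrite invfM mulrCA divff// mulr1 !exprS.
by field.
Qed.

Lemma good_event (t q : R) (M : nat) : 0 < t -> 0 < q ->
  (\int[P]_x (expR (q * xi x ^+ 2))%:E <=
     (expR (8 * q * sigma_noise P xi ^+ 2))%:E)%E ->
  exists E : set T, [/\ measurable E, ((1 - expR (- t))%:E <= P E)%E &
    forall w, E w ->
    (forall N, (N < M)%N -> forall f : {ffun 'I_N.+1 -> I},
      let y := N.+1%:R * (level_width t / n%:R) in
      `|emp_sqnorm (fun j => Xs j w) (atom_mean R f) - pop_sqnorm X (atom_mean R f)|
      <= (pop_sqnorm X (atom_mean R f) + atom_bound b2 / N.+1%:R)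
         * (72 * b1 ^+ 2 * (Num.sqrt y + y))) /\
    (forall i : I,
       emp_noise (fun j => Xs j w) (fun j => xis j w) (signed_atom R i) <=
       n%:R^-1 * Num.sqrt (2 * level_width t * (b0 ^+ 2 * atom_bound b2)
         * noise_energy t q))].
Proof.
move=> t0 q0 hq.
have nR0 : (0 : R) < n%:R by rewrite ltr0n.
have x00 := level_width_gt0 t0; set x0 := level_width t in x00 *.
have ln8 : 0 < ln 8 :> R by apply: ln_gt0; rewrite (ltr_nat _ 1 8).
set V := b0 ^+ 2 * atom_bound b2.
have V0 : 0 < V by rewrite /V /atom_bound mulr_gt0 ?exprn_gt0// mulr_gt0.
set Vn := noise_energy t q.
have Vn0 : 0 < Vn.
  rewrite /Vn /noise_energy ltr_wpDl//; last by rewrite divr_gt0// addr_gt0.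
  by rewrite mulr_ge0 ?(ltW nR0)// mulr_ge0// sqr_ge0.
(* Minimizes x0/s + s V Vn / 2, the Chernoff bound for the noise at an atom once the noise energy is
   at most [Vn]. *)
set s0 := Num.sqrt (2 * x0 / (V * Vn)).
pose J := ({N : 'I_M & {ffun 'I_N.+1 -> I}} * bool + (I + 'I_1))%type.
pose y (N : nat) : R := N.+1%:R * (x0 / n%:R).
pose v N := Num.min 1 (Num.sqrt (y N)).
pose r N (f : {ffun 'I_N.+1 -> I}) : R :=
  pop_sqnorm X (atom_mean R f) + atom_bound b2 / N.+1%:R.
have ab0 : 0 < atom_bound b2 by rewrite /atom_bound exprn_gt0// mulr_gt0.
have r0 N (f : {ffun 'I_N.+1 -> I}) : 0 < r N f.
  by rewrite /r ltr_wpDl ?pop_sqnorm_ge0// divr_gt0.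
have y0 N : 0 < y N by rewrite mulr_gt0// divr_gt0.
pose s N (f : {ffun 'I_N.+1 -> I}) (b : bool) : R :=
  (-1) ^+ b * (v N / (8 * b1 ^+ 2 * r N f)).
pose aq N (f : {ffun 'I_N.+1 -> I}) b w : R :=
  s N f b * \sum_j (pairing (atom_mean R f) (Xs j w) ^+ 2
     - pop_sqnorm X (atom_mean R f)) - n%:R * (8 * v N ^+ 2).
pose an i w : R := s0 * \sum_j xis j w * pairing (signed_atom R i) (Xs j w)
  - s0 ^+ 2 * V / 2 * \sum_j xis j w ^+ 2.
pose ae w : R := q * \sum_j xis j w ^+ 2
  - n%:R * (8 * q * sigma_noise P xi ^+ 2).
pose a (k : J) : T -> R := match k with
  | inl (existT N f, b) => aq N f b
  | inr (inl i) => an i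
  | inr (inr _) => ae end.
pose W (k : J) : R := match k with
  | inl (existT N _, _) => expR (- (N.+1%:R * ln (8 * atom_count)))
  | inr (inl _) => (8 * atom_count)^-1
  | inr (inr _) => 8^-1 end.
have mpa (A : 'M[C]_m) j : measurable_fun setT (fun w => pairing A (Xs j w)).
  exact: measurableT_comp (measurable_pairing A) _.
have mxis2 : measurable_fun setT (fun w => \sum_j xis j w ^+ 2).
  by apply: measurable_sum => j; exact: measurable_funX.
have ma k : measurable_fun setT (a k).
  case: k => [[[N f] b]|[i|u]] /=; apply: measurable_funB => //.
  - apply: measurable_funM => //; apply: measurable_sum => j.
    by apply: measurable_funB => //; exact: measurable_funX.
  - apply: measurable_funM => //; apply: measurable_sum => j.
    exact: measurable_funM.
  - exact: measurable_funM.
  - exact: measurable_funM.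
have [E [mE PE hE]] : exists E : set T, [/\ measurable E,
    ((1 - expR (- t))%:E <= P E)%E &
    forall x, E x -> forall k, W k * expR (a k x) <= expR t].
  apply: (union_markov (f := fun k x => expR (a k x))).
  - by move=> k; exact: measurableT_comp.
  - by move=> k x; exact: expR_ge0.
  - case=> [[[N f] b]|[i|u]] /=.
    + apply: (quadratic_mgf tr sg b1_gt0 (r := r N f) (v := v N) (b := b)) => //.
      * exact: atom_mean_hermsymmx.
      * by rewrite /r lerDl divr_ge0 ?(ltW ab0).
      * by have [/ltW] := min1_sqrt_rate (y0 N).
      * by have [_] := min1_sqrt_rate (y0 N).
    + apply: (linear_noise_mgf tr sg) => //; first exact: signed_atom_hermsymmx.
      by rewrite ler_pM2l ?exprn_gt0//; exact: (pop_sqnorm_signed_atom sg).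
    + exact: (noise_square_sum_mgf tr hq).
  - case=> [[[N f] b]|[i|u]] /=; rewrite ?expR_ge0// invr_ge0//.
    exact: ltW.
  - rewrite !big_sumType/= big_ord1.
    have -> : \sum_(k : {N : 'I_M & {ffun 'I_N.+1 -> I}} * bool) W (inl k) =
      2 * \sum_(N < M) atom_count ^+ N.+1 * expR (- (N.+1%:R * ln (8 * atom_count))).
      rewrite (eq_bigr (fun k => W (inl (k.1, k.2)))); last by case.
      rewrite -(pair_bigA _ (fun k b => W (inl (k, b)))) /=.
      under eq_bigr do rewrite big_bool.
      rewrite mulr_sumr.
      pose e (N : 'I_M) := expR (- (N.+1%:R * ln (8 * atom_count))).
      transitivity (\sum_(N < M) \sum_(f : {ffun 'I_N.+1 -> I}) (e N + e N)).
        rewrite (sig_big_dep _ _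
          (fun (N : 'I_M) (f : {ffun 'I_N.+1 -> I}) => e N + e N)) /=.
        by apply: eq_bigr => -[N f] _.
      apply: eq_bigr => N _; rewrite sumr_const.
      have -> : #|{ffun 'I_N.+1 -> I}| = (#|{: I}| ^ N.+1)%N.
        by rewrite card_ffun card_ord.
      by rewrite -[LHS]mulr_natl natrX -/atom_count /e; ring.
    have -> : \sum_(i : I) W (inr (inl i)) = 8^-1.
      rewrite sumr_const -[LHS]mulr_natl -/atom_count invfM mulrCA divff ?mulr1//.
      by rewrite gt_eqF// (lt_le_trans ltr01)// atom_count_ge1.
    by have := sum_level_weights M; lra.
exists E; split => // w Ew; have {hE}hE := hE w Ew.
have exp_le (l z : R) : expR (- l) * expR z <= expR t -> z <= t + l.
  by rewrite -expRD ler_expR; lra.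
(* Comes first: it replaces the random variance in the noise bound by a constant. *)
have sq : \sum_j xis j w ^+ 2 <= Vn.
  have := hE (inr (inr ord0)); rewrite /= -[8^-1](@lnK R) ?posrE//.
  rewrite lnV ?posrE// => /exp_le h.
  rewrite -(ler_pM2l q0) /Vn /noise_energy.
  have -> : q * (n%:R * (8 * sigma_noise P xi ^+ 2) + (t + ln 8) / q) =
    n%:R * (8 * q * sigma_noise P xi ^+ 2) + (t + ln 8) by field; rewrite gt_eqF.
  by move: h; rewrite /ae; lra.
split.
- move=> N NM f; rewrite -/x0 -/(y N).
  have [v0 v1 vs yv] := min1_sqrt_rate (y0 N); rewrite -/(v N) in v0 v1 vs yv.
  set A := atom_mean R f; set D := emp_sqnorm _ A - _.
  have sumE : \sum_j (pairing A (Xs j w) ^+ 2 - pop_sqnorm X A) = n%:R * D.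
    rewrite sumrB sumr_const card_ord -[pop_sqnorm X A *+ n]mulr_natl /D.
    by rewrite /emp_sqnorm; field; rewrite gt_eqF.
  pose u := v N / (8 * b1 ^+ 2 * r N f).
  have den0 : 0 < 8 * b1 ^+ 2 * r N f by rewrite mulr_gt0// mulr_gt0// exprn_gt0.
  have u0 : 0 < u by rewrite divr_gt0.
  have side (b : bool) : (-1) ^+ b * (u * D) <= y N + 8 * v N ^+ 2.
    have := hE (inl (existT _ (Ordinal NM) f, b)); rewrite /= => /exp_le.
    rewrite /aq sumE /s -/u => h.
    rewrite -(ler_pM2l nR0).
    have -> : n%:R * (y N + 8 * v N ^+ 2) =
      N.+1%:R * x0 + n%:R * (8 * v N ^+ 2).
      by rewrite /y; field; rewrite gt_eqF.
    have tx : t + N.+1%:R * ln (8 * atom_count) <= N.+1%:R * x0.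
      rewrite /x0 /level_width mulrDr lerD2r -{1}[t]mul1r ler_pM2r//.
      by rewrite (ler_nat _ 1).
    have -> : n%:R * ((-1) ^+ b * (u * D)) = (-1) ^+ b * u * (n%:R * D) by ring.
    lra.
  have uD : u * `|D| <= y N + 8 * v N ^+ 2.
    have [D0|D0] := lerP 0 D.
      by rewrite ger0_norm//; have := side false; rewrite expr0 mul1r.
    by rewrite ltr0_norm//; have := side true; rewrite expr1; lra.
  have : `|D| <= (y N + 8 * v N ^+ 2) / u by rewrite ler_pdivlMr// mulrC.
  move/le_trans; apply.
  have -> : (y N + 8 * v N ^+ 2) / u = r N f * (8 * b1 ^+ 2 * (y N / v N + 8 * v N)).
    rewrite /u; field; rewrite !gt_eqF//.
  rewrite /r ler_wpM2l//; first exact: ltW (r0 N f).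
  (* 72 = 8 * 9, from y/v + 8 v <= 9 (sqrt y + y). *)
  have -> : 72 * b1 ^+ 2 * (Num.sqrt (y N) + y N) =
    8 * b1 ^+ 2 * (9 * (Num.sqrt (y N) + y N)) by ring.
  rewrite ler_wpM2l//; first by rewrite mulr_ge0// sqr_ge0.
  by have := y0 N; lra.
- move=> i; rewrite /emp_noise ler_pM2l ?invr_gt0//.
  set Z := \sum_j _.
  have VVn : 0 < V * Vn by rewrite mulr_gt0.
  have s00 : 0 < s0 by rewrite sqrtr_gt0 divr_gt0// mulr_gt0.
  have h : s0 * Z <= x0 + s0 ^+ 2 * V / 2 * Vn.
    have h1 := hE (inr (inl i)).
    have {h1} : expR (- ln (8 * atom_count)) * expR (an i w) <= expR t.
      by rewrite expRN lnK ?posrE.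
    move=> /exp_le; rewrite /an -/Z -/x0 => h1.
    have : s0 ^+ 2 * V / 2 * (\sum_j xis j w ^+ 2) <= s0 ^+ 2 * V / 2 * Vn.
      apply: ler_wpM2l => //; rewrite divr_ge0// mulr_ge0 ?(ltW V0)//.
      exact: sqr_ge0.
    by move: h1; rewrite -[t + _]/x0; lra.
  have s02 : s0 ^+ 2 = 2 * x0 / (V * Vn).
    by rewrite sqr_sqrtr// divr_ge0 ?(ltW VVn)// mulr_ge0// ltW.
  rewrite -(ler_pM2l s00).
  have -> : s0 * Num.sqrt (2 * x0 * V * Vn) = 2 * x0.
    rewrite /s0 -sqrtrM; last by rewrite divr_ge0 ?(ltW VVn)// mulr_ge0// ltW.
    have -> : 2 * x0 / (V * Vn) * (2 * x0 * V * Vn) = (2 * x0) ^+ 2.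
      by field; rewrite !gt_eqF.
    by rewrite sqrtr_sqr ger0_norm// mulr_ge0// ltW.
  apply: le_trans h _; rewrite s02.
  have -> : 2 * x0 / (V * Vn) * V / 2 * Vn = x0 by field; rewrite !gt_eqF.
  lra.
Qed.

End GoodEvent.

(** * Comparison with the stated rates *)

Section RateComparison.
Variable R : realType.

Lemma ln2_ge_half : 1 / 2 <= ln 2 :> R.
Proof.
have h : 0 < 2 :> R by [].
by have := ln_ge_1subV h; lra.
Qed.

Lemma t_m_gt0 (t : R) (m : nat) : 0 < t -> (0 < m)%N -> 0 < t_m t m.
Proof.
move=> t0 m0; rewrite /t_m ltr_wpDr// ln_ge0// -natrM ler1n.
by rewrite muln_gt0.
Qed.

Lemma ln2_le_ln2m (m : nat) : (0 < m)%N -> ln 2 <= ln (2 * m%:R) :> R.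
Proof.
move=> m0; rewrite ler_ln ?posrE ?mulr_gt0 ?ltr0n//.
by rewrite ler_peMr// ler1n.
Qed.

Lemma level_width_le (t : R) (m : nat) : 0 < t -> (0 < m)%N ->
  level_width m t <= 8 * (m%:R * t_m t m).
Proof.
move=> t0 m0; have m1 : 1 <= m%:R :> R by rewrite ler1n.
have l2 := ln2_le_ln2m m0; have l0 := ln2_ge_half.
set L := ln (2 * m%:R) in l2.
have base0 : 0 < (m.*2.+2)%:R :> R by rewrite ltr0n.
(* An atom has 2m real coordinates with 2m + 2 values each, and a sign. *)
have cE : 8 * atom_count R m = 2 ^+ 4 * (m.*2.+2)%:R ^+ (m * 2) :> R.
  rewrite /atom_count card_prod card_bool card_ffun card_prod card_bool !card_ord.
  by rewrite natrM natrX; ring.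
rewrite /level_width cE lnM ?posrE ?exprn_gt0// !lnXn//.
(* 2m + 2 <= (2m)^2 for m >= 1, with equality at m = 1. *)
have lb : ln (m.*2.+2)%:R <= L + L :> R.
  rewrite /L -lnM ?posrE ?mulr_gt0 ?ltr0n// ler_ln ?posrE//; last first.
    by rewrite !mulr_gt0 ?ltr0n.
  by rewrite -addn2 -addnn !natrD; nra.
rewrite -[ln _ *+ (m * 2)]mulr_natl natrM -[ln 2 *+ 4]mulr_natl /t_m -/L.
have := ler_wpM2l (ler0n R m) lb.
have : (m%:R - 1) * L >= 0 by rewrite mulr_ge0 ?subr_ge0//; lra.
have : (m%:R - 1) * t >= 0 by rewrite mulr_ge0 ?subr_ge0// ltW.
move: l2 l0 m1 t0; set M : R := m%:R; set l := ln 2; set z := ln _.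
by clearbody L M l z; clear; nra.
Qed.

Lemma ln8_width_le (t : R) (m : nat) : 0 < t -> (0 < m)%N ->
  t + ln 8 <= 3 * t_m t m.
Proof.
move=> t0 m0; have l2 := ln2_le_ln2m m0.
have -> : (8 : R) = 2 ^+ 3 by rewrite !exprS expr0; ring.
by rewrite lnXn// /t_m -[ln 2 *+ 3]mulr_natl; lra.
Qed.

Lemma rate_fast_ge (t c : R) (m n : nat) : 0 < t -> (0 < m)%N -> (0 < n)%N ->
  c * (Num.sqrt m%:R * t_m t m / n%:R) <= rate_fast t n m c /\
  m%:R * t_m t m / n%:R <= rate_fast t n m c.
Proof.
move=> t0 m0 n0; have tm0 := t_m_gt0 t0 m0.
have nR0 : (0 : R) < n%:R by rewrite ltr0n.
have h : Num.sqrt m%:R * t_m t m / n%:R <= Num.sqrt m%:R * t_nm t n m / n%:R.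
  rewrite ler_pM2r ?invr_gt0// ler_wpM2l ?sqrtr_ge0//.
  by rewrite /t_nm le_max lexx orbT.
have p0 : 0 <= Num.sqrt m%:R * t_m t m / n%:R.
  by rewrite divr_ge0 ?(ltW nR0)// mulr_ge0 ?sqrtr_ge0// ltW.
have mx : Num.sqrt m%:R <= Num.max c (Num.sqrt m%:R) by rewrite le_max lexx orbT.
have cx : c <= Num.max c (Num.sqrt m%:R) by rewrite le_max lexx.
have step (z : R) : z <= Num.max c (Num.sqrt m%:R) ->
    z * (Num.sqrt m%:R * t_m t m / n%:R) <= rate_fast t n m c.
  move=> zx; apply: (@le_trans _ _ (Num.max c (Num.sqrt m%:R) *
      (Num.sqrt m%:R * t_m t m / n%:R))); first exact: ler_wpM2r.
  rewrite /rate_fast ler_wpM2l//; apply: le_trans mx; exact: sqrtr_ge0.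
split; first exact: step.
have := step _ mx; rewrite !mulrA -expr2 sqr_sqrtr//.
Qed.

(* lambda is cut at 1, which costs only the [rate_fast] term. *)
Lemma oracle_arith (a b e L NB Dm lam mu B kk dc : R) :
  0 <= a -> 0 <= b -> 0 <= e -> 0 < lam -> mu = Num.min lam 1 / 4 ->
  0 <= dc -> 0 <= kk ->
  (1 - mu) * (a + b) <= (1 + mu) * e + 3 * (dc * Dm) + 2 * NB + L ->
  Dm <= 64 * B -> NB <= kk * B -> L <= B -> 0 <= B ->
  a <= (1 + lam) * e + 2 * (192 * dc + 2 * kk + 1) * B /\
  b <= (1 + lam) * e + 2 * (192 * dc + 2 * kk + 1) * B.
Proof.
move=> a0 b0' e0 lam0 muE dc0 kk0 h hDm hNB hL B0.
have l0 : 0 < Num.min lam 1 by rewrite lt_min lam0 ltr01.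
have l1 : Num.min lam 1 <= 1 by rewrite ge_min lexx orbT.
have ll : Num.min lam 1 <= lam by rewrite ge_min lexx.
have mu0 : 0 < mu by rewrite muE divr_gt0.
have mu4 : mu <= 1 / 4 by rewrite muE; lra.
have mul : 4 * mu <= lam by rewrite muE; lra.
have hdc := ler_wpM2l dc0 hDm.
set G := (192 * dc + 2 * kk + 1) * B.
have GE : 2 * (192 * dc + 2 * kk + 1) * B = 2 * G by rewrite /G; ring.
have G0 : 0 <= G by apply: mulr_ge0 => //; lra.
have hG : (1 - mu) * (a + b) <= (1 + mu) * e + G by rewrite /G; lra.
have le : 4 * mu * e <= lam * e by rewrite ler_wpM2r.
have m1 : 0 < 1 - mu by lra.
(* As mu <= 1/4 and 4 mu <= lam, dividing by 1 - mu turns 1 + mu into at most 1 + lam and 1 into at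
   most 2. *)
have fin z : 0 <= a + b - z -> z <= (1 + lam) * e + 2 * G.
  move=> hz; rewrite -(ler_pM2l m1); apply: (@le_trans _ _ ((1 + mu) * e + G)).
    by apply: le_trans hG; rewrite ler_pM2l//; lra.
  have h1 : (1 - mu) * (4 * mu * e) <= (1 - mu) * (lam * e) by rewrite ler_pM2l.
  have h2 : mu * (mu * e) <= 1 / 4 * (mu * e) by rewrite ler_wpM2r// mulr_ge0// ltW.
  have h3 : mu * G <= 1 / 4 * G by rewrite ler_wpM2r.
  have h4 : 0 <= mu * e by rewrite mulr_ge0// ltW.
  by move: h1 h2 h3 h4 G0 e0; clear; lra.
by rewrite GE; split; apply: fin; lra.
Qed.

Lemma le_add3 (a k x y z : R) : a <= k -> k <= z -> 0 <= x -> 0 <= y ->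
  a <= x + y + z.
Proof. by lra. Qed.

Lemma deviation_arith (mu K a b e qa qb qe z NB L : R) :
  `|qa - a| <= mu * a + K -> `|qb - b| <= mu * b + K -> `|qe - e| <= mu * e + K ->
  qb + qa <= qe + 2 * z + L -> z <= NB ->
  (1 - mu) * (a + b) <= (1 + mu) * e + 3 * K + 2 * NB + L.
Proof.
rewrite !ler_norml => /andP[h1 _] /andP[h2 _] /andP[_ h3] h4 h5; lra.
Qed.

Lemma scaled_rate_le (r B l : R) : r <= B -> 0 <= B -> 0 < l ->
  8 * (r * l) <= 64 * B * (l / 4).
Proof.
move=> rB B0 l0; have := ler_wpM2r (ltW l0) rB.
by have := mulr_ge0 B0 (ltW l0); lra.
Qed.

End RateComparison.

(** * The oracle inequality *)

Section Oracle.
Context d (T : measurableType d) (R : realType) (P : probability T R) (m n : nat).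
Local Notation C := R[i].
Local Notation I := (grid_index m * bool)%type.
Variables (rho : 'M[C]_m) (X : {RV P >-> borel_mx R m})
  (Xs : 'I_n -> {RV P >-> borel_mx R m}) (xi : {RV P >-> R})
  (xis : 'I_n -> {RV P >-> R}) (b0 b1 b2 : R).
Hypotheses (tr : trace_regression rho X Xs xi xis) (sg : subgaussian P X b0 b1 b2)
  (b0_gt0 : 0 < b0) (b1_gt0 : 0 < b1) (b2_gt0 : 0 < b2) (n0 : (0 < n)%N)
  (xi_psi2 : (psi2_norm P xi < +oo)%E).

Definition dev_const : R := level_const (atom_bound b2) (72 * b1 ^+ 2).

(** A square root because [noise_rate_bound] compares squares; 256 rounds up the sum of 16 * 8 from
    the variance and 2 * 24 from the deviation of the noise energy. *)
Definition noise_rate_const : R :=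
  Num.sqrt (256 * (b0 ^+ 2 * atom_bound b2) * (noise_const R + 1)).

Lemma atom_bound_gt0 : 0 < atom_bound b2.
Proof. by rewrite /atom_bound exprn_gt0// mulr_gt0. Qed.

Lemma dev_const_ge0 : 0 <= dev_const.
Proof.
have k0 := atom_bound_gt0.
have K0 : 0 <= 72 * b1 ^+ 2 by rewrite mulr_ge0// sqr_ge0.
rewrite /dev_const /level_const; move: K0; set K := 72 * _ => K0.
by rewrite !addr_ge0// !mulr_ge0// ?addr_ge0 ?mulr_ge0 ?sqr_ge0// ltW.
Qed.

Lemma atom_mean_single (i : I) :
  atom_mean R ([ffun=> i] : {ffun 'I_1 -> I}) = signed_atom R i.
Proof. by rewrite /atom_mean big_ord1 ffunE invr1 scale1r. Qed.

(** The level supplied by [exists_level] is bounded independently of [mu] and of the states, so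
    finitely many levels control all differences at once. *)
Lemma states_sub_deviation (x : 'I_n -> 'M[C]_m) (D : R) (M : nat) :
  0 < D -> D <= 1 -> atom_bound b2 / D + atom_bound b2 + 2 < M%:R ->
  (forall N, (N < M)%N -> forall f : {ffun 'I_N.+1 -> I},
    `|emp_sqnorm x (atom_mean R f) - pop_sqnorm X (atom_mean R f)|
    <= (pop_sqnorm X (atom_mean R f) + atom_bound b2 / N.+1%:R)
       * (72 * b1 ^+ 2 * (Num.sqrt (N.+1%:R * D) + N.+1%:R * D))) ->
  forall (S S' : 'M[C]_m) (mu : R), states S -> states S' -> 0 < mu -> mu <= 1 ->
  `|emp_sqnorm x (S - S') - pop_sqnorm X (S - S')| <=
    mu * pop_sqnorm X (S - S') + dev_const * (D / mu).
Proof.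
move=> D0 D1 hM hdev S S' mu sS sS' mu0 mu1.
have k0 := atom_bound_gt0.
have K0 : 0 < 72 * b1 ^+ 2 by rewrite mulr_gt0// exprn_gt0.
have Qk := pop_sqnorm_states_sub tr sg b2_gt0 sS sS'.
have [N [N0 NM hN]] := exists_level k0 K0 D0 D1 mu0 mu1 (pop_sqnorm_ge0 _ _) Qk.
have NltM : (N < M)%N by rewrite -(ltr_nat R) (le_lt_trans _ hM)// (le_trans _ NM)// ler_nat.
have M0 : (0 < M)%N by exact: leq_ltn_trans NltM.
have [p [p0 p1 E]] := states_sub_decomposition (states_gt0 sS) sS sS'.
apply: le_trans hN.
apply: (maurey_deviation (p := p)
  (qB := fun f => emp_sqnorm x (atom_mean R f))
  (QB := fun f => pop_sqnorm X (atom_mean R f))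
  (qa := fun i => emp_sqnorm x (signed_atom R i))
  (Qa := fun i => pop_sqnorm X (signed_atom R i))
  (kap := atom_bound b2)); [exact: p0|exact: p1|exact: N0| | | | | | |].
- by rewrite mulr_ge0 ?(ltW K0)// addr_ge0 ?sqrtr_ge0// mulr_ge0// ltW.
- exact: pop_sqnorm_ge0.
- exact: (pop_sqnorm_signed_atom sg).
- by rewrite E; exact: emp_sqnorm_maurey.
- by rewrite E; exact: (pop_sqnorm_maurey tr sg).
- exact: hdev.
(* An atom is a mean of one draw, so level 0 covers the atoms. *)
- move=> i; have := hdev 0%N M0 [ffun=> i]; rewrite atom_mean_single !mul1r divr1.
  move/le_trans; apply; rewrite ler_wpM2r//.
    by rewrite mulr_ge0 ?(ltW K0)// addr_ge0 ?sqrtr_ge0// ltW.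
  have := pop_sqnorm_signed_atom sg b2_gt0 i.
  by move=> h; rewrite mulr_natl mulr2n lerD2r.
Qed.

(** The variance part of the noise energy yields [rate_noise], and 1/q, of order [c_noise] squared,
    yields [rate_fast]. The additive 1 in the bound on 1/q is absorbed by the sqrt m inside
    [rate_fast]. *)
Lemma noise_rate_bound (t q B : R) : 0 < t -> (0 < m)%N -> 0 < q ->
  q^-1 <= noise_const R * c_noise P xi ^+ 2 + 1 ->
  rate_noise t n m (sigma_noise P xi) <= B -> rate_fast t n m (c_noise P xi) <= B ->
  n%:R^-1 * Num.sqrt (2 * level_width m t * (b0 ^+ 2 * atom_bound b2)
     * noise_energy n xi t q) <= noise_rate_const * B.
Proof.
move=> t0 m0 q0 hq hB2 hB4.
have nR0 : (0 : R) < n%:R by rewrite ltr0n.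
have mR1 : (1 : R) <= m%:R by rewrite ler1n.
have tm0 := t_m_gt0 t0 m0.
have [h4c h4] := rate_fast_ge (c_noise P xi) t0 m0 n0.
have x0le := level_width_le t0 m0; have x1le := ln8_width_le t0 m0.
have x00 := level_width_gt0 m t0.
have x10 : 0 < t + ln 8.
  by rewrite addr_gt0// ln_gt0// (ltr_nat R 1 8).
set s := sigma_noise P xi in hB2 *; set c := c_noise P xi in hq hB4 h4c h4 *.
have s0 : 0 <= s by exact: sqrtr_ge0.
set V := b0 ^+ 2 * atom_bound b2.
have V0 : 0 < V by exact: mulr_gt0 (exprn_gt0 2 b0_gt0) atom_bound_gt0.
have Kn0 := noise_const_gt0 R.
set H := m%:R * t_m t m / n%:R in h4.
have H0 : 0 < H by rewrite divr_gt0// mulr_gt0// (lt_le_trans ltr01).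
have B0 : 0 <= B by apply: le_trans hB2; rewrite mulr_ge0 ?sqrtr_ge0.
have BB0 : 0 <= B ^+ 2 by exact: sqr_ge0.
set g := Num.sqrt m%:R * t_m t m / n%:R in h4c.
have g0 : 0 <= g by rewrite divr_ge0 ?(ltW nR0)// mulr_ge0 ?sqrtr_ge0// ltW.
have gg : g ^+ 2 = m%:R * (t_m t m) ^+ 2 / n%:R ^+ 2.
  by rewrite /g !exprMn sqr_sqrtr// exprVn.
have gB : g ^+ 2 <= B ^+ 2.
  apply: lerXn2r; rewrite ?nnegrE//; apply: le_trans hB4; apply: le_trans h4.
  rewrite /g /H ler_pM2r ?invr_gt0// ler_pM2r//.
  rewrite -[leRHS](sqr_sqrtr (ler0n R m)) expr2 ler_peMr ?sqrtr_ge0//.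
  by rewrite -[leLHS]sqrtr1 ler_wsqrtr.
have cgB : c ^+ 2 * g ^+ 2 <= B ^+ 2.
  rewrite -exprMn -(real_normK (num_real (c * g))) normrM (ger0_norm g0).
  have c0 : 0 <= c.
    rewrite /c /c_noise; have := s0; rewrite le_eqVlt => /predU1P[sz|sp].
      by rewrite -/s -sz invr0 mulr0 ln0// mulr0.
    have [p0 L0] := psi2_sigma_gap (measurable_funPT xi) xi_psi2 sp.
    by rewrite mulr_ge0 ?(ltW p0)//; lra.
  have cg0 : 0 <= c * g by exact: mulr_ge0.
  rewrite ger0_norm//; apply: lerXn2r; rewrite ?nnegrE//.
  exact: le_trans h4c hB4.
have sHB : s ^+ 2 * H <= B ^+ 2.
  rewrite -(sqr_sqrtr (ltW H0)) -exprMn; apply: lerXn2r; rewrite ?nnegrE//.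
  exact: mulr_ge0 s0 (sqrtr_ge0 _).
set x0 := level_width m t in x0le x00 *; set x1 := t + ln 8 in x1le x10 *.
rewrite -(ger0_norm (_ : 0 <= n%:R^-1 * Num.sqrt _)); last first.
  by rewrite mulr_ge0 ?sqrtr_ge0// invr_ge0 ltW.
rewrite /noise_rate_const -/V -[leRHS]ger0_norm ?mulr_ge0 ?sqrtr_ge0//.
rewrite -(@ler_pXn2r _ 2) ?nnegrE ?normr_ge0// !real_normK ?num_real//.
have En0 : 0 <= noise_energy n xi t q.
  apply: addr_ge0; last exact: divr_ge0 (ltW x10) (ltW q0).
  apply: mulr_ge0 (ltW nR0) _; apply: mulr_ge0 => //; exact: sqr_ge0.
rewrite !exprMn !sqr_sqrtr; last 2 first.
- apply: mulr_ge0; last exact: addr_ge0 (ltW Kn0) ler01.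
  exact: mulr_ge0 (ler0n R 256) (ltW V0).
- apply: mulr_ge0 En0; apply: mulr_ge0 (ltW V0).
  exact: mulr_ge0 (ler0n R 2) (ltW x00).
rewrite /noise_energy -/s -/x1.
have -> : n%:R^-1 ^+ 2 * (2 * x0 * V * (n%:R * (8 * s ^+ 2) + x1 / q)) =
  V * (16 * (s ^+ 2 * (x0 / n%:R)) + 2 * (x0 * x1 / n%:R ^+ 2 * q^-1)).
  by field; rewrite !gt_eqF.
have -> : 256 * V * (noise_const R + 1) * B ^+ 2 =
  V * (256 * (noise_const R + 1) * B ^+ 2) by ring.
rewrite ler_pM2l//.
have T1 : s ^+ 2 * (x0 / n%:R) <= 8 * B ^+ 2.
  apply: (@le_trans _ _ (s ^+ 2 * (8 * H))); last by lra.
  rewrite ler_wpM2l ?sqr_ge0// /H mulrA ler_pM2r ?invr_gt0//.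
have T2 : x0 * x1 / n%:R ^+ 2 * q^-1 <=
    24 * g ^+ 2 * (noise_const R * c ^+ 2 + 1).
  apply: ler_pM => //.
    exact: divr_ge0 (mulr_ge0 (ltW x00) (ltW x10)) (sqr_ge0 _).
    by rewrite invr_ge0 ltW.
  rewrite gg mulrA ler_pM2r ?invr_gt0 ?exprn_gt0//.
  have -> : 24 * (m%:R * t_m t m ^+ 2) = (8 * (m%:R * t_m t m)) * (3 * t_m t m).
    by ring.
  by apply: ler_pM => //; rewrite ltW.
have T3 : noise_const R * (c ^+ 2 * g ^+ 2) <= noise_const R * B ^+ 2.
  by rewrite ler_pM2l.
have T4 : 0 <= noise_const R * B ^+ 2 by rewrite mulr_ge0// ltW.
by move: T1 T2 T3 T4 gB BB0; lra.
Qed.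

(** The last summand serves samples too small for the deviation bound, where only the L2-diameter of
    the states is used. *)
Definition oracle_const : R :=
  2 * (192 * dev_const + 2 * noise_rate_const + 1) + 8 * atom_bound b2.

Lemma oracle_event (eps t : R) (rhohat : T -> 'M[C]_m) : 0 <= eps <= 1 -> 0 < t ->
  (forall w : T, risk_argmin (fun j => Xs j w)
     (response rho (fun j => Xs j w) (fun j => xis j w)) eps (rhohat w)) ->
  exists E : set T, [/\ measurable E, ((1 - expR (- t))%:E <= P E)%E &
    forall w, E w -> forall (lambda : R) (S : 'M[C]_m), 0 < lambda -> states S ->
      let bound := (1 + lambda) * normL2 P X (S - rho) ^+ 2
        + oracle_const * Num.max (entropy_error eps S)
            (Num.max (rate_noise t n m (sigma_noise P xi))
            (Num.max (rate_lambda t n m lambda)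
                     (rate_fast t n m (c_noise P xi)))) in
      normL2 P X (rhohat w - S) ^+ 2 <= bound /\
      normL2 P X (rhohat w - rho) ^+ 2 <= bound].
Proof.
move=> eps01 t0 hhat.
have srho := tr_state tr; have m0 := states_gt0 srho.
have mxi : measurable_fun setT (xi : T -> R) by [].
have [q [q0 hq hmgf]] := noise_square_mgf mxi xi_psi2 ltr01.
pose D := level_width m t / n%:R.
have nR0 : (0 : R) < n%:R by rewrite ltr0n.
have D0 : 0 < D by rewrite divr_gt0// level_width_gt0.
pose M := (Num.truncn (atom_bound b2 / D + atom_bound b2 + 2)).+1.
have hM : atom_bound b2 / D + atom_bound b2 + 2 < M%:R.
  have k0 := atom_bound_gt0.
  have z0 : 0 <= atom_bound b2 / D + atom_bound b2 + 2.
    exact: addr_ge0 (addr_ge0 (divr_ge0 (ltW k0) (ltW D0)) (ltW k0)) (ler0n R 2).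
  by have /andP[] := truncn_itv z0.
have [E [mE PE hE]] := good_event tr sg b0_gt0 b1_gt0 b2_gt0 n0 M t0 q0 hmgf.
exists E; split => // w Ew lam S lam0 sS bound.
have [hdev hnoise] := hE w Ew.
have shat : states (rhohat w) by have [] := hhat w.
rewrite /bound {bound}; set B := Num.max (entropy_error eps S) _.
have B1 : entropy_error eps S <= B by rewrite /B le_max lexx.
have B2 : rate_noise t n m (sigma_noise P xi) <= B.
  by rewrite /B !le_max lexx !orbT.
have B3 : rate_lambda t n m lam <= B by rewrite /B !le_max lexx !orbT.
have B4 : rate_fast t n m (c_noise P xi) <= B by rewrite /B !le_max lexx !orbT.
have [_ HB4] := rate_fast_ge (c_noise P xi) t0 m0 n0.
have tm0 := t_m_gt0 t0 m0; have mR0 : (0 : R) < m%:R by rewrite ltr0n.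
set H := m%:R * t_m t m / n%:R in HB4.
have H0 : 0 < H by rewrite divr_gt0// mulr_gt0.
have B0 : 0 <= B by apply: le_trans B4; apply: le_trans HB4; exact: ltW.
have DH : D <= 8 * H.
  rewrite /D /H [leRHS]mulrA ler_pM2r ?invr_gt0//.
  exact: level_width_le.
have dc0 := dev_const_ge0.
have nr0 : 0 <= noise_rate_const by exact: sqrtr_ge0.
have k0 := atom_bound_gt0.
have e0 := pop_sqnorm_ge0 X (S - rho).
have CB : 0 <= 2 * (192 * dev_const + 2 * noise_rate_const + 1) * B.
  apply: mulr_ge0 B0; move: dc0 nr0.
  by move: (dev_const) (noise_rate_const) => u v; lra.
have kB0 : 0 <= 8 * atom_bound b2 * B by rewrite mulr_ge0// mulr_ge0// ltW.
have boundE : (1 + lam) * normL2 P X (S - rho) ^+ 2 + oracle_const * B =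
   (1 + lam) * pop_sqnorm X (S - rho)
   + 2 * (192 * dev_const + 2 * noise_rate_const + 1) * B + 8 * atom_bound b2 * B.
  by rewrite /oracle_const [X in _ + X = _]mulrDl addrA.
have le0 : 0 <= (1 + lam) * pop_sqnorm X (S - rho).
  by rewrite mulr_ge0// addr_ge0// ltW.
rewrite boundE.
(* If D > 1 then [rate_fast] exceeds 1/8, and the diameter bound already suffices. *)
have [D1|D1] := lerP D 1; last first.
  have kB : atom_bound b2 <= 8 * atom_bound b2 * B.
    have : 1 <= 8 * B by lra.
    by move=> h; rewrite mulrAC mulrC ler_peMr// ltW.
  have h1 := pop_sqnorm_states_sub tr sg b2_gt0 shat sS.
  have h2 := pop_sqnorm_states_sub tr sg b2_gt0 shat srho.
  by split; [exact: le_add3 h1 kB le0 CB|exact: le_add3 h2 kB le0 CB].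
pose mu := Num.min lam 1 / 4.
have lam'0 : 0 < Num.min lam 1 by rewrite lt_min lam0 ltr01.
have lam'1 : Num.min lam 1 <= 1 by rewrite ge_min lexx orbT.
have mu0 : 0 < mu by rewrite divr_gt0.
have mu1 : mu <= 1 by rewrite /mu; lra.
have dev := states_sub_deviation D0 D1 hM hdev.
have d1 := dev _ _ _ shat srho mu0 mu1.
have d2 := dev _ _ _ shat sS mu0 mu1.
have d3 := dev _ _ _ sS srho mu0 mu1.
have /andP[eps0 _] := eps01.
have fo := risk_argmin_first_order eps0 (hhat w) sS.
set x := fun j : 'I_n => _ in hdev hnoise dev d1 d2 d3 fo.
pose NB := n%:R^-1 * Num.sqrt (2 * level_width m t * (b0 ^+ 2 * atom_bound b2)
     * noise_energy n xi t q).
have hNB : emp_noise x (fun j => xis j w) (rhohat w - S) <= NB.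
  have [p [p0 p1 ->]] := states_sub_decomposition m0 shat sS.
  have -> : emp_noise x (fun j => xis j w) (\sum_i (p i)%:C%C *: signed_atom R i)
     = \sum_i p i * emp_noise x (fun j => xis j w) (signed_atom R i).
    rewrite /emp_noise; under eq_bigr => j _ do rewrite pairing_sum mulr_sumr.
    rewrite exchange_big mulr_sumr; apply: eq_bigr => i _ /=.
    rewrite mulrCA; congr (_ * _); rewrite mulr_sumr.
    by apply: eq_bigr => j _; rewrite pairingZ mulrCA.
  apply: (@le_trans _ _ (\sum_i p i * NB)); last by rewrite -mulr_suml p1 mul1r.
  by apply: ler_sum => i _; apply: ler_wpM2l => //; exact: hnoise.
have NBB : NB <= noise_rate_const * B by exact: noise_rate_bound.
have LB : eps * ln m%:R <= B by apply: le_trans B1; exact: entropy_error_ge.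
(* For lambda < 1 this is [rate_lambda]; otherwise mu = 1/4 and [rate_fast] dominates D. *)
have DmB : D / mu <= 64 * B.
  rewrite ler_pdivrMr// /mu /Num.min; case: ifP => _; last first.
    by apply: (le_trans DH); lra.
  have hl : H = rate_lambda t n m lam * lam.
    by rewrite /H /rate_lambda; field; rewrite !gt_eqF.
  apply: (le_trans DH); rewrite hl.
  exact: scaled_rate_le.
have key : (1 - mu) * (pop_sqnorm X (rhohat w - S) + pop_sqnorm X (rhohat w - rho)) <=
   (1 + mu) * pop_sqnorm X (S - rho) + 3 * (dev_const * (D / mu)) + 2 * NB
     + eps * ln m%:R.
  exact: deviation_arith d2 d1 d3 fo hNB.
have [h1 h2] := oracle_arith (pop_sqnorm_ge0 X _) (pop_sqnorm_ge0 X _) e0 lam0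
  (erefl mu) dc0 nr0 key DmB NBB LB B0.
by split; [exact: ler_wpDr kB0 h1|exact: ler_wpDr kB0 h2].
Qed.

End Oracle.

Theorem theorem7 (R : realType) (b0 b1 b2 : R)
    (b0_gt0 : 0 < b0) (b1_gt0 : 0 < b1) (b2_gt0 : 0 < b2) :
  exists C c : R, [/\ 0 < C, 0 < c &
  forall (d : measure_display) (T : measurableType d) (P : probability T R)
    (m n : nat) (rho : 'M[R[i]]_m)
    (X : {RV P >-> borel_mx R m}) (Xs : 'I_n -> {RV P >-> borel_mx R m})
    (xi : {RV P >-> R}) (xis : 'I_n -> {RV P >-> R}),
  (0 < n)%N ->
  trace_regression rho X Xs xi xis ->
  subgaussian P X b0 b1 b2 ->
  (psi2_norm P xi < +oo)%E ->
  forall (eps : R) (rhohat : T -> 'M[R[i]]_m),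
  0 <= eps <= 1 ->
  (forall w : T,
     risk_argmin (fun j => Xs j w)
       (response rho (fun j => Xs j w) (fun j => xis j w)) eps (rhohat w)) ->
  (forall (t lambda : R) (S : 'M[R[i]]_m),
     0 < t -> 0 < lambda -> tau_n t n <= c * lambda ^+ 2 * n%:R -> states S ->
     let bound := (1 + lambda) * normL2 P X (S - rho) ^+ 2
       + C * Num.max (entropy_error eps S)
            (Num.max (rate_noise t n m (sigma_noise P xi))
            (Num.max (rate_lambda t n m lambda)
                     (rate_fast t n m (c_noise P xi)))) in
     with_prob_ge P (1 - expR (- t))
       [set w | normL2 P X (rhohat w - S) ^+ 2 <= bound /\
                normL2 P X (rhohat w - rho) ^+ 2 <= bound]) /\
  (forall t : R, 0 < t ->
     with_prob_ge P (1 - expR (- t))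
       [set w | normL2 P X (rhohat w - rho) ^+ 2 <=
          C * Num.max (entropy_error eps rho)
             (Num.max (rate_noise t n m (sigma_noise P xi))
                      (rate_fast t n m (c_noise P xi)))])].
Proof.
exists (oracle_const b0 b1 b2), 1; split => //.
  have := dev_const_ge0 b1_gt0 b2_gt0.
  have : 0 <= noise_rate_const b0 b2 by exact: sqrtr_ge0.
  by have := atom_bound_gt0 b2_gt0; rewrite /oracle_const; lra.
move=> d T P m n rho X Xs xi xis n0 tr sg psi eps rhohat eps01 hhat.
split=> [t lam S t0 lam0 _ sS bound|t t0].
  have [E [mE PE hE]] := oracle_event tr sg b0_gt0 b1_gt0 b2_gt0 n0 psi eps01 t0 hhat.
  by exists E; split => // w Ew; exact: hE.
have [E [mE PE hE]] := oracle_event tr sg b0_gt0 b1_gt0 b2_gt0 n0 psi eps01 t0 hhat.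
have srho := tr_state tr; have m0 := states_gt0 srho.
exists E; split => // w Ew /=.
(* At S = rho the approximation error vanishes, and at lambda = 1 the lambda-rate is m t_m / n,
   which [rate_fast] dominates. *)
have [_] := hE w Ew 1 rho ltr01 srho.
have -> : normL2 P X (rho - rho) = 0.
  rewrite subrr; apply/eqP; rewrite eq_le sqrtr_ge0 andbT.
  have [_ _ _ h] := sg; apply: le_trans (h 0) _.
  by rewrite /norm2 /trdot mul0mx mxtrace0 /= sqrtr0 mulr0.
rewrite expr0n mulr0 add0r.
suff -> : Num.max (rate_lambda t n m 1) (rate_fast t n m (c_noise P xi)) =
  rate_fast t n m (c_noise P xi) by [].
have [_ h] := rate_fast_ge (c_noise P xi) t0 m0 n0.
by apply/max_idPr; rewrite /rate_lambda mulr1.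
Qed.
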